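(* (a) Let $p>\frac52$ be a real number. Then there exists $n_0=n_0(p)$ such that the following holds for all $n\ge n_0$. Let $G$ be a $Q_3$-free graph on $n$ vertices. Then $G$ is an extremal graph with $e_p(G)=\mathrm{ex}_p(n,Q_3)$ if and only if $G=K_3\vee L$ for some graph $L$ on $n-3$ vertices which is a disjoint union of copies of $C_3$ and $C_4$. (b) Let $d\ge 2$ be an integer, and $\alpha_d:=1-\frac{1}{d-1}+\frac{1}{(d-1)2^{d-1}}$. Let $p>\frac{1}{1-\alpha_d}$ be a real number. Then there exists $n_0=n_0(d,p)$ such that the following holds. For all $n\ge n_0$ with $n\equiv 2^{d-1}-1\pmod d$, if $G$ is a $Q_d$-free graph on $n$ vertices with $e_p(G)=\mathrm{ex}_p(n,Q_d)$, then $G\in\mathcal L(n,2^{d-1}-1,d-1)$.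
   Context: All graphs are finite, simple and undirected; graphs are considered up to isomorphism. $Q_d$ is the $d$-dimensional discrete hypercube: its vertices are all $(0,1)$-vectors of length $d$, two being adjacent if and only if they differ in exactly one coordinate. $C_m$ is the cycle on $m$ vertices. A graph is $F$-free if it does not contain $F$ as a (not necessarily induced) subgraph. For real $p>0$, $e_p(G)=\sum_{v\in V(G)}d_G(v)^p$, and $\mathrm{ex}_p(n,F)$ is the maximum of $e_p(G)$ over all $F$-free graphs $G$ on $n$ vertices; an extremal graph is an $F$-free graph on $n$ vertices attaining this maximum. The join $G\vee H$ is obtained from vertex-disjoint copies of $G$ and $H$ by adding all edges between them. A graph $L$ on $t$ vertices is near $\ell$-regular if it is $\ell$-regular when $\ell t$ is even, and otherwise has $t-1$ vertices of degree $\ell$ and one vertex of degree $\ell-1$. $\mathcal L(n,s,\ell)$ is the family of all graphs $K_s\vee L$ where $L$ is a near $\ell$-regular graph on $n-s$ vertices. *)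

(* Defs.v *)
From mathcomp Require Import all_boot all_order all_algebra.
From mathcomp Require Import all_classical all_reals all_analysis.
Set Implicit Arguments.
Unset Strict Implicit.
Unset Printing Implicit Defensive.
Import Order.TTheory GRing.Theory Num.Theory.
Local Open Scope ring_scope.

Record sgraph := SGraph {
  vertex :> finType;
  adj : rel vertex;
  adj_sym : symmetric adj;
  adj_irrefl : irreflexive adj }.

Definition degree (G : sgraph) (x : G) : nat := #|[set y : G | adj x y]|.

Definition graph_iso (G H : sgraph) : Prop :=
  exists2 f : G -> H, bijective f & forall x y, adj (f x) (f y) = adj x y.

(* Not necessarily induced: edges need not be reflected. *)
Definition contains (F G : sgraph) : Prop :=
  exists2 f : F -> G, injective f & forall x y, adj x y -> adj (f x) (f y).

Definition is_free (F G : sgraph) : Prop := ~ contains F G.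

Section Complete.
Variable s : nat.
Definition complete_adj : rel 'I_s := fun i j => i != j.
Fact complete_sym : symmetric complete_adj.
Proof. by move=> i j; rewrite /complete_adj eq_sym. Qed.
Fact complete_irrefl : irreflexive complete_adj.
Proof. by move=> i; rewrite /complete_adj eqxx. Qed.
Definition complete : sgraph := SGraph complete_sym complete_irrefl.
End Complete.

(* For m >= 3 this is the cycle C_m ([ordS] is the successor modulo m). *)
Section Cycle.
Variable m : nat.
Definition cycle_adj : rel 'I_m :=
  fun i j => (i != j) && ((j == ordS i) || (i == ordS j)).
Fact cycle_sym : symmetric cycle_adj.
Proof. by move=> i j; rewrite /cycle_adj eq_sym orbC. Qed.
Fact cycle_irrefl : irreflexive cycle_adj.
Proof. by move=> i; rewrite /cycle_adj eqxx. Qed.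
Definition cycle_graph : sgraph := SGraph cycle_sym cycle_irrefl.
End Cycle.

Section Hypercube.
Variable d : nat.
Definition hypercube_adj : rel {ffun 'I_d -> bool} :=
  fun x y => #|[set i | x i != y i]| == 1%N.
Fact hypercube_sym : symmetric hypercube_adj.
Proof.
move=> x y; rewrite /hypercube_adj; congr (_ == _); apply: eq_card => i.
by rewrite !inE eq_sym.
Qed.
Fact hypercube_irrefl : irreflexive hypercube_adj.
Proof.
move=> x; rewrite /hypercube_adj; apply/negbTE; rewrite (_ : [set _ | _] = finset.set0).
  by rewrite cards0.
by apply/setP => i; rewrite !inE eqxx.
Qed.
Definition hypercube : sgraph := SGraph hypercube_sym hypercube_irrefl.
End Hypercube.

Section Sum.
Variables (b : bool) (G H : sgraph).
Definition sum_adj : rel (G + H)%type := fun u v =>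
  match u, v with
  | inl x, inl y => adj x y
  | inr x, inr y => adj x y
  | _, _ => b
  end.
Fact sum_sym : symmetric sum_adj.
Proof. by move=> [x|x] [y|y] //=; rewrite adj_sym. Qed.
Fact sum_irrefl : irreflexive sum_adj.
Proof. by move=> [x|x] /=; rewrite adj_irrefl. Qed.
Definition sum_graph : sgraph := SGraph sum_sym sum_irrefl.
End Sum.

Definition join := sum_graph true.
Definition disjoint_union := sum_graph false.

Section Copies.
Variables (k : nat) (G : sgraph).
Definition copies_adj : rel ('I_k * G)%type :=
  fun u v => (u.1 == v.1) && adj u.2 v.2.
Fact copies_sym : symmetric copies_adj.
Proof. by move=> u v; rewrite /copies_adj eq_sym adj_sym. Qed.
Fact copies_irrefl : irreflexive copies_adj.
Proof. by move=> u; rewrite /copies_adj adj_irrefl andbF. Qed.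
Definition copies : sgraph := SGraph copies_sym copies_irrefl.
End Copies.

Definition union_of_C3_C4 (L : sgraph) : Prop :=
  exists a b : nat, graph_iso L
    (disjoint_union (copies a (cycle_graph 3)) (copies b (cycle_graph 4))).

Definition near_regular (l : nat) (L : sgraph) : Prop :=
  if odd (l * #|L|) then
    exists2 v : L, degree v = l.-1 & forall u : L, u != v -> degree u = l
  else forall v : L, degree v = l.

(* G belongs to the family L(n,s,l); s + |L| = n avoids truncated subtraction. *)
Definition join_near_regular (n s l : nat) (G : sgraph) : Prop :=
  exists L : sgraph,
    [/\ (s + #|L| = n)%N, near_regular l L & graph_iso G (join (complete s) L)].

Section DegreePowers.
Variables (R : realType) (p : R).

Definition deg_pow (G : sgraph) : R := \sum_(v : G) (degree v)%:R `^ p.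

Definition free_deg_pows (n : nat) (F : sgraph) : set R :=
  [set r | exists G : sgraph, [/\ #|G| = n, is_free F G & r = deg_pow G]]%classic.

(* This supremum is a maximum, see [ex_pow_ge] and [ex_pow_attained]. *)
Definition ex_pow (n : nat) (F : sgraph) : R := sup (free_deg_pows n F).

Definition extremal (n : nat) (F G : sgraph) : Prop :=
  [/\ #|G| = n, is_free F G & deg_pow G = ex_pow n F].

Let deg_val n (f : {ffun 'I_n -> 'I_n.+1}) : R := \sum_i (f i : nat)%:R `^ p.

Let deg_pow_val n (G : sgraph) :
  #|G| = n -> exists f : {ffun 'I_n -> 'I_n.+1}, deg_pow G = deg_val f.
Proof.
move=> <-; exists [ffun i => inord (degree (enum_val i))].
rewrite /deg_pow /deg_val (big_enum_val (A := vertex G)) /=.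
apply: eq_bigr => i _.
by rewrite ffunE inordK // ltnS max_card.
Qed.

Let free_deg_pows_max n (F G : sgraph) : #|G| = n -> is_free F G ->
  exists2 r, free_deg_pows n F r & ubound (free_deg_pows n F) r.
Proof.
move=> Gn GF; have [f0 Gf0] := deg_pow_val Gn.
have P0 : `[< free_deg_pows n F (deg_val f0) >].
  by apply/asboolP; exists G; split=> //; rewrite Gf0.
have [f /asboolP Pf fmax] :=
  Order.TotalTheory.arg_maxP (P := fun f => `[< free_deg_pows n F (deg_val f) >])
    (@deg_val n) P0.
exists (deg_val f) => // _ [H [Hn HF ->]]; have [g Hg] := deg_pow_val Hn.
by rewrite Hg; apply: fmax; apply/asboolP; exists H; split=> //; rewrite Hg.
Qed.

Lemma ex_pow_ge n F (G : sgraph) : #|G| = n -> is_free F G -> deg_pow G <= ex_pow n F.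
Proof.
move=> Gn GF; have [r _ rub] := free_deg_pows_max Gn GF.
by apply: ub_le_sup; [exists r | exists G].
Qed.

Lemma ex_pow_attained n F (G : sgraph) :
  #|G| = n -> is_free F G -> exists H, extremal n F H.
Proof.
move=> Gn GF; have [r Sr rub] := free_deg_pows_max Gn GF.
have [H [Hn HF rE]] := Sr; exists H; split=> //.
apply/eqP; rewrite eq_le ex_pow_ge //= -rE.
by apply: ge_sup => //; exists r.
Qed.

End DegreePowers.

Definition alpha (R : realType) (d : nat) : R :=
  1 - (d%:R - 1)^-1 + ((d%:R - 1) * 2 ^+ d.-1)^-1.

(* Main.v *)
Require Import Defs.
From mathcomp Require Import all_boot all_order all_algebra.
From mathcomp Require Import zify ring perm.

Set Implicit Arguments.
Unset Strict Implicit.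
Unset Printing Implicit Defensive.

(* Let N = 2^(d-1) and s = N - 1.

Few vertices of a Q_d-free graph have high degree: the number of vertices of degree at least D is at most
C (n/D)^q for some q < p.  For d = 3 one takes q = 5/2: in a bipartite Q_3-free graph, the bipartite graph
between the neighbourhoods of two vertices from opposite sides contains no hexagon avoiding them.  For
general d, repeated Cauchy-Schwarz reflections show that a dense bipartite graph has many homomorphisms from
Q_d and that few of them are degenerate.

Summing dyadically, the vertices of degree below e n contribute at most C e^(p-q) n^p to e_p.  So if e_p(G) is
at least that of K_s v L with L (d-1)-regular, almost all of it comes from boundedly many vertices of linear
degree.  The sum of their degrees is at most s n + O(1), and convexity yields a set W
of s vertices adjacent to almost all others.  Comparing the loss at W with the possible gain elsewhere shows
that W is adjacent to everything; then a vertex outside W has at most d - 1 neighbours outside W, because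
K_s v K_{1,d} contains Q_d, and the comparison forces equality.

For the graphs K_s v k K_d to be Q_d-free one needs that deleting s vertices from Q_d always leaves a
component with more than d vertices.  For d = 3, K_3 v P_5 also contains Q_3, and
a 2-regular graph without a path on five vertices is a disjoint union of triangles and quadrilaterals; conversely,
five vertices of Q_3 induce either a connected graph or one containing K_{1,3}. *)

(** * Reflections and homomorphisms from the cube *)

(** The exponent required for general d is 1/(1 - alpha_d) = N(d-1)/(N-1); for d = 3 it equals 8/3,
    so reaching 5/2 takes a separate argument. The general value arises as follows. A bipartite
    graph with parts A, B and e edges has at least e^(Nd) / (|A||B|)^(N(d-1)) homomorphisms from
    Q_d. If none is injective, a positive proportion of them is constant on a whole parity class, so
    maps the cube into a star, and stars are counted by degrees. When all m vertices of A have
    degree D this leads to m^(N-1) D^(N(d-1)) <= C n^(N(d-1)), up to a power of log m that comes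
    from the irregular degrees in B. The bound on p is strict, so the logarithm disappears in the
    choice of q. All counting stays in the natural numbers; real powers enter only with e_p.

    In both parts p >= 2, so x^p <= x^2 on [0,1]: this is the convexity that separates degrees near
    n from intermediate ones. One stability statement serves both parts: a Q_d-free graph whose e_p
    is at least the value computed for K_s v L, L being (d-1)-regular, is itself such a join. The
    congruence on n, or n - 3 >= 6, supplies a Q_d-free join to compare with. *)

Lemma sum_sqr_le (I : finType) (a b c : I -> nat) :
  (forall i, a i ^ 2 <= b i * c i) ->
  (\sum_i a i) ^ 2 <= (\sum_i b i) * (\sum_i c i).
Proof.
(* The inequality is doubled so that the terms (i,j) and (j,i) pair up and the arithmetic-geometric
   mean inequality applies without square roots. *)
move=> abc; suff le2 : (\sum_i a i) ^ 2 + (\sum_i a i) ^ 2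
    <= (\sum_i b i) * (\sum_i c i) + (\sum_i b i) * (\sum_i c i) by lia.
rewrite {2}[_ * \sum_i c i]mulnC -!mulnn !big_distrlr /= -!big_split /=.
apply: leq_sum => i _; rewrite -!big_split /=; apply: leq_sum => j _.
have Hi := abc i; have Hj := abc j.
have lexy : (a i * a j) ^ 2 <= (b i * c j) * (c i * b j).
  by rewrite expnMn; apply: leq_trans (leq_mul Hi Hj) _; lia.
rewrite addnn -leq_sqr -mul2n expnMn.
apply: leq_trans (nat_AGM2 (b i * c j) (c i * b j)).
by rewrite -[2 ^ 2]/4 leq_mul2l lexy orbT.
Qed.

Section Reflection.
Variables (I T : finType) (sg : I -> I) (F H : pred I).
Hypothesis sgK : involutive sg.
Hypothesis sg_fix : forall x, F x -> sg x = x.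
Hypothesis sg_F : forall x, F (sg x) = F x.
Hypothesis sg_H : forall x, ~~ F x -> H (sg x) = ~~ H x.

Let low x := F x || H x.
Let high x := F x || ~~ H x.

Definition reflect_fun (f : {ffun I -> T}) : {ffun I -> T} := [ffun x => f (sg x)].

Definition depends_on (D : pred I) (P : pred {ffun I -> T}) :=
  forall f g : {ffun I -> T}, (forall x, D x -> f x = g x) -> P f -> P g.

Let agree (f g : {ffun I -> T}) := [forall x, F x ==> (f x == g x)].

Let agreeP (f g : {ffun I -> T}) : reflect (forall x, F x -> f x = g x) (agree f g).
Proof.
apply: (iffP forallP) => [h x Fx|h x]; last by apply/implyP => /h ->.
by apply/eqP; apply: (implyP (h x)).
Qed.

(** The restriction to the mirror [F], padded with [None]; its values index the classes of functions
    that agree on [F], each of size [c]. *)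
Let key (f : {ffun I -> T}) : {ffun I -> option T} :=
  [ffun x => if F x then Some (f x) else None].

Let key_agree (f g : {ffun I -> T}) : (key f == key g) = agree f g.
Proof.
apply/eqP/agreeP => [/ffunP e x Fx|e]; first by move: (e x); rewrite !ffunE Fx => -[].
by apply/ffunP => x; rewrite !ffunE; case: ifP => // /e ->.
Qed.

Let c := \prod_(x : I) (if F x then 1 else #|T|).

Let card_class f : #|[set g | key g == key f]| = c.
Proof.
pose D x : pred T := if F x then pred1 (f x) else predT.
rewrite (eq_card (B := family D)) => [|g].
  rewrite card_family foldrE big_map big_enum /=; apply: eq_bigr => x _.
  by rewrite /D; case: (F x); rewrite ?card1.
rewrite inE key_agree; apply/agreeP/familyP => h x.
  by rewrite /D; case: ifP => // /h ->; rewrite inE.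
by move=> Fx; have := h x; rewrite /D Fx => /eqP.
Qed.

Let pairs (P Q : pred {ffun I -> T}) :=
  [set u : {ffun I -> T} * {ffun I -> T} | [&& key u.1 == key u.2, P u.1 & Q u.2]].

Let mix (f g : {ffun I -> T}) : {ffun I -> T} := [ffun x => if low x then f x else g x].

(** Exchanging the values of two functions off [low] is an involution on the pairs that agree on
    [F]. It moves both conditions onto the first function, since [P] reads only [low] and [Q] only
    [high]; the second function is then free in a class of size [c]. *)
Let card_pairs_mix (P Q : pred {ffun I -> T}) : depends_on low P -> depends_on high Q ->
  #|pairs P Q| = c * #|[set f | P f && Q f]|.
Proof.
move=> locP locQ.
have -> : c * #|[set f | P f && Q f]| = #|pairs (fun f => P f && Q f) predT|.
  rewrite -[RHS]sum1_card (partition_big fst (fun f => P f && Q f)) /=; last first.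
    by move=> u; rewrite inE => /and3P[].
  rewrite mulnC -sum_nat_const; apply: eq_big => [f|f]; rewrite inE // => Pf.
  rewrite -(card_class f) -sum1_card (reindex_onto (fun g => (f, g)) snd) /=.
    apply: eq_bigl => g; rewrite !inE /= Pf eqxx andbT; symmetry.
    by rewrite eqxx !andbT eq_sym.
  by case=> f' g /= /andP[_ /eqP <-].
pose h (u : {ffun I -> T} * {ffun I -> T}) := (mix u.1 u.2, mix u.2 u.1).
have hK u : h (h u) = u.
  by case: u => f g; rewrite /h /=; congr pair; apply/ffunP => x; rewrite !ffunE; case: (low x).
rewrite -(card_imset _ (can_inj hK)); congr #|pred_of_set _|.
apply/setP => u.
have -> : (u \in [set h x | x in pairs P Q]) = (h u \in pairs P Q).
  apply/imsetP/idP => [[v vP ->]|hu]; first by rewrite hK.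
  by exists (h u) => //; rewrite hK.
case: u => f g; rewrite !inE /= !key_agree andbT.
have -> : agree (mix f g) (mix g f) = agree f g.
  by apply/agreeP/agreeP => e x Fx; move: (e x Fx); rewrite !ffunE /low Fx.
case: agreeP => //= e; apply/andP/andP => -[Pf Qg]; split.
- by apply: locP Pf => x; rewrite ffunE => ->.
- apply: locQ Qg => x; rewrite ffunE /high /low.
  by case Fx: (F x); [rewrite (e _ Fx) | rewrite /= => /negbTE ->].
- by apply: locP Pf => x; rewrite ffunE => ->.
- apply: locQ Qg => x; rewrite ffunE /high /low.
  by case Fx: (F x); [rewrite (e _ Fx) | rewrite /= => /negbTE ->].
Qed.

Let N (P : pred {ffun I -> T}) k := #|[set f | (key f == k) && P f]|.

Let card_pairsE P Q : #|pairs P Q| = \sum_k N P k * N Q k.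
Proof.
rewrite -sum1_card (partition_big (fun u => key u.1) predT) //=.
apply: eq_bigr => k _; rewrite -cardsX -sum1_card; apply: eq_bigl => -[f g].
rewrite !inE /=; case: (key f =P k) => [<-|]; last by rewrite andbF.
by rewrite eq_sym andbT; case: (_ == _); case: (P f).
Qed.

Let reflect_funK : involutive reflect_fun.
Proof. by move=> f; apply/ffunP => x; rewrite !ffunE sgK. Qed.

Let N_reflect P k : N (fun f => P (reflect_fun f)) k = N P k.
Proof.
rewrite /N -(card_imset _ (can_inj reflect_funK)); congr #|pred_of_set _|; apply/setP => f.
have kr g : key (reflect_fun g) = key g.
  by apply/ffunP => x; rewrite !ffunE; case: ifP => // /sg_fix ->.
apply/imsetP/idP => [[g]|]; rewrite inE => /andP[/eqP kf Pf].
  by move=> ->; rewrite inE kr kf eqxx.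
by exists (reflect_fun f); rewrite ?reflect_funK // inE kr kf eqxx reflect_funK.
Qed.

Let depends_reflect D P :
  depends_on D P -> depends_on (fun x => D (sg x)) (fun f => P (reflect_fun f)).
Proof. by move=> loc f g e; apply: loc => x Dx; rewrite !ffunE e ?sgK. Qed.

(** Pairs agreeing on the mirror, the first satisfying [P1] and the second [P2], are counted by a
    sum of products over the classes, to which Cauchy-Schwarz applies. In the resulting square for
    [P1] the second function may be reflected, as reflection preserves every class; the pair then
    glues to one function that satisfies [P1] both directly and after reflection. *)
Lemma reflection_CS (P P1 P2 Q1 Q2 : pred {ffun I -> T}) :
    depends_on low P1 -> depends_on high P2 ->
    (forall f, P f -> P1 f && P2 f) ->
    (forall f, P1 f -> P1 (reflect_fun f) -> Q1 f) ->
    (forall f, P2 f -> P2 (reflect_fun f) -> Q2 f) ->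
  #|[set f | P f]| ^ 2 <= #|[set f | Q1 f]| * #|[set f | Q2 f]|.
Proof.
move=> loc1 loc2 PP PQ1 PQ2.
have [->|[f0 _]] := set_0Vmem [set f | P f]; first by rewrite cards0.
have c_gt0 : 0 < c.
  by rewrite -(card_class f0); apply/card_gt0P; exists f0; rewrite inE.
have le1 : c * #|[set f | P f]| <= #|pairs P1 P2|.
  rewrite card_pairs_mix // leq_mul2l; apply/orP; right; apply: subset_leq_card.
  by apply/subsetP => f; rewrite !inE => /PP.
have e1 : #|pairs P1 P1| <= c * #|[set f | Q1 f]|.
  have -> : #|pairs P1 P1| = #|pairs P1 (fun f => P1 (reflect_fun f))|.
    by rewrite !card_pairsE; apply: eq_bigr => k _; rewrite N_reflect.
  rewrite card_pairs_mix //; last first.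
    move=> f g e; apply: (depends_reflect loc1) => x; rewrite /low sg_F => lx.
    by apply: e; rewrite /high; case Fx: (F x) lx => //=; rewrite sg_H ?Fx.
  rewrite leq_mul2l; apply/orP; right; apply: subset_leq_card.
  by apply/subsetP => f; rewrite !inE => /andP[]; apply: PQ1.
have e2 : #|pairs P2 P2| <= c * #|[set f | Q2 f]|.
  have -> : #|pairs P2 P2| = #|pairs (fun f => P2 (reflect_fun f)) P2|.
    by rewrite !card_pairsE; apply: eq_bigr => k _; rewrite N_reflect.
  rewrite card_pairs_mix //; last first.
    move=> f g e; apply: (depends_reflect loc2) => x; rewrite /high sg_F => lx.
    by apply: e; rewrite /low; case Fx: (F x) lx => //=; rewrite sg_H ?Fx ?negbK.
  rewrite leq_mul2l; apply/orP; right; apply: subset_leq_card.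
  by apply/subsetP => f; rewrite !inE => /andP[P2r P2f]; apply: PQ2.
have CS : #|pairs P1 P2| ^ 2 <= #|pairs P1 P1| * #|pairs P2 P2|.
  by rewrite !card_pairsE; apply: sum_sqr_le => k; rewrite expnMn -!mulnn.
have c2_gt0 : 0 < c ^ 2 by rewrite expn_gt0 c_gt0.
rewrite -(leq_pmul2l c2_gt0) -expnMn.
apply: leq_trans (_ : #|pairs P1 P2| ^ 2 <= _); first by rewrite leq_sqr.
apply: leq_trans CS _; apply: leq_trans (leq_mul e1 e2) _.
by rewrite mulnACA mulnn.
Qed.

End Reflection.

(** * Parity classes and reflections of the cube *)

Section Cube.
Variable d : nat.
Notation Q := {ffun 'I_d -> bool}.

Definition flip (i : 'I_d) (x : Q) : Q := [ffun k => x k (+) (k == i)].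

Definition parity (x : Q) : bool := \big[addb/false]_i x i.

Lemma flipK i : involutive (flip i).
Proof. by move=> x; apply/ffunP => k; rewrite !ffunE -addbA addbb addbF. Qed.

Lemma flipC i j x : flip i (flip j x) = flip j (flip i x).
Proof. by apply/ffunP => k; rewrite !ffunE addbAC. Qed.

Lemma parity_flip i x : parity (flip i x) = ~~ parity x.
Proof.
rewrite /parity (eq_bigr (fun k => x k (+) (k == i))) => [|k _]; last by rewrite ffunE.
rewrite big_split /= -addbT; congr addb; rewrite (bigD1 i) //= eqxx big1 ?addbF // => k.
by move/negbTE.
Qed.

Lemma hypercube_adjP x y : reflect (exists i, y = flip i x) (hypercube_adj x y).
Proof.
apply: (iffP idP) => [/cards1P[i /setP xy]|[i ->]].
  exists i; apply/ffunP => k; rewrite !ffunE.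
  by move: (xy k); rewrite !inE; case: (x k) (y k) => -[] /= <-.
apply/cards1P; exists i; apply/setP => k; rewrite !inE ffunE.
by case: (x k) (k == i) => -[].
Qed.

End Cube.

Lemma card_parity d b : 0 < d -> #|[set x : {ffun 'I_d -> bool} | parity x == b]| = 2 ^ d.-1.
Proof.
case: d => // d' _; set E := fun b => [set x : {ffun 'I_d'.+1 -> bool} | parity x == b].
have EC c : #|E c| = #|E (~~ c)|.
  rewrite -(card_imset _ (can_inj (@flipK _ ord0))); congr #|pred_of_set _|; apply/setP => x.
  apply/imsetP/idP => [[y]|]; rewrite inE => /eqP px.
    by move=> ->; rewrite inE parity_flip px.
  by exists (flip ord0 x); rewrite ?flipK // inE parity_flip px negbK.
have : #|E b| + #|E (~~ b)| = 2 ^ d'.+1.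
  rewrite -cardsUI (_ : E b :&: E (~~ b) = set0) ?cards0 ?addn0.
    rewrite (_ : _ :|: _ = setT) ?cardsT ?card_ffun ?card_bool ?card_ord //.
    by apply/setP => x; rewrite !inE; case: parity b => -[].
  by apply/setP => x; rewrite !inE; case: parity b => -[].
by rewrite -EC addnn -mul2n expnS => /eqP; rewrite eqn_pmul2l // => /eqP.
Qed.

Section CubeReflection.
Variables (d : nat) (i j : 'I_d) (c : bool).
Hypothesis neq_ij : i != j.
Notation Q := {ffun 'I_d -> bool}.

(* For c = false this exchanges the coordinates i and j. *)
Definition cube_refl (x : Q) : Q := if x i (+) x j == c then x else flip i (flip j x).

Let ji : (j == i) = false.
Proof. by rewrite eq_sym (negbTE neq_ij). Qed.

Let ij : (i == j) = false.
Proof. exact: negbTE. Qed.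

Lemma cube_reflE (x : Q) : (cube_refl x i (+) cube_refl x j == c) = (x i (+) x j == c).
Proof.
rewrite /cube_refl; case: ifP => // <-; rewrite !ffunE !eqxx ij ji.
by case: (x i) (x j) => -[].
Qed.

Lemma cube_refl_i (x : Q) : x i (+) x j != c -> cube_refl x i = ~~ x i.
Proof. by rewrite /cube_refl => /negbTE ->; rewrite !ffunE eqxx ij addbF addbT. Qed.

Lemma cube_refl_id (x : Q) : x i (+) x j == c -> cube_refl x = x.
Proof. by rewrite /cube_refl => ->. Qed.

Lemma cube_reflK : involutive cube_refl.
Proof.
move=> x; rewrite {1}/cube_refl cube_reflE; case: ifP => Fx; rewrite /cube_refl Fx //.
by rewrite [flip i (flip j x)]flipC flipK flipK.
Qed.

Lemma parity_cube_refl x : parity (cube_refl x) = parity x.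
Proof. by rewrite /cube_refl; case: ifP => // _; rewrite !parity_flip negbK. Qed.

Lemma cube_refl_flip k (x : Q) : cube_refl (flip k x) = flip (tperm i j k) (cube_refl x).
Proof.
rewrite /cube_refl ffunE [flip k x j]ffunE.
case: tpermP => [->|->|/eqP ki /eqP kj].
- rewrite eqxx ji addbF addbT.
  by case: (x i) (x j) c => -[] [] //=; rewrite [flip i (flip j _)]flipC flipK.
- rewrite eqxx ij addbF addbT.
  by case: (x i) (x j) c => -[] [] //=; rewrite flipK.
- rewrite [i == k]eq_sym (negbTE ki) [j == k]eq_sym (negbTE kj) !addbF; case: ifP => // _.
  by rewrite [flip j (flip k x)]flipC flipC.
Qed.

End CubeReflection.

Section CubeCS.
Variables (d : nat) (T : finType).
Notation Q := {ffun 'I_d -> bool}.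

Definition low_half (i j : 'I_d) (c b : bool) : pred Q :=
  fun x => (x i (+) x j == c) || (x i == b).

Definition high_half (i j : 'I_d) (c b : bool) : pred Q :=
  fun x => (x i (+) x j == c) || (x i != b).

Lemma cube_CS (i j : 'I_d) (c b : bool) (P P1 P2 Q1 Q2 : pred {ffun Q -> T}) : i != j ->
    depends_on (low_half i j c b) P1 -> depends_on (high_half i j c b) P2 ->
    (forall f, P f -> P1 f && P2 f) ->
    (forall f, P1 f -> P1 (reflect_fun (cube_refl i j c) f) -> Q1 f) ->
    (forall f, P2 f -> P2 (reflect_fun (cube_refl i j c) f) -> Q2 f) ->
  #|[set f | P f]| ^ 2 <= #|[set f | Q1 f]| * #|[set f | Q2 f]|.
Proof.
move=> neq_ij; apply: reflection_CS => [|x|x|x].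
- exact: cube_reflK.
- exact: cube_refl_id.
- exact: cube_reflE.
- by move/cube_refl_i => /(_ neq_ij) ->; case: (x i) b => -[].
Qed.

Lemma low_half_refl i j c b x : i != j ->
  low_half i j c b (cube_refl i j c x) = high_half i j c b x.
Proof.
move=> neq_ij; rewrite /low_half /high_half cube_reflE //.
case Fx: (_ == c) => //=; rewrite cube_refl_i ?Fx //.
by case: (x i) b => -[].
Qed.

Lemma high_half_refl i j c b x : i != j ->
  high_half i j c b (cube_refl i j c x) = low_half i j c b x.
Proof. by move=> neq_ij; rewrite -[in RHS](cube_reflK c neq_ij x) low_half_refl. Qed.

Lemma low_half_flip i j c b k x : k != i -> k != j ->
  low_half i j c b (flip k x) = low_half i j c b x.
Proof. by move=> ki kj; rewrite /low_half !ffunE ![_ == k]eq_sym (negbTE ki) (negbTE kj) !addbF. Qed.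

Lemma high_half_flip i j c b k x : k != i -> k != j ->
  high_half i j c b (flip k x) = high_half i j c b x.
Proof. by move=> ki kj; rewrite /high_half !ffunE ![_ == k]eq_sym (negbTE ki) (negbTE kj) !addbF. Qed.

Lemma low_or_high i j c b x : low_half i j c b x || high_half i j c b x.
Proof. by rewrite /low_half /high_half; case: (_ == c); case: (_ == b). Qed.

Variables (A B : {set T}) (r : rel T).
Implicit Types (J : pred 'I_d) (D : pred Q) (f : {ffun Q -> T}).

Definition side (x : Q) : {set T} := if parity x then B else A.

(** Restricting to the points of [D] lets the condition depend on one half of the cube only, as
    [reflection_CS] requires; varying the set [J] of edge directions interpolates between the
    edgeless graph and the cube. Each edge is tested from its even end. *)
Definition hom_on (J : pred 'I_d) (D : pred Q) (f : {ffun Q -> T}) : bool :=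
  [forall x, D x ==> (f x \in side x)] &&
  [forall x, forall k, [&& D x, D (flip k x), ~~ parity x & J k] ==> r (f x) (f (flip k x))].

Lemma hom_onP J D (f : {ffun Q -> T}) :
  reflect ((forall x, D x -> f x \in side x) /\
           (forall x k, D x -> D (flip k x) -> ~~ parity x -> J k -> r (f x) (f (flip k x))))
    (hom_on J D f).
Proof.
apply: (iffP andP) => -[h1 h2]; split.
- by move=> x Dx; apply: (implyP (forallP h1 x)).
- move=> x k Dx Dk px Jk; apply: (implyP (forallP (forallP h2 x) k)).
  by rewrite Dx Dk px Jk.
- by apply/forallP => x; apply/implyP/h1.
- by apply/forallP => x; apply/forallP => k; apply/implyP => /and4P[]; apply: h2.
Qed.

Lemma hom_on_depends J D : depends_on D (hom_on J D).
Proof.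
move=> f g fg /hom_onP[h1 h2]; apply/hom_onP; split=> [x Dx|x k Dx Dk px Jk].
  by rewrite -fg ?h1.
by rewrite -!fg ?h2.
Qed.

Lemma hom_on_sub (J J' : pred 'I_d) (D D' : pred Q) (f : {ffun Q -> T}) :
  (forall k, J' k -> J k) -> (forall x, D' x -> D x) -> hom_on J D f -> hom_on J' D' f.
Proof.
move=> sJ sD /hom_onP[h1 h2]; apply/hom_onP; split=> [x /sD/h1 //|x k Dx Dk px Jk].
by apply: h2; rewrite ?sJ ?sD.
Qed.

Lemma hom_on_union (J J1 J2 : pred 'I_d) (D D1 D2 : pred Q) (f : {ffun Q -> T}) :
    (forall x, D x -> D1 x || D2 x) ->
    (forall x k, D x -> D (flip k x) -> J k ->
      [&& D1 x, D1 (flip k x) & J1 k] || [&& D2 x, D2 (flip k x) & J2 k]) ->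
  hom_on J1 D1 f -> hom_on J2 D2 f -> hom_on J D f.
Proof.
move=> hD hJ /hom_onP[h1 h2] /hom_onP[h3 h4]; apply/hom_onP; split=> [x /hD|x k Dx Dk px Jk].
  by case/orP => [/h1|/h3].
by case/orP: (hJ x k Dx Dk Jk) => /and3P[? ? ?]; [apply: h2 | apply: h4].
Qed.

Lemma hom_on_reflect (i j : 'I_d) (c : bool) J D (f : {ffun Q -> T}) : i != j ->
  hom_on J D (reflect_fun (cube_refl i j c) f) ->
  hom_on (fun k => J (tperm i j k)) (fun x => D (cube_refl i j c x)) f.
Proof.
move=> neq_ij /hom_onP[h1 h2]; apply/hom_onP; split=> [x /h1|x k Dx].
  by rewrite ffunE cube_reflK // /side parity_cube_refl.
rewrite cube_refl_flip // => Dk px Jk.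
have := h2 _ _ Dx Dk; rewrite !ffunE parity_cube_refl -cube_refl_flip // !cube_reflK //.
exact.
Qed.

Definition cube_hom J := hom_on J predT.

Definition nhom (J : pred 'I_d) := #|[set f | cube_hom J f]|.

(** On each four-cycle in the directions i and j, the set J + i prescribes two parallel edges. A
    reflection in one diagonal turns them into a path of two edges; a reflection in the other
    diagonal turns that path into the full four-cycle on one half and into no edge on the other. *)
Lemma nhom_logconvex J i j : i != j -> ~~ J i -> ~~ J j ->
  nhom (predU1 i J) ^ 2 <= nhom J * nhom (predU1 i (predU1 j J)).
Proof.
move=> neq_ij Ji Jj.
pose JJ : pred 'I_d := predU1 i (predU1 j J).
have ji : (j == i) = false by rewrite eq_sym (negbTE neq_ij).
have JN k : J k -> (k != i) && (k != j).
  by move=> Jk; apply/andP; split; apply/eqP => e; move: Jk; rewrite e ?(negbTE Ji) ?(negbTE Jj).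
have Jt k : J k -> tperm i j k = k.
  by move/JN/andP => [ki kj]; rewrite tpermD // eq_sym.
(* On every four-cycle, [K b] asks for the two edges that meet at the corner where both coordinates
   equal b. *)
pose K b f := cube_hom J f && hom_on JJ (low_half i j true b) f.
have step1 : nhom (predU1 i J) ^ 2 <= #|[set f | K true f]| * #|[set f | K false f]|.
  apply: (@cube_CS i j false false _ (hom_on (predU1 i J) (low_half i j false false))
    (hom_on (predU1 i J) (high_half i j false false))) => //.
  - exact: hom_on_depends.
  - exact: hom_on_depends.
  - by move=> f hf; rewrite !(hom_on_sub _ _ hf).
  - move=> f h1 /(hom_on_reflect neq_ij) h2; apply/andP; split.
      apply: (hom_on_union _ _ h1 h2) => [x _|x k _ _ Jk].
        by rewrite low_half_refl ?low_or_high.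
      have /andP[ki kj] := JN _ Jk.
      rewrite !low_half_refl // low_half_flip // high_half_flip // /= Jt // Jk orbT !andbT !andbb.
      exact: low_or_high.
    apply: (hom_on_union _ _ h1 h2) => [x _|x k].
      by rewrite low_half_refl ?low_or_high.
    rewrite !low_half_refl // => Dx Dk /or3P[/eqP ki|/eqP kj|Jk].
    + rewrite ki in Dk *; move: Dx Dk; rewrite /low_half /high_half !ffunE !eqxx ji.
      by rewrite /= eqxx; case: (x i) (x j) => -[].
    + rewrite kj in Dk *; move: Dx Dk; rewrite /low_half /high_half !ffunE !eqxx ?(negbTE neq_ij).
      by rewrite /= tpermR eqxx; case: (x i) (x j) => -[].
    have /andP[ki kj] := JN _ Jk.
    rewrite low_half_flip // high_half_flip // /= Jt // Jk ?orbT !andbT !andbb.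
    exact: low_or_high.
  - move=> f h1 /(hom_on_reflect neq_ij) h2; apply/andP; split.
      apply: (hom_on_union _ _ h1 h2) => [x _|x k _ _ Jk].
        by rewrite high_half_refl // orbC low_or_high.
      have /andP[ki kj] := JN _ Jk.
      rewrite !high_half_refl // low_half_flip // high_half_flip // /= Jt // Jk orbT !andbT !andbb.
      by rewrite orbC low_or_high.
    apply: (hom_on_union _ _ h1 h2) => [x _|x k].
      by rewrite high_half_refl // orbC low_or_high.
    rewrite !high_half_refl // => Dx Dk /or3P[/eqP ki|/eqP kj|Jk].
    + rewrite ki in Dk *; move: Dx Dk; rewrite /low_half /high_half !ffunE !eqxx ji.
      by rewrite /= eqxx; case: (x i) (x j) => -[].
    + rewrite kj in Dk *; move: Dx Dk; rewrite /low_half /high_half !ffunE !eqxx ?(negbTE neq_ij).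
      by rewrite /= tpermR eqxx; case: (x i) (x j) => -[].
    have /andP[ki kj] := JN _ Jk.
    rewrite low_half_flip // high_half_flip // /= Jt // Jk orbT !andbT !andbb.
    by rewrite orbC low_or_high.
have step2 b : #|[set f | K b f]| ^ 2 <= nhom JJ * nhom J.
  apply: (@cube_CS i j true b _ (hom_on JJ (low_half i j true b))
    (hom_on J (high_half i j true b))) => //.
  - exact: hom_on_depends.
  - exact: hom_on_depends.
  - by move=> f /andP[hf ->]; rewrite (hom_on_sub _ _ hf).
  - move=> f h1 /(hom_on_reflect neq_ij) h2; apply: (hom_on_union _ _ h1 h2) => [x _|x k _ _].
      by rewrite low_half_refl ?low_or_high.
    rewrite !low_half_refl // => /or3P[/eqP ->|/eqP ->|Jk].
    + rewrite /low_half /high_half !ffunE !eqxx ji /JJ /= tpermL !eqxx orbT.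
      by case: (x i) (x j) (b) => -[] [].
    + rewrite /low_half /high_half !ffunE !eqxx (negbTE neq_ij) /JJ /= tpermR !eqxx orbT.
      by case: (x i) (x j) (b) => -[] [].
    have /andP[ki kj] := JN _ Jk.
    rewrite low_half_flip // high_half_flip // /= Jt // /JJ /= Jk ?orbT !andbT !andbb.
    exact: low_or_high.
  - move=> f h1 /(hom_on_reflect neq_ij) h2; apply: (hom_on_union _ _ h1 h2) => [x _|x k _ _ Jk].
      by rewrite high_half_refl // orbC low_or_high.
    have /andP[ki kj] := JN _ Jk.
    rewrite !high_half_refl // low_half_flip // high_half_flip // /= Jt // Jk !andbT !andbb.
    by rewrite orbC low_or_high.
have := step2 true; have := step2 false; move=> h2 h1.
rewrite -leq_sqr; apply: leq_trans (_ : (#|[set f | K true f]| * #|[set f | K false f]|) ^ 2 <= _).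
  by rewrite leq_sqr.
by rewrite expnMn; apply: leq_trans (leq_mul h1 h2) _; rewrite mulnn mulnC.
Qed.

End CubeCS.

(** The ratios of consecutive terms do not decrease, so the product of the first n + 1 of them is at
    least the corresponding power of the first. Everything is cross-multiplied, which also admits
    zero terms. *)
Lemma logconvex_expn_le (a : nat -> nat) n :
  (forall k, k < n -> a k.+1 ^ 2 <= a k * a k.+2) -> a 1 ^ n.+1 <= a n.+1 * a 0 ^ n.
Proof.
move=> cvx; have ratio k : k <= n -> a 1 * a k <= a 0 * a k.+1.
  elim: k => [|k IH] kn; first by rewrite mulnC.
  have [->|ak] := posnP (a k.+1); first by rewrite muln0.
  rewrite -(leq_pmul2r ak) -!mulnA mulnn.
  apply: leq_trans (_ : a 1 * (a k * a k.+2) <= _); first by rewrite leq_mul2l cvx ?orbT.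
  rewrite mulnA; apply: leq_trans (leq_mul (IH (ltnW kn)) (leqnn (a k.+2))) _.
  by rewrite -mulnA (mulnC (a k.+1)).
suff : forall k, k <= n -> a 1 ^ k.+1 <= a k.+1 * a 0 ^ k by exact.
elim=> [|k IH] kn; first by rewrite muln1.
rewrite expnS; apply: leq_trans (leq_mul (leqnn (a 1)) (IH (ltnW kn))) _.
rewrite mulnA; apply: leq_trans (leq_mul (ratio _ kn) (leqnn _)) _.
by rewrite (mulnC (a 0)) -mulnA -expnS.
Qed.

Lemma card_bigcup_le (I T : finType) (P : pred I) (F : I -> {set T}) :
  #|\bigcup_(i | P i) F i| <= \sum_(i | P i) #|F i|.
Proof.
elim/big_rec2: _ => [|i a b _ IH]; first by rewrite cards0.
by apply: leq_trans (leq_card_setU _ _) _; rewrite leq_add2l.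
Qed.

(** * Lower bound for homomorphisms, and collapse of a parity class *)

Section HomCount.
Variables (d : nat) (T : finType) (A B : {set T}) (r : rel T).
Hypothesis d_gt0 : 0 < d.
Hypothesis rAB : forall x y, r x y -> (x \in A) && (y \in B).
Notation Q := {ffun 'I_d -> bool}.
Notation N := (2 ^ d.-1).
Notation nhom := (@nhom d T A B r).
Notation cube_hom := (@cube_hom d T A B r).
Notation hom_on := (@hom_on d T A B r).
Implicit Types (J : pred 'I_d) (D : pred Q) (f : {ffun Q -> T}).

Lemma eq_nhom J J' : J =1 J' -> nhom J = nhom J'.
Proof.
move=> e; apply: eq_card => f; rewrite !inE.
by apply/idP/idP; apply: hom_on_sub => // k; rewrite e.
Qed.

Lemma prod_parity (a b : nat) :
  \prod_(x : Q) (if parity x then b else a) = (a * b) ^ N.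
Proof.
rewrite (bigID (@parity d)) /= (eq_bigr (fun=> b)) => [|x ->] //.
rewrite (eq_bigr (F1 := fun x : Q => if parity x then b else a) (fun=> a)); last first.
  by move=> x /negbTE ->.
rewrite !prod_nat_const expnMn mulnC; congr (_ ^ _ * _ ^ _).
  by rewrite -(card_parity false d_gt0); apply: eq_card => x; rewrite inE eqbF_neg.
by rewrite -(card_parity true d_gt0); apply: eq_card => x; rewrite inE eqb_id.
Qed.

Lemma nhom0 : nhom pred0 = (#|A| * #|B|) ^ N.
Proof.
rewrite -prod_parity /nhom.
rewrite (eq_card (B := family (fun x : Q => mem (side A B x)))) => [|f].
  rewrite card_family foldrE big_map big_enum /=; apply: eq_bigr => x _.
  by rewrite /side; case: ifP.
rewrite inE; apply/hom_onP/familyP => [[h _] x|h]; first exact: h.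
by split=> // x _; apply: h.
Qed.

(** The edges in direction i form a perfect matching of N edges, whose images can be chosen
    independently. *)
Lemma nhom1 i : #|[set u : T * T | r u.1 u.2]| ^ N <= nhom (pred1 i).
Proof.
set E := [set u | _]; have [->|[p0 p0E]] := set_0Vmem E.
  by rewrite cards0 exp0n // expn_gt0.
(* The image of a matching edge is stored at its even end; odd points carry the dummy value [p0], so
   that the family has exactly [#|E| ^ N] members. *)
pose D (x : Q) : pred (T * T) := if parity x then pred1 p0 else mem E.
have -> : #|E| ^ N = #|family D|.
  rewrite card_family foldrE big_map big_enum /= -[in LHS](muln1 #|E|) -prod_parity.
  by apply: eq_bigr => x _; rewrite /D; case: ifP => // _; rewrite card1.
pose h (g : {ffun Q -> T * T}) : {ffun Q -> T} :=
  [ffun x => if parity x then (g (flip i x)).2 else (g x).1].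
have gE g x : g \in family D -> ~~ parity x -> r (g x).1 (g x).2.
  by move=> /familyP/(_ x); rewrite /D => /[swap] /negbTE ->; rewrite inE.
have h_inj : {in family D &, injective h}.
  move=> g1 g2 g1D g2D /ffunP e; apply/ffunP => x; case px: (parity x).
    have /familyP/(_ x) := g1D; have /familyP/(_ x) := g2D.
    by rewrite /D px !inE => /eqP -> /eqP ->.
  have := e x; have := e (flip i x).
  rewrite !ffunE parity_flip px /= flipK.
  by case: (g1 x) (g2 x) => [? ?] [? ?] /= -> ->.
rewrite -(card_in_imset h_inj); apply: subset_leq_card.
apply/subsetP => _ /imsetP[g gD ->]; rewrite inE; apply/hom_onP; split=> [x _|x k _ _ px].
  rewrite ffunE /side; case: ifP => px; last by have /rAB/andP[] := gE g x gD (negbT px).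
  have := @gE g (flip i x) gD; rewrite parity_flip px => /(_ isT) /rAB.
  by case/andP.
by move=> /eqP ->; rewrite !ffunE parity_flip (negbTE px) /= flipK gE.
Qed.

(** Sidorenko's inequality for the cube: there are at least as many homomorphisms as expected in a
    random bipartite graph of the same density. It follows from log-convexity along initial segments
    of directions, starting from [nhom0] and [nhom1]. *)
Theorem nhom_lower :
  #|[set u : T * T | r u.1 u.2]| ^ (N * d) <= nhom predT * (#|A| * #|B|) ^ (N * d.-1).
Proof.
pose a k := nhom (fun i : 'I_d => i < k).
have aS k (kd : k < d) : a k.+1 = nhom (predU1 (Ordinal kd) (fun i : 'I_d => i < k)).
  by apply: eq_nhom => i; rewrite /= ltnS leq_eqVlt.
have a0 : a 0 = (#|A| * #|B|) ^ N by rewrite -nhom0; apply: eq_nhom.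
have ad : a d = nhom predT by apply: eq_nhom => i /=; rewrite ltn_ord.
have := @logconvex_expn_le a d.-1; rewrite prednK // => /(_ _)/[dup] cvx _.
rewrite !expnM -a0 -ad; apply: leq_trans (cvx _) => [|k kd].
  rewrite leq_exp2r //; apply: leq_trans (nhom1 (Ordinal d_gt0)) _.
  by rewrite (aS _ d_gt0); apply/eq_leq/eq_nhom => i; rewrite /= orbF.
have kd1 : k.+1 < d by rewrite -ltn_predRL.
rewrite (aS _ (ltnW kd1)) (aS _ kd1) /a.
have -> : nhom (predU1 (Ordinal kd1) (fun i : 'I_d => i < k.+1)) =
    nhom (predU1 (Ordinal (ltnW kd1)) (predU1 (Ordinal kd1) (fun i : 'I_d => i < k))).
  by apply: eq_nhom => i /=; rewrite ltnS [i <= k]leq_eqVlt orbCA.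
by apply: nhom_logconvex; rewrite /= -?leqNgt // -val_eqE /= neq_ltn ltnSn.
Qed.

Definition const_on (S : {set Q}) f := [forall x in S, forall y in S, f x == f y].

Lemma const_onP (S : {set Q}) f :
  reflect (forall x y, x \in S -> y \in S -> f x = f y) (const_on S f).
Proof.
apply: (iffP forall_inP) => [h x y xS yS|h x xS]; last by apply/forall_inP => y yS; apply/eqP/h.
by apply/eqP; apply: (forall_inP (h x xS)).
Qed.

Definition nhom_const (S : {set Q}) := #|[set f | cube_hom predT f && const_on S f]|.

Lemma nhom_const_sub (S S' : {set Q}) : S \subset S' -> nhom_const S' <= nhom_const S.
Proof.
move=> /subsetP sS; apply: subset_leq_card; apply/subsetP => f; rewrite !inE => /andP[-> /const_onP h].
by apply/const_onP => x y xS yS; apply: h; apply: sS.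
Qed.

(** Two points strictly inside opposite halves differ in both coordinates i and j, so they are not
    adjacent. Hence a function that is a homomorphism on one half, directly and after reflection, is
    one on the whole cube. *)
Lemma half_edge i j c b k (x : Q) : i != j ->
  (low_half i j c b x && low_half i j c b (flip k x)) ||
  (high_half i j c b x && high_half i j c b (flip k x)).
Proof.
move=> neq_ij; have ji : (j == i) = false by rewrite eq_sym (negbTE neq_ij).
have [->|ki] := eqVneq k i.
  rewrite /low_half /high_half !ffunE eqxx ji.
  by case: (x i) (x j) c b => -[] [] [].
have [->|kj] := eqVneq k j.
  rewrite /low_half /high_half !ffunE eqxx (negbTE neq_ij).
  by case: (x i) (x j) c b => -[] [] [].
by rewrite low_half_flip // high_half_flip // !andbb low_or_high.
Qed.

Lemma hom_of_low i j c b f : i != j ->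
  hom_on predT (low_half i j c b) f ->
  hom_on predT (low_half i j c b) (reflect_fun (cube_refl i j c) f) -> cube_hom predT f.
Proof.
move=> neq_ij h1 /(hom_on_reflect neq_ij) h2; apply: (hom_on_union _ _ h1 h2) => [x _|x k _ _ _].
  by rewrite low_half_refl ?low_or_high.
by rewrite !low_half_refl //= !andbT half_edge.
Qed.

Lemma hom_of_high i j c b f : i != j ->
  hom_on predT (high_half i j c b) f ->
  hom_on predT (high_half i j c b) (reflect_fun (cube_refl i j c) f) -> cube_hom predT f.
Proof.
move=> neq_ij h1 /(hom_on_reflect neq_ij) h2; apply: (hom_on_union _ _ h2 h1) => [x _|x k _ _ _].
  by rewrite high_half_refl ?low_or_high.
by rewrite !high_half_refl //= !andbT half_edge.
Qed.

(** The fixed point [t] anchors the two copies of [S]: a function constant on [S], both directly and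
    after reflection, takes the value at [t] on [S] and on its mirror image. The other half
    contributes at most [nhom predT]. *)
Lemma nhom_const_reflect i j c b (S S' : {set Q}) t : i != j ->
    t \in S -> t i (+) t j == c -> (forall x, x \in S -> low_half i j c b x) ->
    (forall x, x \in S' -> (x \in S) || (cube_refl i j c x \in S)) ->
  nhom_const S ^ 2 <= nhom_const S' * nhom predT.
Proof.
move=> neq_ij tS Ft Slow S'S.
pose C f := [forall x in S, f x == f t].
have refl_t f : reflect_fun (cube_refl i j c) f t = f t by rewrite ffunE cube_refl_id.
apply: (@cube_CS _ _ i j c b _ (fun f => hom_on predT (low_half i j c b) f && C f)
  (hom_on predT (high_half i j c b))) => // [f g fg /andP[hf /forall_inP Cf]||f|f|f].
- apply/andP; split; first by apply: hom_on_depends hf.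
  by apply/forall_inP => x xS; rewrite -!fg ?Cf //; apply: Slow.
- exact: hom_on_depends.
- move=> /andP[hf /const_onP Sf]; rewrite !(hom_on_sub _ _ hf) //= andbT.
  by apply/forall_inP => x xS; apply/eqP/Sf.
- move=> /andP[h1 /forall_inP C1] /andP[h2 /forall_inP C2].
  rewrite (hom_of_low neq_ij h1 h2) /=; apply/const_onP => x y.
  have Ct z : z \in S' -> f z = f t.
    move/S'S => /orP[/C1/eqP //|/C2]; rewrite refl_t ffunE cube_reflK // => /eqP //.
  by move=> /Ct -> /Ct ->.
- exact: hom_of_high.
Qed.

(** Only the points with the parity of [u] in the subcube through [u] with free directions [J]:
    points of different parity have images on different sides. *)
Definition subcube (u : Q) (J : {set 'I_d}) : {set Q} :=
  [set x | (parity x == parity u) && [forall k, (k \notin J) ==> (x k == u k)]].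

Lemma subcubeP u (J : {set 'I_d}) (x : Q) :
  reflect (parity x = parity u /\ forall k, k \notin J -> x k = u k) (x \in subcube u J).
Proof.
rewrite inE; apply: (iffP andP) => [[/eqP px /forallP h]|[px h]]; split=> //.
- by move=> k kJ; apply/eqP; apply: (implyP (h k)).
- exact/eqP.
- by apply/forallP => k; apply/implyP => /h ->.
Qed.

Lemma subcube_id u (J : {set 'I_d}) : u \in subcube u J.
Proof. by apply/subcubeP. Qed.

Lemma subcube_flip2 u (J : {set 'I_d}) i j (x : Q) :
  i \in J -> j \in J -> (flip i (flip j x) \in subcube u J) = (x \in subcube u J).
Proof.
move=> iJ jJ; have h y : y \in subcube u J -> flip i (flip j y) \in subcube u J.
  move=> /subcubeP[py hy]; apply/subcubeP; split=> [|k kJ]; first by rewrite !parity_flip negbK.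
  have /negbTE ki : k != i by apply: contraNneq kJ => ->.
  have /negbTE kj : k != j by apply: contraNneq kJ => ->.
  by rewrite !ffunE ki kj !addbF hy.
apply/idP/idP => [/h|/h //]; by rewrite [flip i (flip j x)]flipC !flipK.
Qed.

Lemma subcube2 u i j : i != j -> subcube u [set i; j] \subset [set u; flip i (flip j u)].
Proof.
move=> neq_ij; have ji : (j == i) = false by rewrite eq_sym (negbTE neq_ij).
apply/subsetP => x /subcubeP[px hx].
have xE (y : Q) : y i = x i -> y j = x j -> (forall k, k != i -> k != j -> y k = u k) -> x = y.
  move=> yi yj yk; apply/ffunP => k.
  have [->//|ki] := eqVneq k i; have [->//|kj] := eqVneq k j.
  by rewrite yk // hx // !inE negb_or ki.
rewrite !inE; case ei: (x i == u i); case ej: (x j == u j).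
- by rewrite (xE u) ?eqxx ?(eqP ei) ?(eqP ej).
- suff xu : x = flip j u by move: px; rewrite xu parity_flip; case: parity.
  apply: xE => [||k ki kj]; rewrite !ffunE.
  + by rewrite (negbTE neq_ij) addbF (eqP ei).
  + by rewrite eqxx; move: ej; case: (x j) (u j) => -[].
  + by rewrite (negbTE kj) addbF.
- suff xu : x = flip i u by move: px; rewrite xu parity_flip; case: parity.
  apply: xE => [||k ki kj]; rewrite !ffunE.
  + by rewrite eqxx; move: ei; case: (x i) (u i) => -[].
  + by rewrite ji addbF (eqP ej).
  + by rewrite (negbTE ki) addbF.
- rewrite orbC (xE (flip i (flip j u))) ?eqxx // => [||k ki kj]; rewrite !ffunE ?eqxx ?ji ?(negbTE neq_ij).
  + by move: ei; case: (x i) (u i) => -[].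
  + by move: ej; case: (x j) (u j) => -[].
  + by rewrite (negbTE ki) (negbTE kj) !addbF.
Qed.

(* Two reflections move the coordinate j into the collapsed subcube: one copies
   the points agreeing with u at i, the other those disagreeing with u at i. *)
Lemma nhom_const_grow u (J : {set 'I_d}) i i' j :
    i != i' -> i \in J -> i' \in J -> j \notin J ->
  nhom_const (subcube u J) ^ 4 <= nhom predT ^ 3 * nhom_const (subcube u (j |: J)).
Proof.
move=> neq_ii' iJ i'J jJ.
have neq_ij : i != j by apply: contraNneq jJ => <-.
have neq_i'j : i' != j by apply: contraNneq jJ => <-.
have ji : (j == i) = false by rewrite eq_sym (negbTE neq_ij).
have Su := subcube_id u J; set S := subcube u J in Su *.
have Sj x : x \in S -> x j = u j by case/subcubeP => _ /(_ j jJ).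
pose c := ~~ (u i (+) u j).
pose S1 := S :|: [set x | cube_refl i j c x \in S].
have S1E x : (x \in S1) = (x \in S) || (cube_refl i j c x \in S).
  by rewrite in_setU; congr orb; rewrite in_set.
have step1 : nhom_const S ^ 2 <= nhom_const S1 * nhom predT.
  apply: (@nhom_const_reflect i j c (u i) S S1 (flip i (flip i' u))) => //.
  - by rewrite subcube_flip2.
  - rewrite !ffunE eqxx (negbTE neq_ii') ji [j == i']eq_sym (negbTE neq_i'j) /c.
    by case: (u i) (u j) => -[].
  - by move=> x xS; rewrite /low_half (Sj x xS) /c; case: (x i) (u i) (u j) => -[] [].
  - by move=> x; rewrite S1E.
have step2 : nhom_const S1 ^ 2 <= nhom_const (subcube u (j |: J)) * nhom predT.
  apply: (@nhom_const_reflect i j (~~ c) (~~ u i) S1 _ u) => //.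
  - by rewrite S1E Su.
  - by rewrite /c negbK.
  - move=> x; rewrite S1E /low_half /c => /orP[/Sj ->|].
      by case: (x i) (u i) (u j) => -[] [].
    rewrite /cube_refl /c; case: ifP => [/eqP xc /Sj xj|xc /Sj].
      by move: xc; rewrite xj; case: (x i) (u i) (u j) => -[] [].
    rewrite !ffunE eqxx ji addbF addbT; move: xc.
    by case: (x i) (x j) (u i) (u j) => -[] [] [].
  - move=> x /subcubeP[px hx].
    have inS (y : Q) : parity y = parity u -> y j = u j ->
        (forall k, k != i -> k != j -> y k = x k) -> y \in S.
      move=> py yj yk; apply/subcubeP; split=> // k kJ.
      have [->//|kj] := eqVneq k j; rewrite yk ?hx // ?inE ?negb_or ?kj //.
      by apply: contraNneq kJ => ->.
    have p2 : parity (flip i (flip j x)) = parity u by rewrite !parity_flip negbK.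
    have k2 k : k != i -> k != j -> flip i (flip j x) k = x k.
      by move=> ki kj; rewrite !ffunE (negbTE ki) (negbTE kj) !addbF.
    have [xj|xj] := eqVneq (x j) (u j); first by rewrite S1E (inS x).
    have S2 : flip i (flip j x) \in S.
      apply: inS => //; rewrite !ffunE eqxx ji.
      by move: xj; case: (x j) (u j) => -[].
    have [xi|xi] := eqVneq (x i) (u i).
      apply/orP; right; rewrite S1E {1}/cube_refl; case: ifP => [|_]; last by rewrite S2.
      by move: xi xj; rewrite /c; case: (x i) (u i) (x j) (u j) => -[] [] [].
    apply/orP; left; rewrite S1E; apply/orP; right; rewrite /cube_refl; case: ifP => // /eqP.
    by move: xi xj; rewrite /c; case: (x i) (u i) (x j) (u j) => -[] [] [].
rewrite -[4]/(2 * 2) expnM; apply: leq_trans (_ : (nhom_const S1 * nhom predT) ^ 2 <= _).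
  by rewrite leq_sqr.
rewrite expnMn; apply: leq_trans (leq_mul step2 (leqnn _)) _.
by rewrite -mulnA -expnS mulnC.
Qed.

(** If phi(J) is the proportion of homomorphisms constant on [subcube u J], each added direction
    costs a fourth power, and phi(J)^(4^k) <= phi(setT); denominators are cleared. The induction
    starts at two directions because [nhom_const_grow] uses two free ones. *)
Lemma nhom_const_iter u (J : {set 'I_d}) k : 1 < #|J| -> #|J| + k = d ->
  nhom predT * nhom_const (subcube u J) ^ (4 ^ k) <=
  nhom predT ^ (4 ^ k) * nhom_const (subcube u setT).
Proof.
elim: k J => [|k IH] J J2 Jk.
  suff -> : J = setT by rewrite !expn1.
  by apply/eqP; rewrite eqEcard subsetT cardsT card_ord; lia.
have [i [i' [iJ i'J neq_ii']]] := card_gt1P J2.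
have /set0Pn[j] : ~: J != set0.
  by rewrite -card_gt0; have := cardsC J; rewrite card_ord; lia.
rewrite inE => jJ.
have IHj : nhom predT * nhom_const (subcube u (j |: J)) ^ 4 ^ k <=
    nhom predT ^ 4 ^ k * nhom_const (subcube u setT).
  by apply: IH; rewrite cardsU1 jJ ?add1n ?addSnnS // ltnW.
rewrite expnS !expnM.
have g := nhom_const_grow u neq_ii' iJ i'J jJ.
apply: leq_trans (_ : nhom predT * (nhom predT ^ 3 * nhom_const (subcube u (j |: J))) ^ 4 ^ k <= _).
  by rewrite leq_mul2l leq_exp2r ?expn_gt0 // g orbT.
rewrite expnMn mulnCA [nhom predT ^ 4]expnSr expnMn -mulnA leq_mul2l.
by rewrite IHj orbT.
Qed.

(** Equal parity provides two coordinates i, j in which u and w differ. For the value of [c] that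
    keeps both off the mirror they lie in opposite halves, and for each common value [a] the
    reflection pairs u, and likewise w, with its own mirror image at distance two. *)
Lemma nhom_const_pair (u w : Q) : u != w -> parity u = parity w ->
  exists i j, i != j /\
    nhom_const [set u; w] ^ 2 <=
    nhom_const [set u; flip i (flip j u)] * nhom_const [set w; flip i (flip j w)].
Proof.
move=> neq_uw puw.
have [i ui] : exists i, u i != w i.
  by apply/existsP; apply: contraNT neq_uw => /existsPn h; apply/eqP/ffunP => i; apply/eqP/negPn/h.
have [j uj] : exists j, u j != flip i w j.
  apply/existsP; apply: contraT => /existsPn h.
  have uE : u = flip i w by apply/ffunP => j; apply/eqP/negPn/h.
  by move: puw; rewrite uE parity_flip; case: parity.
have neq_ij : i != j.
  by apply: contraNneq uj => <-; rewrite ffunE eqxx; move: ui; case: (u i) (w i) => -[].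
have ji : (j == i) = false by rewrite eq_sym (negbTE neq_ij).
exists i, j; split=> //; move: uj; rewrite ffunE ji addbF => uj.
pose c := ~~ (u i (+) u j).
have pairE x y : nhom_const [set x; y] = \sum_a #|[set f | [&& cube_hom predT f, f x == a & f y == a]]|.
  rewrite /nhom_const -sum1_card (partition_big (fun f : {ffun Q -> T} => f x) predT) //=.
  apply: eq_bigr => a _; rewrite -sum1_card; apply: eq_bigl => f; rewrite !inE -andbA.
  case: (cube_hom predT f) => //=; apply/andP/andP => [[/const_onP h /eqP <-]|[/eqP ex /eqP ey]].
    by split=> //; apply/eqP; apply: h; rewrite !inE eqxx ?orbT.
  by rewrite ex; split=> //; apply/const_onP => z t; rewrite !inE => /orP[]/eqP -> /orP[]/eqP ->; rewrite ?ex ?ey.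
rewrite !pairE; apply: sum_sqr_le => a.
have uF : (u i (+) u j == c) = false by rewrite /c; case: (u i) (u j) => -[].
have wF : (w i (+) w j == c) = false.
  by move: ui uj; rewrite /c; case: (u i) (w i) (u j) (w j) => -[] [] [].
apply: (@cube_CS _ _ i j c (u i) _
  (fun f => hom_on predT (low_half i j c (u i)) f && (f u == a))
  (fun f => hom_on predT (high_half i j c (u i)) f && (f w == a))) => //.
- move=> f g fg /andP[hf fu]; rewrite (hom_on_depends fg hf) /= -fg //.
  by rewrite /low_half eqxx orbT.
- move=> f g fg /andP[hf fu]; rewrite (hom_on_depends fg hf) /= -fg //.
  by rewrite /high_half [w i == u i]eq_sym ui orbT.
- by move=> f /and3P[hf -> ->]; rewrite !(hom_on_sub _ _ hf).
- move=> f /andP[h1 fu] /andP[h2]; rewrite ffunE {1}/cube_refl uF => ->.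
  by rewrite (hom_of_low neq_ij h1 h2) fu.
- move=> f /andP[h1 fu] /andP[h2]; rewrite ffunE {1}/cube_refl wF => ->.
  by rewrite (hom_of_high neq_ij h1 h2) fu.
Qed.

(** Such a homomorphism maps into a star: one choice of the centre in [X], then at most [D] choices
    at each of the N points of the other parity. *)
Lemma nhom_const_class (u : Q) (X : {set T}) (D : nat) (P : T -> {set T}) :
    (forall f x, cube_hom predT f -> parity x = parity u -> f x \in X) ->
    (forall f x i, cube_hom predT f -> parity x = parity u -> f (flip i x) \in P (f x)) ->
    (forall a, a \in X -> #|P a| <= D) ->
  nhom_const (subcube u setT) <= #|X| * D ^ N.
Proof.
move=> hX hP leD.
rewrite /nhom_const -sum1_card (partition_big (fun f : {ffun Q -> T} => f u) (mem X)) /=; last first.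
  by move=> f; rewrite inE => /andP[hf _]; apply: hX.
rewrite -sum_nat_const; apply: leq_sum => a aX.
pose E (x : Q) : {set T} := if parity x == parity u then [set a] else P a.
rewrite sum1_card; apply: leq_trans (_ : #|family (fun x => mem (E x))| <= _).
  apply: subset_leq_card; apply/subsetP => f.
  rewrite -topredE /= inE => /andP[/andP[hf /const_onP cf] /eqP fu].
  have fa y : parity y = parity u -> f y = a.
    by move=> py; rewrite -fu; apply: cf; rewrite ?subcube_id //; apply/subcubeP; split=> // k; rewrite inE.
  apply/familyP => x; rewrite /E; case: ifP => [/eqP px|px]; first by rewrite in_set1 fa.
  pose i0 := Ordinal d_gt0.
  have pf : parity (flip i0 x) = parity u by rewrite parity_flip; move: px; case: (parity x) (parity u) => -[].
  by have := hP f _ i0 hf pf; rewrite flipK (fa _ pf).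
rewrite card_family foldrE big_map big_enum /= -[D]mul1n.
have <- : \prod_(x : Q) (if parity x == parity u then 1 else D) = (1 * D) ^ N.
  case: (parity u); [rewrite mulnC -(prod_parity D 1) | rewrite -(prod_parity 1 D)];
    by apply: eq_bigr => x _; case: parity.
apply: leq_prod => x _; rewrite /E; case: ifP => _; first by rewrite cards1.
exact: leD.
Qed.

(** As [A] and [B] are disjoint, identified points have equal parity. There are at most [4 ^ d]
    ordered pairs, so some pair is identified by that share of the homomorphisms; [nhom_const_pair]
    brings it to distance two, where the growth of the collapsed set can start. *)
Lemma nhom_le_const : 1 < d -> [disjoint A & B] ->
    (forall f, cube_hom predT f -> exists x y, x != y /\ f x = f y) ->
  exists u i j, i != j /\ nhom predT <= 4 ^ d * nhom_const [set u; flip i (flip j u)].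
Proof.
move=> d2 disAB noinj.
pose G := [set p : Q * Q | (p.1 != p.2) && (parity p.1 == parity p.2)].
have le_sum : nhom predT <= \sum_(p in G) nhom_const [set p.1; p.2].
  apply: leq_trans (_ : #|\bigcup_(p in G) [set f | cube_hom predT f && const_on [set p.1; p.2] f]| <= _).
    apply: subset_leq_card; apply/subsetP => f; rewrite inE => hf.
    have [x [y [xy fxy]]] := noinj f hf.
    apply/bigcupP; exists (x, y); rewrite inE /= ?hf ?xy /=.
      have [/hom_onP[fs _]] := (hf, tt); have := fs x isT; have := fs y isT.
      rewrite /side fxy; case: (parity x) (parity y) => -[] // yA yB.
        by have := disjointFr disAB yA; rewrite yB.
      by have := disjointFr disAB yB; rewrite yA.
    by apply/const_onP => z t; rewrite !inE => /orP[]/eqP -> /orP[]/eqP ->.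
  exact: card_bigcup_le.
have [G0|G_gt0] := posnP #|G|.
  exists [ffun=> false], (Ordinal d_gt0), (Ordinal d2); split=> //.
  by move: le_sum; rewrite (cards0_eq G0) big_set0 leqn0 => /eqP ->.
have [[u w]] := eq_bigmax_cond (fun p : Q * Q => nhom_const [set p.1; p.2]) G_gt0.
rewrite inE /= => /andP[neq_uw /eqP puw] maxp.
have le_h : nhom predT <= 4 ^ d * nhom_const [set u; w].
  apply: leq_trans le_sum _.
  apply: leq_trans (_ : \sum_(p in G) nhom_const [set u; w] <= _).
    by apply: leq_sum => p pG; rewrite -maxp; apply: leq_bigmax_cond.
  rewrite sum_nat_const leq_mul2r; apply/orP; right.
  apply: leq_trans (max_card _) _; rewrite card_prod card_ffun card_bool card_ord.
  by rewrite -expnMn.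
have [i [j [neq_ij CS]]] := nhom_const_pair neq_uw puw.
have [le_uw|/ltnW le_wu] := leqP (nhom_const [set w; flip i (flip j w)])
    (nhom_const [set u; flip i (flip j u)]).
  exists u, i, j; split=> //; apply: leq_trans le_h _; rewrite leq_mul2l; apply/orP; right.
  by rewrite -leq_sqr; apply: leq_trans CS _; rewrite -mulnn leq_mul2l le_uw orbT.
exists w, i, j; split=> //; apply: leq_trans le_h _; rewrite leq_mul2l; apply/orP; right.
by rewrite -leq_sqr; apply: leq_trans CS _; rewrite -mulnn leq_mul2r le_wu orbT.
Qed.

(** A proportion of at least 4^(-d) identifies some pair at distance two; after d - 2 growth steps a
    proportion of at least (4^d)^(-M), with M = 4^(d-2), is constant on a parity class. Counting
    stars thus bounds [nhom predT], and [nhom_lower] turns this into a bound on edges. *)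
Theorem edges_le_star (DA DB : nat) : 1 < d -> [disjoint A & B] ->
    (forall f, cube_hom predT f -> exists x y, x != y /\ f x = f y) ->
    (forall a, a \in A -> #|[set b | r a b]| <= DA) ->
    (forall b, b \in B -> #|[set a | r a b]| <= DB) ->
  #|[set u : T * T | r u.1 u.2]| ^ (N * d) <=
  (4 ^ d) ^ (4 ^ (d - 2)) * maxn (#|A| * DA ^ N) (#|B| * DB ^ N) * (#|A| * #|B|) ^ (N * d.-1).
Proof.
move=> d2 disAB noinj degA degB.
apply: leq_trans nhom_lower _; rewrite leq_mul2r; apply/orP; right.
have [u [i [j [neq_ij le_h]]]] := nhom_le_const d2 disAB noinj.
have star : nhom_const (subcube u setT) <= maxn (#|A| * DA ^ N) (#|B| * DB ^ N).
  have hside f x : cube_hom predT f -> f x \in side A B x by move=> /hom_onP[h _]; apply: h.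
  have hedge f x k : cube_hom predT f -> ~~ parity x -> r (f x) (f (flip k x)).
    by move=> /hom_onP[_ h] px; apply: h.
  case pu: (parity u); rewrite leq_max; apply/orP; [right|left].
    apply: (@nhom_const_class u B DB (fun b => [set a | r a b])) => // [f x|f x k] hf px.
      by have := hside f x hf; rewrite /side px pu.
    rewrite inE; have := hedge f (flip k x) k hf; rewrite parity_flip flipK px pu.
    exact.
  apply: (@nhom_const_class u A DA (fun a => [set b | r a b])) => // [f x|f x k] hf px.
    by have := hside f x hf; rewrite /side px pu.
  by rewrite inE hedge ?px ?pu.
have card2 : #|[set i; j]| = 2 by rewrite cards2 neq_ij.
have iter := @nhom_const_iter u [set i; j] (d - 2); rewrite card2 in iter.
have {iter} := iter isT (subnKC d2).
have [->//|h_gt0] := posnP (nhom predT); set M := 4 ^ (d - 2) => iter.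
have hM_gt0 : 0 < nhom predT ^ M by rewrite expn_gt0 h_gt0.
rewrite -(leq_pmul2r hM_gt0).
apply: leq_trans (_ : nhom predT * (4 ^ d * nhom_const (subcube u [set i; j])) ^ M <= _).
  rewrite leq_mul2l leq_exp2r ?expn_gt0 //; apply/orP; right; apply: leq_trans le_h _.
  by rewrite leq_mul2l nhom_const_sub ?orbT // subcube2.
rewrite expnMn mulnCA -mulnA leq_mul2l; apply/orP; right.
by apply: leq_trans iter _; rewrite mulnC leq_mul2r star orbT.
Qed.

End HomCount.

(** * Graphs without hexagons and without three-dimensional cubes *)

Lemma card_dep_pairs (I J : finType) (E : {set I}) (F : I -> {set J}) :
  #|[set p : I * J | (p.1 \in E) && (p.2 \in F p.1)]| = \sum_(e in E) #|F e|.
Proof.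
rewrite -sum1_card; under [RHS]eq_bigr do rewrite -sum1_card.
by rewrite pair_big_dep /=; apply: eq_bigl => p; rewrite inE.
Qed.

Definition pair_swap (S T : Type) (q : S * T) : T * S := (q.2, q.1).

Lemma pair_swapK (S T : Type) : cancel (@pair_swap S T) (@pair_swap T S).
Proof. by case. Qed.

Section BipartiteEdges.
Variables (T : finType) (r : rel T).
Implicit Types X Y : {set T}.

Definition bip_edges X Y := [set p : T * T | [&& p.1 \in X, p.2 \in Y & r p.1 p.2]].
Definition rdeg Y x := #|[set y in Y | r x y]|.
Definition ldeg X y := #|[set x in X | r x y]|.

Lemma sum_edges_l X Y (f : T -> nat) :
  \sum_(p in bip_edges X Y) f p.1 = \sum_(x in X) rdeg Y x * f x.
Proof.
rewrite (eq_bigr (fun x => \sum_(y in [set y in Y | r x y]) f x)); last first.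
  by move=> x _; rewrite sum_nat_const.
rewrite pair_big_dep /=; apply: eq_bigl => -[x y]; by rewrite !inE.
Qed.

Lemma sum_edges_r X Y (f : T -> nat) :
  \sum_(p in bip_edges X Y) f p.2 = \sum_(y in Y) ldeg X y * f y.
Proof.
rewrite (eq_bigr (fun y => \sum_(x in [set x in X | r x y]) f y)); last first.
  by move=> x _; rewrite sum_nat_const.
rewrite (exchange_big_dep (mem X)) /=; last by move=> x y _; rewrite inE => /andP[].
rewrite pair_big_dep /=; apply: eq_bigl => -[x y]; rewrite !inE /=.
by case: (x \in X); rewrite ?andbF.
Qed.

Lemma card_edges_l X Y : #|bip_edges X Y| = \sum_(x in X) rdeg Y x.
Proof. by rewrite -sum1_card (sum_edges_l _ _ (fun=> 1)); under eq_bigr do rewrite muln1. Qed.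

Lemma card_edges_r X Y : #|bip_edges X Y| = \sum_(y in Y) ldeg X y.
Proof. by rewrite -sum1_card (sum_edges_r _ _ (fun=> 1)); under eq_bigr do rewrite muln1. Qed.

Definition hexagon_free X Y := forall x1 x2 x3 y1 y2 y3,
  x1 \in X -> x2 \in X -> x3 \in X -> y1 \in Y -> y2 \in Y -> y3 \in Y ->
  uniq [:: x1; x2; x3] -> uniq [:: y1; y2; y3] ->
  r x1 y1 -> r x2 y1 -> r x2 y2 -> r x3 y2 -> r x3 y3 -> r x1 y3 -> False.

Section HexagonFree.
Variables X Y : {set T}.
Hypothesis noC6 : hexagon_free X Y.

(* ((x1, y1), (x, y)) encodes the path x - y1 - x1 - y. *)
Let paths : {set (T * T) * (T * T)} :=
  [set q | (q.1 \in bip_edges X Y) &&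
           (q.2 \in setX ([set x in X | r x q.1.2] :\ q.1.1) ([set y in Y | r q.1.1 y] :\ q.1.2))].

Let pathP x1 y1 x y : reflect
  [/\ [/\ x1 \in X, y1 \in Y, x \in X & y \in Y], [/\ r x1 y1, r x y1 & r x1 y], x != x1 & y != y1]
  (((x1, y1), (x, y)) \in paths).
Proof.
rewrite !inE /= -!andbA; apply: (iffP idP) => [|[[-> -> -> ->] [-> -> ->] -> ->]] //.
by do 8![case/andP=> ->] => ->.
Qed.

Let card_paths :
  #|paths| = \sum_(p in bip_edges X Y) (ldeg X p.2).-1 * (rdeg Y p.1).-1.
Proof.
rewrite (card_dep_pairs _ (fun p : T * T => setX ([set x in X | r x p.2] :\ p.1) ([set y in Y | r p.1 y] :\ p.2))).
apply: eq_bigr => -[x y]; rewrite !inE /= => /and3P[xX yY rxy].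
by rewrite cardsX /ldeg /rdeg (cardsD1 x [set _ in X | _]) (cardsD1 y [set _ in Y | _]) !inE xX yY rxy.
Qed.

Let codegX y y' := #|[set x in X | r x y && r x y']|.
Let codegY x x' := #|[set y in Y | r x y && r x' y]|.

Let pathsL := [set q in paths | 2 < codegX q.1.2 q.2.2].
Let pathsR := [set q in paths | 2 < codegY q.1.1 q.2.1].
Let paths0 := [set q in paths | (codegX q.1.2 q.2.2 <= 2) && (codegY q.1.1 q.2.1 <= 2)].

Let other2 (A : {set T}) a b : 2 < #|A| -> exists2 c, c \in A & c \notin [:: a; b].
Proof.
move=> A3; have /card_gt0P[c] : 0 < #|A :\: [set a; b]|.
  have := cardsID [set a; b] A; have := subset_leq_card (subsetIr A [set a; b]).
  have : #|[set a; b]| <= 2 by rewrite cards2; case: (_ != _).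
  by lia.
by rewrite !inE => /andP[cab cA]; exists c; rewrite ?inE.
Qed.

(** The end y is determined by the other three vertices: if y and y' both occurred, a common
    neighbour x2 of y1, y and another one x3 of y1, y' would close the hexagon x1 y' x3 y1 x2 y.
    More than two common neighbours leave room for x3 besides x1 and x2. *)
Let card_pathsL : #|pathsL| <= \sum_(y in Y) ldeg X y ^ 2.
Proof.
have -> : \sum_(y in Y) ldeg X y ^ 2 =
    #|[set p : T * (T * T) | (p.1 \in Y) && (p.2 \in setX [set x in X | r x p.1] [set x in X | r x p.1])]|.
  rewrite (card_dep_pairs _ (fun y => setX [set x in X | r x y] [set x in X | r x y])).
  by apply: eq_bigr => y _; rewrite cardsX mulnn.
pose h (q : (T * T) * (T * T)) := (q.1.2, (q.1.1, q.2.1)).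
have h_inj : {in pathsL &, injective h}.
  move=> [[x1 y1] [x y]] [[x1' y1'] [x' y']].
  rewrite in_set => /andP[/pathP[[x1X y1Y xX yY] [r11 r01 r10] xx yy] /= cy].
  rewrite in_set => /andP[/pathP[[_ _ _ y'Y] [_ _ r10'] _ yy'] /= cy'] [? ? ?]; subst y1' x1' x'.
  congr ((_, _), (_, _)); apply/eqP/negPn/negP => neq_yy'.
  have [x2] := other2 x1 x1 cy; rewrite !inE orbb => /and3P[x2X rx2y1 rx2y] x21.
  have [x3] := other2 x1 x2 cy'; rewrite !inE negb_or => /and3P[x3X rx3y1 rx3y'] /andP[x31 x32].
  apply: (@noC6 x1 x3 x2 y' y1 y) => //=; rewrite !inE ?negb_or ?neq_yy' ?yy' ?andbT //=.
  - by rewrite eq_sym x31 eq_sym x21 x32.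
  - by rewrite eq_sym neq_yy' eq_sym.
rewrite -(card_in_imset h_inj); apply: subset_leq_card; apply/subsetP => _ /imsetP[q qP ->].
case: q qP => [[x1 y1] [x y]] qP; rewrite in_set in qP.
case/andP: qP => /pathP[[x1X y1Y xX yY] [r11 r01 r10] _ _] _.
by rewrite !inE /= y1Y x1X xX r11 r01.
Qed.

Let card_pathsR : #|pathsR| <= \sum_(x in X) rdeg Y x ^ 2.
Proof.
rewrite (eq_bigr (fun x => #|setX [set y in Y | r x y] [set y in Y | r x y]|)); last first.
  by move=> x _; rewrite cardsX mulnn.
rewrite -(card_dep_pairs _ (fun x => setX [set y in Y | r x y] [set y in Y | r x y])).
pose h (q : (T * T) * (T * T)) := (q.1.1, (q.1.2, q.2.2)).
have h_inj : {in pathsR &, injective h}.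
  move=> [[x1 y1] [x y]] [[x1' y1'] [x' y']].
  rewrite in_set => /andP[/pathP[[x1X y1Y xX yY] [r11 r01 r10] xx yy] /= cx].
  rewrite in_set => /andP[/pathP[[_ _ x'X _] [_ r01' _] xx' _] /= cx'] [? ? ?]; subst y1' x1' y'.
  congr ((_, _), (_, _)); apply/eqP/negPn/negP => neq_xx'.
  have [y2] := other2 y1 y1 cx; rewrite !inE orbb => /and3P[y2Y rxy2 rx1y2] y21.
  have [y3] := other2 y1 y2 cx'; rewrite !inE negb_or => /and3P[y3Y rx'y3 rx1y3] /andP[y31 y32].
  apply: (@noC6 x x' x1 y1 y3 y2) => //=; rewrite !inE ?negb_or ?neq_xx' ?xx ?xx' ?andbT //=.
  by rewrite eq_sym y31 eq_sym y21 y32.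
rewrite -(card_in_imset h_inj); apply: subset_leq_card; apply/subsetP => _ /imsetP[q qP ->].
case: q qP => [[x1 y1] [x y]] qP; rewrite in_set in qP.
case/andP: qP => /pathP[[x1X y1Y xX yY] [r11 r01 r10] _ _] _.
by rewrite !inE /= y1Y x1X yY r11 r10.
Qed.

(** For fixed ends, two disjoint middle edges would close a hexagon through the ends. Three middle
    edges that meet pairwise share a vertex, and this vertex and the end on its side then have three
    common neighbours. *)
Let card_paths0 : #|paths0| <= 2 * (#|X| * #|Y|).
Proof.
rewrite -sum1_card (partition_big snd (mem (setX X Y))) /=; last first.
  by move=> [[x1 y1] [x y]]; rewrite in_set => /andP[/pathP[[_ _ xX yY] _ _ _] _]; rewrite inE /= xX.
rewrite -cardsX mulnC -sum_nat_const; apply: leq_sum => -[x y] _.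
rewrite sum1_card leqNgt; apply/negP => /card_gt2P[q1 [q2 [q3 [[]]]]].
have mem0 q : q \in [pred q | (q \in paths0) && (q.2 == (x, y))] ->
    exists x1 y1, [/\ q = ((x1, y1), (x, y)), ((x1, y1), (x, y)) \in paths,
                      codegX y1 y <= 2 & codegY x1 x <= 2].
  case: q => [[x1 y1] p] /andP[] /[swap] /eqP /= ->.
  by rewrite in_set => /and3P[? ? ?]; exists x1, y1.
move=> /mem0[x1 [y1 [-> /pathP[[x1X y1Y xX yY] [r11 r01 r10] xx yy] cX1 cY1]]].
move=> /mem0[x2 [y2 [-> /pathP[[x2X y2Y _ _] [r22 r02 r20] xx2 yy2] cX2 cY2]]].
move=> /mem0[x3 [y3 [-> /pathP[[x3X y3Y _ _] [r33 r03 r30] xx3 yy3] cX3 cY3]]].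
case; rewrite !xpair_eqE !eqxx !andbT => n12 n23 n31.
have inter xa ya xb yb : xa \in X -> ya \in Y -> xb \in X -> yb \in Y ->
    r xa ya -> r x ya -> r xa y -> r xb yb -> r x yb -> r xb y ->
    x != xa -> y != ya -> x != xb -> y != yb -> (xa == xb) || (ya == yb).
  move=> xaX yaY xbX ybY raa r0a ra0 rbb r0b rb0 nxa nya nxb nyb.
  rewrite -[_ || _]negbK negb_or; apply/negP => /andP[nxab nyab].
  apply: (@noC6 x xa xb ya y yb) => //=; rewrite !inE ?negb_or ?nxa ?nxb ?nxab //=.
  by rewrite eq_sym nya nyab nyb.
have tripX x2' x3' : x1 != x2' -> x2' != x3' -> x3' != x1 -> x2' \in X -> x3' \in X ->
    r x2' y1 -> r x3' y1 -> r x2' y -> r x3' y -> False.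
  move=> h12 h23 h31 X2 X3 r2 r3 r2y r3y; suff : 2 < codegX y1 y by rewrite ltnNge cX1.
  by apply/card_gt2P; exists x1, x2', x3'; rewrite !inE x1X X2 X3 r11 r10 r2 r3 r2y r3y h12 h23 h31.
have tripY y2' y3' : y1 != y2' -> y2' != y3' -> y3' != y1 -> y2' \in Y -> y3' \in Y ->
    r x1 y2' -> r x1 y3' -> r x y2' -> r x y3' -> False.
  move=> h12 h23 h31 Y2 Y3 r2 r3 r2y r3y; suff : 2 < codegY x1 x by rewrite ltnNge cY1.
  by apply/card_gt2P; exists y1, y2', y3'; rewrite !inE y1Y Y2 Y3 r11 r01 r2 r3 r2y r3y h12 h23 h31.
have i12 := inter _ _ _ _ x1X y1Y x2X y2Y r11 r01 r10 r22 r02 r20 xx yy xx2 yy2.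
have i23 := inter _ _ _ _ x2X y2Y x3X y3Y r22 r02 r20 r33 r03 r30 xx2 yy2 xx3 yy3.
have i31 := inter _ _ _ _ x3X y3Y x1X y1Y r33 r03 r30 r11 r01 r10 xx3 yy3 xx yy.
have [e12|d12] := eqVneq x1 x2.
  subst x2; rewrite eqxx /= in n12.
  have [e31|d31] := eqVneq x3 x1.
    by subst x3; rewrite eqxx /= in n31 n23; apply: (tripY y2 y3).
  rewrite (negbTE d31) /= in i31; rewrite eq_sym (negbTE d31) /= in i23.
  by move: n12; rewrite -(eqP i31) (eqP i23) eqxx.
rewrite (negbTE d12) /= in i12.
have y12 := eqP i12; subst y2; rewrite eqxx andbT in n12.
have [e31|d31] := eqVneq y3 y1.
  by subst y3; rewrite eqxx ?andbT in n31 n23; apply: (tripX x2 x3).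
rewrite (negbTE d31) orbF in i31; rewrite [y1 == y3]eq_sym (negbTE d31) orbF in i23.
by move: n12; rewrite -(eqP i31) (eqP i23) eqxx.
Qed.

Lemma hexagon_free_paths :
  \sum_(p in bip_edges X Y) (ldeg X p.2).-1 * (rdeg Y p.1).-1 <=
  2 * (#|X| * #|Y|) + \sum_(x in X) rdeg Y x ^ 2 + \sum_(y in Y) ldeg X y ^ 2.
Proof.
rewrite -card_paths; apply: leq_trans (_ : #|paths0 :|: pathsR :|: pathsL| <= _).
  apply: subset_leq_card; apply/subsetP => q qP; rewrite !in_setU.
  rewrite [q \in paths0]in_set [q \in pathsR]in_set [q \in pathsL]in_set qP /=.
  by case: ltnP => //= _; rewrite ?orbT // orbF orbC; case: ltnP.
apply: leq_trans (leq_card_setU _ _) _; apply: leq_add; last exact: card_pathsL.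
by apply: leq_trans (leq_card_setU _ _) _; apply: leq_add; [exact: card_paths0|exact: card_pathsR].
Qed.

(** Degrees of at least 8 make each sum of squares in [hexagon_free_paths] at most S/8, whence S <=
    4mn. On the other hand at least half of the e edges have both end degrees at least a quarter of
    the average on their side, so S >= e^3/(32mn). *)
Lemma hexagon_free_core :
    (forall x, x \in X -> 8 <= rdeg Y x) -> (forall y, y \in Y -> 8 <= ldeg X y) ->
  #|bip_edges X Y| ^ 3 <= 128 * (#|X| * #|Y|) ^ 2.
Proof.
move=> degX degY; set E := bip_edges X Y; set m := #|X|; set n := #|Y|.
set S := \sum_(p in E) ldeg X p.2 * rdeg Y p.1.
have EX p : p \in E -> 8 <= rdeg Y p.1 by rewrite inE => /and3P[/degX].
have EY p : p \in E -> 8 <= ldeg X p.2 by rewrite inE => /and3P[_ /degY].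
have sqX : \sum_(p in E) rdeg Y p.1 = \sum_(x in X) rdeg Y x ^ 2.
  by rewrite (sum_edges_l X Y (rdeg Y)); apply: eq_bigr => x _; rewrite mulnn.
have sqY : \sum_(p in E) ldeg X p.2 = \sum_(y in Y) ldeg X y ^ 2.
  by rewrite (sum_edges_r X Y (ldeg X)); apply: eq_bigr => y _; rewrite mulnn.
have sumX : 8 * \sum_(x in X) rdeg Y x ^ 2 <= S.
  by rewrite -sqX big_distrr /=; apply: leq_sum => p pE; rewrite leq_mul2r EY ?orbT.
have sumY : 8 * \sum_(y in Y) ldeg X y ^ 2 <= S.
  by rewrite -sqY big_distrr /=; apply: leq_sum => p pE; rewrite mulnC leq_mul2l EX ?orbT.
have S_le : S <= 4 * (m * n).
  have le1 : S <= \sum_(p in E) ((ldeg X p.2).-1 * (rdeg Y p.1).-1 + rdeg Y p.1 + ldeg X p.2).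
    apply: leq_sum => p pE; have := EX p pE; have := EY p pE.
    by case: (ldeg X p.2) => // a; case: (rdeg Y p.1) => // b /= _ _; rewrite mulSn mulnS; lia.
  rewrite !big_split /= sqX sqY in le1.
  have := hexagon_free_paths; rewrite -/E -/m -/n; move: le1 sumX sumY.
  move: (\sum_(x in X) rdeg Y x ^ 2) (\sum_(y in Y) ldeg X y ^ 2) => a b.
  by move: (\sum_(p in E) (ldeg X p.2).-1 * (rdeg Y p.1).-1) => c; clearbody S; lia.
pose big := [set p in E | (#|E| <= 4 * m * rdeg Y p.1) && (#|E| <= 4 * n * ldeg X p.2)].
have bigE : #|E| <= 2 * #|big|.
  have low_l : 4 * #|[set p in E | 4 * m * rdeg Y p.1 < #|E|]| <= #|E|.
    have [m0|m_gt0] := posnP m.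
      suff -> : E = set0.
        by rewrite cards0 (_ : [set p in set0 | _] = set0) ?cards0 //; apply/setP => p; rewrite !inE.
      by apply/setP => p; rewrite !inE (cards0_eq m0) inE.
    rewrite -(leq_pmul2l m_gt0) -sum1_card.
    under eq_bigl do rewrite inE.
    rewrite big_mkcondr (sum_edges_l X Y (fun x => if 4 * m * rdeg Y x < #|E| then 1 else 0)).
    rewrite !big_distrr /= -sum_nat_const; apply: leq_sum => x _.
    by case: ifP => [/ltnW|_]; rewrite ?muln1 ?muln0 // mulnA [m * 4]mulnC.
  have low_r : 4 * #|[set p in E | 4 * n * ldeg X p.2 < #|E|]| <= #|E|.
    have [n0|n_gt0] := posnP n.
      suff -> : E = set0.
        by rewrite cards0 (_ : [set p in set0 | _] = set0) ?cards0 //; apply/setP => p; rewrite !inE.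
      by apply/setP => p; rewrite !inE (cards0_eq n0) inE andbF.
    rewrite -(leq_pmul2l n_gt0) -sum1_card.
    under eq_bigl do rewrite inE.
    rewrite big_mkcondr (sum_edges_r X Y (fun y => if 4 * n * ldeg X y < #|E| then 1 else 0)).
    rewrite !big_distrr /= -sum_nat_const; apply: leq_sum => x _.
    by case: ifP => [/ltnW|_]; rewrite ?muln1 ?muln0 // mulnA [n * 4]mulnC.
  have : E \subset big :|: ([set p in E | 4 * m * rdeg Y p.1 < #|E|] :|:
                           [set p in E | 4 * n * ldeg X p.2 < #|E|]).
    apply/subsetP => p; rewrite !in_setU !in_set => -> /=.
    by case: leqP => //= _; case: leqP => //= _; rewrite ?orbT.
  move/subset_leq_card; move: low_l low_r.
  set U3 := [set p in E | 4 * m * _ < _]; set U4 := [set p in E | 4 * n * _ < _].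
  have h1 := (leq_card_setU big (U3 :|: U4)).1; have h2 := (leq_card_setU U3 U4).1.
  by clearbody U3 U4 big E; lia.
have S_ge : #|big| * #|E| ^ 2 <= 16 * (m * n) * S.
  rewrite -sum_nat_const big_distrr /=.
  apply: leq_trans (_ : \sum_(p in big) 16 * (m * n) * (ldeg X p.2 * rdeg Y p.1) <= _).
    apply: leq_sum => p; rewrite inE => /and3P[_ h1 h2].
    by rewrite -mulnn; apply: leq_trans (leq_mul h1 h2) _; lia.
  rewrite [leqRHS](bigID (mem big)) /=; apply: leq_trans (leq_addr _ _).
  by apply: eq_leq; apply: eq_bigl => p; rewrite in_set; case: (p \in E).
rewrite expnS; apply: leq_trans (leq_mul bigE (leqnn _)) _.
rewrite -mulnA; apply: leq_trans (leq_mul (leqnn 2) S_ge) _.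
apply: leq_trans (_ : 2 * (16 * (m * n) * (4 * (m * n))) <= _); last by lia.
by rewrite !leq_mul2l S_le !orbT.
Qed.

End HexagonFree.

(** Deleting vertices of degree below 8 one by one loses fewer than 8 edges each time. Instead of a
    process, [weight] credits 8 for every discarded vertex, and a maximizer has all degrees at least
    8. *)
Lemma hexagon_free_edges X Y : hexagon_free X Y ->
  exists e, #|bip_edges X Y| <= 8 * (#|X| + #|Y|) + e /\ e ^ 3 <= 128 * (#|X| * #|Y|) ^ 2.
Proof.
move=> noC6.
pose ok (p : {set T} * {set T}) := (p.1 \subset X) && (p.2 \subset Y).
pose weight (p : {set T} * {set T}) := #|bip_edges p.1 p.2| + 8 * (#|X :\: p.1| + #|Y :\: p.2|).
have okXY : ok (X, Y) by rewrite /ok !subxx.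
have [[X' Y'] /andP[/= sX sY] maxXY] := @arg_maxnP _ (X, Y) ok weight okXY.
have degX x : x \in X' -> 8 <= rdeg Y' x.
  move=> xX'; have := maxXY (X' :\ x, Y'); rewrite /ok /= sY andbT.
  rewrite (subset_trans (subD1set _ _) sX) /weight /= => /(_ isT).
  rewrite !card_edges_l (big_setD1 x xX') /=.
  have -> : #|X :\: (X' :\ x)| = #|X :\: X'|.+1.
    rewrite (cardsD1 x (X :\: (X' :\ x))) !inE eqxx (subsetP sX) //= add1n; congr _.+1.
    by apply: eq_card => z; rewrite !inE; case: eqVneq => // ->; rewrite xX'.
  by lia.
have degY y : y \in Y' -> 8 <= ldeg X' y.
  move=> yY'; have := maxXY (X', Y' :\ y); rewrite /ok /= sX.
  rewrite (subset_trans (subD1set _ _) sY) /weight /= => /(_ isT).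
  rewrite !card_edges_r (big_setD1 y yY') /=.
  have -> : #|Y :\: (Y' :\ y)| = #|Y :\: Y'|.+1.
    rewrite (cardsD1 y (Y :\: (Y' :\ y))) !inE eqxx (subsetP sY) //= add1n; congr _.+1.
    by apply: eq_card => z; rewrite !inE; case: eqVneq => // ->; rewrite yY'.
  by lia.
exists #|bip_edges X' Y'|; split.
  have := maxXY (X, Y) okXY; rewrite /weight /= !setDv !cards0 addn0 muln0 addn0 => le_e.
  apply: leq_trans le_e _; rewrite addnC leq_add2r leq_mul2l /=.
  by apply: leq_add; apply: subset_leq_card; apply: subsetDl.
apply: leq_trans (_ : 128 * (#|X'| * #|Y'|) ^ 2 <= _); last first.
  by rewrite leq_mul2l leq_sqr leq_mul ?subset_leq_card ?orbT.
apply: hexagon_free_core => // x1 x2 x3 y1 y2 y3 /(subsetP sX) ? /(subsetP sX) ? /(subsetP sX) ?.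
by move=> /(subsetP sY) ? /(subsetP sY) ? /(subsetP sY) ?; apply: noC6.
Qed.

End BipartiteEdges.

Lemma contains_cube3 (G : sgraph) (v : bool * bool * bool -> G) : injective v ->
    (forall b c, adj (v (false, b, c)) (v (true, b, c))) ->
    (forall b c, adj (v (b, false, c)) (v (b, true, c))) ->
    (forall b c, adj (v (b, c, false)) (v (b, c, true))) ->
  contains (hypercube 3) G.
Proof.
move=> vinj a1 a2 a3.
pose i0 : 'I_3 := ord0; pose i1 : 'I_3 := inord 1; pose i2 : 'I_3 := inord 2.
exists (fun x : hypercube 3 => v (x i0, x i1, x i2)).
  move=> x y /vinj [e0 e1 e2]; apply/ffunP => -[[|[|[|]]] k3] //.
  - by rewrite (_ : Ordinal k3 = i0) //; apply: val_inj.
  - by rewrite (_ : Ordinal k3 = i1) //; apply: val_inj; rewrite /= inordK.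
  - by rewrite (_ : Ordinal k3 = i2) //; apply: val_inj; rewrite /= inordK.
move=> x y; rewrite -[adj x y]/(hypercube_adj x y) /hypercube_adj.
rewrite -sum1dep_card big_mkcond /= !big_ord_recl big_ord0 /=.
have -> : lift ord0 (ord0 : 'I_2) = i1 by apply: val_inj; rewrite /= inordK.
have -> : lift ord0 (lift ord0 (ord0 : 'I_1)) = i2 by apply: val_inj; rewrite /= inordK.
rewrite -/i0; case: (x i0) (x i1) (x i2) (y i0) (y i1) (y i2) => -[] [] [] [] [] //= _;
 by rewrite ?a1 ?a2 ?a3 // adj_sym ?a1 ?a2 ?a3.
Qed.

Lemma contains_cube3_seq (G : sgraph) (v000 v100 v010 v110 v001 v101 v011 v111 : G) :
    uniq [:: v000; v100; v010; v110; v001; v101; v011; v111] ->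
    [&& adj v000 v100, adj v000 v010 & adj v000 v001] ->
    [&& adj v110 v100, adj v110 v010 & adj v110 v111] ->
    [&& adj v101 v100, adj v101 v001 & adj v101 v111] ->
    [&& adj v011 v010, adj v011 v001 & adj v011 v111] ->
  contains (hypercube 3) G.
Proof.
move=> uniq_v /and3P[? ? ?] /and3P[? ? ?] /and3P[? ? ?] /and3P[? ? ?].
pose code (p : bool * bool * bool) := p.1.1 + p.1.2.*2 + p.2 * 4.
have code_lt p : code p < 8 by case: p => -[[] []] [].
set s := [:: _; _; _; _; _; _; _; _] in uniq_v.
apply: (@contains_cube3 G (fun p => nth v000 s (code p))) => [p q e|||].
  have := @nth_uniq _ v000 s _ _ (code_lt p) (code_lt q) uniq_v; rewrite e eqxx.
  by case: p {e} => -[[] []] []; case: q => -[[] []] [].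
all: by case=> -[] //=; rewrite adj_sym.
Qed.

Lemma sum_sqr_le_card (I : finType) (E : {set I}) (f : I -> nat) :
  (\sum_(i in E) f i) ^ 2 <= #|E| * \sum_(i in E) f i ^ 2.
Proof.
rewrite -sum1_card !(big_mkcond (mem E)) /=; apply: sum_sqr_le => i.
by case: ifP; rewrite ?mul1n.
Qed.

(** Holder's inequality with exponents 3 and 3/2, up to the factor 8, which is the price for
    avoiding roots: terms below half the average make up at most half of the sum and are dropped. *)
Lemma sum_cube_le (I : finType) (E : {set I}) (e t : I -> nat) c :
    (forall i, i \in E -> e i ^ 3 <= c * t i ^ 2) ->
  (\sum_(i in E) e i) ^ 3 <= 8 * c * #|E| * (\sum_(i in E) t i) ^ 2.
Proof.
move=> e3; set W := \sum_(i in E) e i; set M := #|E|.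
have [M0|M_gt0] := posnP M.
  by rewrite /W (cards0_eq M0) big_set0.
pose big := [set i in E | W <= 2 * M * e i].
have bigE i : i \in big -> (i \in E) /\ W <= 2 * M * e i by rewrite in_set => /andP.
have W_le : W <= 2 * \sum_(i in big) e i.
  have small : 2 * (\sum_(i in E | i \notin big) e i) <= W.
    rewrite -(leq_pmul2l M_gt0) mulnA [M * 2]mulnC big_distrr /=.
    apply: leq_trans (_ : \sum_(i in E | i \notin big) W <= _).
      apply: leq_sum => i /andP[iE]; rewrite in_set iE /= -ltnNge; exact: ltnW.
    rewrite sum_nat_const leq_mul2r; apply/orP; right; apply: subset_leq_card.
    by apply/subsetP => i /andP[].
  have : W = \sum_(i in big) e i + \sum_(i in E | i \notin big) e i.
    rewrite /W (bigID (mem big)) /=; congr (_ + _); apply: eq_bigl => i.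
    by rewrite in_set; case: (i \in E).
  by clearbody W; lia.
clearbody W; have sqr_le : (\sum_(i in big) e i) ^ 2 * W <= 2 * M * c * (\sum_(i in E) t i) ^ 2.
  apply: leq_trans (_ : 2 * M * c * (\sum_(i in big) t i) ^ 2 <= _); last first.
    rewrite leq_mul2l leq_sqr; apply/orP; right; rewrite [leqRHS](bigID (mem big)) /=.
    apply: leq_trans (leq_addr _ _); apply: eq_leq; apply: eq_bigl => i.
    by rewrite in_set; case: (i \in E).
  rewrite -!mulnn !big_distrlr /= big_distrl big_distrr /=; apply: leq_sum => i /bigE[iE Wi].
  rewrite big_distrl big_distrr /=; apply: leq_sum => j /bigE[jE Wj].
  have sq k : k \in E -> W <= 2 * M * e k -> e k ^ 2 * W <= 2 * M * c * t k ^ 2.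
    move=> kE Wk; apply: leq_trans (leq_mul (leqnn _) Wk) _.
    by rewrite mulnCA -expnSr -[2 * M * c * _]mulnA leq_mul2l e3 ?orbT.
  rewrite -leq_sqr; apply: leq_trans (_ : (e i ^ 2 * W) * (e j ^ 2 * W) <= _).
    by apply: eq_leq; clearbody M; lia.
  apply: leq_trans (leq_mul (sq i iE Wi) (sq j jE Wj)) _.
  by apply: eq_leq; clearbody M; lia.
apply: leq_trans (_ : (2 * \sum_(i in big) e i) ^ 2 * W <= _).
  by rewrite expnSr leq_mul2r leq_sqr W_le orbT.
rewrite expnMn -mulnA; apply: leq_trans (leq_mul (leqnn _) sqr_le) _.
by apply: eq_leq; clearbody M; lia.
Qed.

(** * Links of pairs in a bipartite graph without Q_3 *)

Section CubeFree.
Variables (G : sgraph) (A B : {set G}) (r : rel G) (D n : nat).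
Hypotheses (disAB : [disjoint A & B]) (rAB : forall x y, r x y -> (x \in A) && (y \in B)).
Hypotheses (r_adj : forall x y, r x y -> adj x y).
Hypotheses (regA : forall x, x \in A -> #|[set y | r x y]| = D).
Hypotheses (An : #|A| <= n) (Bn : #|B| <= n).
Hypothesis freeG : is_free (hypercube 3) G.

Let NA a := [set y | r a y].
Let NB b := [set x | r x b].

(** Q_3 without two antipodal points is a hexagon. Here a and v are the antipodes, and the hexagon
    alternates between neighbours of v and neighbours of a. *)
Let link_hexagon_free a v : hexagon_free r (NB v :\ a) (NA a :\ v).
Proof.
move=> x1 x2 x3 y1 y2 y3; rewrite !in_setD1 !in_set.
move=> /andP[xa1 rx1] /andP[xa2 rx2] /andP[xa3 rx3] /andP[yv1 ry1] /andP[yv2 ry2] /andP[yv3 ry3].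
rewrite /= !inE !negb_or !andbT => /andP[/andP[x12 x13] x23] /andP[/andP[y12 y13] y23] *.
apply: freeG; apply: (@contains_cube3_seq G a y3 y1 x1 y2 x3 x2 v); last 4 first.
- by rewrite !r_adj.
- by rewrite !r_adj.
- by rewrite !r_adj.
- by rewrite !r_adj.
have [aA _] := andP (rAB ry1); have [x1A vB] := andP (rAB rx1).
have [x2A _] := andP (rAB rx2); have [x3A _] := andP (rAB rx3).
have [_ y1B] := andP (rAB ry1); have [_ y2B] := andP (rAB ry2); have [_ y3B] := andP (rAB ry3).
have AB x y : x \in A -> y \in B -> (x == y) = false.
  by move=> xA yB; apply: contraTF xA => /eqP ->; rewrite (disjointFl disAB yB).
have BA x y : x \in A -> y \in B -> (y == x) = false by move=> *; rewrite eq_sym AB.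
have nX x : x != a -> (a == x) = false by rewrite eq_sym => /negbTE.
pose neqE := (AB a y1 aA y1B, AB a y2 aA y2B, AB a y3 aA y3B, AB a v aA vB, BA x1 y1 x1A y1B,
  BA x1 y3 x1A y3B, AB x1 y2 x1A y2B, BA x3 y3 x3A y3B, BA x3 y1 x3A y1B, BA x3 y2 x3A y2B,
  BA x2 y3 x2A y3B, BA x2 y1 x2A y1B, BA x2 y2 x2A y2B, AB x1 v x1A vB, AB x2 v x2A vB, AB x3 v x3A vB).
rewrite /= !inE !negb_or !neqE !(nX x1, nX x2, nX x3) //= yv1 yv2 yv3 x12 x13.
by rewrite [y3 == y1]eq_sym y13 [y3 == y2]eq_sym y23 y12 [x3 == x2]eq_sym x23.
Qed.

Let e (q : G * G) := #|bip_edges r (NB q.2 :\ q.1) (NA q.1 :\ q.2)| - 8 * (#|NB q.2| + D).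

(** The factor 9 instead of 8 pays for the edges at a and at v that the link leaves out, at most D
    and [#|NB v|] of them. *)
Let link_le a v : a \in A -> v \in B ->
  #|bip_edges r (NB v) (NA a)| <= 9 * (#|NB v| + D) + e (a, v) /\
  e (a, v) ^ 3 <= 128 * (D * #|NB v|) ^ 2.
Proof.
move=> aA vB; have [e' [le_e' e'3]] := hexagon_free_edges (@link_hexagon_free a v).
have leNA : #|NA a :\ v| <= D by rewrite -(regA aA) subset_leq_card ?subD1set.
have leNB : #|NB v :\ a| <= #|NB v| by rewrite subset_leq_card ?subD1set.
split.
  have sub : bip_edges r (NB v) (NA a) \subset bip_edges r (NB v :\ a) (NA a :\ v) :|:
      (setX [set a] (NA a) :|: setX (NB v) [set v]).
    apply/subsetP => -[x y]; rewrite !inE /= => /and3P[-> -> ->]; rewrite !andbT.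
    by case: (x == a); case: (y == v).
  apply: leq_trans (subset_leq_card sub) _.
  apply: leq_trans (leq_card_setU _ _).1 _.
  apply: leq_trans (leq_add (leqnn _) (leq_card_setU _ _).1) _.
  rewrite !cardsX !cards1 regA // /e /=.
  by lia.
have le_ee : e (a, v) <= e'.
  by rewrite /e leq_subLR; apply: leq_trans le_e' _; rewrite leq_add2r leq_mul2l leq_add.
apply: leq_trans (_ : e' ^ 3 <= _); first by rewrite leq_exp2r.
apply: leq_trans e'3 _; rewrite leq_mul2l leq_sqr mulnC leq_mul //.
Qed.

Let W := \sum_(q in setX A B) #|bip_edges r (NB q.2) (NA q.1)|.

Let sum_NB : \sum_(b in B) #|NB b| = #|A| * D.
Proof.
rewrite -sum_nat_const -(eq_bigr _ regA).
under [RHS]eq_bigr do rewrite -sum1_card; under eq_bigr do rewrite -sum1_card.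
rewrite !pair_big_dep /= (reindex_inj (can_inj (@pair_swapK _ _))) /=.
apply: eq_bigl => -[a b]; rewrite !inE /=; apply/andP/andP => -[h1 h2].
  by case/andP: (rAB h2).
by case/andP: (rAB h2).
Qed.

(** [W] counts the walks v - w - y - a. Grouped by the middle edge wy they number D times [#|NB y|],
    since w has exactly D neighbours. *)
Let W_E : W = D * \sum_(b in B) #|NB b| ^ 2.
Proof.
rewrite /W -(card_dep_pairs _ (fun q : G * G => bip_edges r (NB q.2) (NA q.1))).
have -> : \sum_(b in B) #|NB b| ^ 2 = \sum_(p in bip_edges r A B) #|NB p.2|.
  rewrite (sum_edges_r r A B (fun b => #|NB b|)); apply: eq_bigr => b bB.
  rewrite -mulnn; congr (_ * _); apply: eq_card => a; rewrite !inE.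
  by case rab: (r a b); rewrite ?andbF // andbT; case/andP: (rAB rab).
rewrite big_distrr /=.
rewrite (eq_bigr (fun p : G * G => #|setX (NB p.2) (NA p.1)|)) => [|p]; last first.
  by rewrite inE => /and3P[pA _ _]; rewrite cardsX regA // mulnC.
rewrite -(card_dep_pairs _ (fun p : G * G => setX (NB p.2) (NA p.1))).
rewrite -(card_imset _ (can_inj (@pair_swapK _ _))); congr #|pred_of_set _|.
apply/setP => -[[a v] [w y]]; apply/idP/imsetP => [|[[[w' y'] [a' v']]]].
  rewrite !inE /= => /andP[/andP[aA vB] /and3P[rwv ray rwy]].
  by exists ((w, y), (a, v)) => //; rewrite !inE /= rwv rwy ray; case/andP: (rAB rwy) => -> ->.
rewrite !inE /= => /andP[/and3P[wA yB rwy] /andP[ray rwv]] [-> -> -> ->].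
by rewrite rwv rwy ray; case/andP: (rAB rwv) => _ ->; case/andP: (rAB ray) => ->.
Qed.

(** Cauchy-Schwarz on the degrees in B bounds [W] from below, the links bound it from above. If the
    excesses [e] dominate, m D^5 <= C n^4; the factor m <= n makes this homogeneous in n/D and
    yields the exponent 5/2. If the linear terms dominate, even m D^2 <= 36 n^2. *)
Lemma cube3_bip_bound : #|A| ^ 2 * D ^ 5 <= 8 * 1024 * n ^ 5.
Proof.
set m := #|A|; have [m0|m_gt0] := posnP m; first by rewrite m0.
have [->|D_gt0] := posnP D; first by rewrite muln0.
have Dn : D <= n.
  have [a aA] := card_gt0P m_gt0; rewrite -(regA aA); apply: leq_trans Bn.
  by apply: subset_leq_card; apply/subsetP => b; rewrite inE => /rAB/andP[].
have le_W : D * (m * D) ^ 2 <= n * W.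
  have := sum_sqr_le_card B (fun b => #|NB b|); rewrite sum_NB -/m => CS.
  rewrite W_E mulnCA leq_mul2l; apply/orP; right.
  by apply: leq_trans CS _; rewrite leq_mul2r Bn orbT.
pose t (q : G * G) := D * #|NB q.2|.
have sumAB (f : G -> nat) : \sum_(q in setX A B) f q.2 = m * \sum_(b in B) f b.
  rewrite -sum_nat_const pair_big_dep /=; apply: eq_bigl => -[a b]; by rewrite inE.
set W' := \sum_(q in setX A B) e q.
have W'_le : W' ^ 3 <= 8 * 128 * (m * n) * (m * m * D * D) ^ 2.
  apply: leq_trans (sum_cube_le (c := 128) (t := t) _) _ => [[a v]|].
    by rewrite inE => /andP[aA vB]; have [_] := link_le aA vB.
  have -> : \sum_(q in setX A B) t q = m * m * D * D.
    by rewrite (sumAB (fun b => D * #|NB b|)) -big_distrr sum_NB -/m /=; lia.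
  by rewrite cardsX leq_mul2r leq_mul2l leq_mul2l Bn !orbT.
have W_le : W <= 18 * (n * m * D) + W'.
  apply: leq_trans (_ : \sum_(q in setX A B) (9 * (#|NB q.2| + D) + e q) <= _).
    by apply: leq_sum => -[a v]; rewrite inE => /andP[aA vB]; have [] := link_le aA vB.
  rewrite big_split leq_add2r /= -big_distrr /= big_split /= (sumAB (fun b => #|NB b|)) sum_NB.
  rewrite sum_nat_const cardsX -/m.
  have h1 : m * (m * D) <= n * (m * D) by rewrite leq_mul2r An orbT.
  have h2 : m * #|B| * D <= m * n * D by rewrite leq_mul2r leq_mul2l Bn !orbT.
  by lia.
have [le_W'|lt_W'] := leqP W (2 * W').
  have h3 : (D * (m * D) ^ 2) ^ 3 <= n ^ 3 * (8 * (8 * 128 * (m * n) * (m * m * D * D) ^ 2)).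
    apply: leq_trans (_ : (n * W) ^ 3 <= _); first by rewrite leq_exp2r.
    rewrite expnMn leq_mul2l; apply/orP; right.
    apply: leq_trans (_ : (2 * W') ^ 3 <= _); first by rewrite leq_exp2r.
    by rewrite expnMn leq_mul2l W'_le orbT.
  have c_gt0 : 0 < m ^ 5 * D ^ 4 by rewrite muln_gt0 !expn_gt0 m_gt0 D_gt0.
  have h4 : m * D ^ 5 <= 8 * 1024 * n ^ 4.
    rewrite -(leq_pmul2r c_gt0); apply: leq_trans (_ : (D * (m * D) ^ 2) ^ 3 <= _); first by lia.
    by apply: leq_trans h3 _; lia.
  apply: leq_trans (_ : n * (m * D ^ 5) <= _).
    by rewrite -mulnn -mulnA leq_mul2r An orbT.
  by apply: leq_trans (leq_mul (leqnn n) h4) _; lia.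
have {}W_le : W <= 36 * (n * m * D) by clearbody W W'; lia.
have h5 : m * D ^ 2 <= 36 * n ^ 2.
  have c_gt0 : 0 < m * D by rewrite muln_gt0 m_gt0.
  rewrite -(leq_pmul2r c_gt0); apply: leq_trans (_ : n * (36 * (n * m * D)) <= _); last by lia.
  apply: leq_trans (_ : n * W <= _); last by rewrite leq_mul2l W_le orbT.
  by apply: leq_trans le_W; lia.
apply: leq_trans (_ : (m * D ^ 2) ^ 2 * D <= _); first by lia.
apply: leq_trans (_ : (36 * n ^ 2) ^ 2 * n <= _); last by lia.
by apply: leq_mul => //; rewrite leq_sqr.
Qed.

End CubeFree.

(** * Numbers of vertices of high degree *)

Lemma exists_subset_card (T : finType) (S : {set T}) k : k <= #|S| ->
  exists2 S' : {set T}, S' \subset S & #|S'| = k.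
Proof.
case/card_geqP => s [us sk sS]; exists [set x in s].
  by apply/subsetP => x; rewrite inE => /sS.
by rewrite -sk cardsE; apply/card_uniqP.
Qed.

Lemma max_cut (G : sgraph) : exists X : {set G},
  forall v, degree v <= 2 * #|[set y | adj v y && ((y \in X) != (v \in X))]|.
Proof.
pose t (X : {set G}) (x y : G) : nat := adj x y && ((y \in X) != (x \in X)).
pose cut X := \sum_x \sum_y t X x y.
have [X _ maxX] := @arg_maxnP _ (set0 : {set G}) predT cut isT.
exists X => v.
pose X' := [set x | (x \in X) (+) (x == v)].
have tC Y x y : t Y x y = t Y y x by rewrite /t adj_sym eq_sym.
have tvv Y : t Y v v = 0 by rewrite /t adj_irrefl.
have cutE Y : cut Y = 2 * (\sum_y t Y v y) + \sum_(x | x != v) \sum_(y | y != v) t Y x y.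
  rewrite /cut (bigD1 v) //= mul2n -addnn -addnA; congr (_ + _).
  rewrite [in X in X + _](bigD1 v) //= tvv add0n -big_split /=; apply: eq_bigr => x _.
  by rewrite (bigD1 v) //= tC.
have same x y : x != v -> y != v -> t X' x y = t X x y.
  by move=> xv yv; rewrite /t !inE (negbTE xv) (negbTE yv) !addbF.
have le_cut : cut X' <= cut X := maxX X' isT; rewrite !cutE in le_cut.
have eqR : \sum_(x | x != v) \sum_(y | y != v) t X' x y = \sum_(x | x != v) \sum_(y | y != v) t X x y.
  by apply: eq_bigr => x xv; apply: eq_bigr => y yv; apply: same.
rewrite eqR leq_add2r leq_mul2l /= in le_cut.
have degE : degree v = \sum_y t X v y + \sum_y t X' v y.
  rewrite -big_split /= /degree -sum1dep_card big_mkcond /=; apply: eq_bigr => y _.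
  rewrite /t !inE eqxx addbT; case vy: (adj v y) => //=.
  have /negbTE -> : y != v by apply: contraTneq vy => ->; rewrite adj_irrefl.
  by rewrite addbF; case: (y \in X) (v \in X) => -[].
have -> : #|[set y | adj v y && ((y \in X) != (v \in X))]| = \sum_y t X v y.
  by rewrite -sum1dep_card big_mkcond; apply: eq_bigr => y _; rewrite /t; case: (_ && _).
by rewrite degE; lia.
Qed.

(** A maximum cut keeps half of every degree, and the side with at least half of the high-degree
    vertices is used. Edges are then discarded until all of A has degree exactly [uphalf D]. *)
Lemma regular_bip_subgraph (G : sgraph) (D : nat) :
  exists (A B : {set G}) (r : rel G),
    [/\ #|A| <= #|[set v : G | D <= degree v]| <= 2 * #|A|, [disjoint A & B],
        forall x y, r x y -> [&& x \in A, y \in B & adj x y]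
      & forall x, x \in A -> #|[set y | r x y]| = uphalf D].
Proof.
have [X cutX] := max_cut G; set H := [set v : G | D <= degree v].
have [Y [HY cutY]] : exists Y : {set G}, #|H| <= 2 * #|H :&: Y| /\
    forall v, v \in Y -> degree v <= 2 * #|[set y | adj v y && (y \notin Y)]|.
  have [le|lt] := leqP #|H :\: X| #|H :&: X|.
    exists X; split=> [|v vX]; first by have := cardsID X H; lia.
    by apply: leq_trans (cutX v) _; rewrite vX; under eq_finset do rewrite eqb_id.
  exists (~: X); split=> [|v]; first by have := cardsID X H; rewrite -setDE; lia.
  rewrite inE => /negbTE vX; apply: leq_trans (cutX v) _; rewrite vX.
  by apply: eq_leq; congr (2 * #|pred_of_set _|); apply/setP => y; rewrite !inE negbK eqbF_neg negbK.
pose S v := [set y | adj v y && (y \notin Y)].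
pose nb v := odflt set0 [pick S' : {set G} | (S' \subset S v) && (#|S'| == uphalf D)].
have nbP v : v \in H :&: Y -> nb v \subset S v /\ #|nb v| = uphalf D.
  rewrite !inE => /andP[Dv vY]; rewrite /nb; case: pickP => [S' /andP[? /eqP]//|no].
  have [S' sS' cS'] : exists2 S' : {set G}, S' \subset S v & #|S'| = uphalf D.
    by apply: exists_subset_card; have := cutY v vY; rewrite -/(S v); lia.
  by have := no S'; rewrite sS' cS' eqxx.
exists (H :&: Y), (~: Y), (fun x y => (x \in H :&: Y) && (y \in nb x)); split=> //.
- by rewrite HY subset_leq_card ?subsetIl.
- by rewrite -setI_eq0 -setIA setICr setI0.
- move=> x y /andP[xA yx]; have [/subsetP/(_ y yx)] := nbP x xA.
  by rewrite !inE => /andP[-> ->]; move: xA; rewrite !inE => ->.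
- move=> x xA; have [_ <-] := nbP x xA; apply: eq_card => y.
  by rewrite in_set xA.
Qed.

Lemma cube3_high_degree (G : sgraph) (D : nat) : is_free (hypercube 3) G ->
  #|[set v : G | D <= degree v]| ^ 2 * D ^ 5 <= 2 ^ 20 * #|G| ^ 5.
Proof.
move=> freeG; have [A [B [r [/andP[_ leA] disAB rP regA]]]] := regular_bip_subgraph G D.
have rAB x y : r x y -> (x \in A) && (y \in B) by move/rP/and3P => [-> ->].
have r_adj x y : r x y -> adj x y by move/rP/and3P => [].
have bound := cube3_bip_bound disAB rAB r_adj regA (max_card _) (max_card _) freeG.
have leD : D <= 2 * uphalf D by lia.
apply: leq_trans (_ : (2 * #|A|) ^ 2 * (2 * uphalf D) ^ 5 <= _).
  by rewrite leq_mul ?leq_exp2r.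
by rewrite !expnMn; lia.
Qed.

Lemma hypercube_hom_degenerate (d : nat) (G : sgraph) (A B : {set G}) (r : rel G)
    (f : {ffun {ffun 'I_d -> bool} -> G}) :
    is_free (hypercube d) G -> (forall x y, r x y -> adj x y) -> cube_hom A B r predT f ->
  exists x y, x != y /\ f x = f y.
Proof.
move=> freeG r_adj /hom_onP[_ hf]; have [/injectiveP inj_f|] := boolP (injectiveb f).
  case: freeG; exists f => // x y /hypercube_adjP[i ->].
  case px: (parity x); last by apply/r_adj/hf; rewrite ?px.
  rewrite adj_sym; apply: r_adj; have := hf (flip i x) i.
  by rewrite flipK parity_flip px; apply.
by case/injectivePn => x [y xy fxy]; exists x, y.
Qed.

(** The degrees in B may vary, so B is cut into [L] dyadic degree classes and a class with most
    edges is kept. If the stars centred in A dominate, the estimate follows by cancellation. If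
    those centred in B dominate, degrees there are at most about E'/b, which gives D^k <= C L^k
    b^(k-N+1); then b <= n and m <= n finish. *)
Lemma hypercube_bip_bound (d : nat) (G : sgraph) (A B : {set G}) (r : rel G) (D : nat) :
    1 < d -> is_free (hypercube d) G -> [disjoint A & B] ->
    (forall x y, r x y -> [&& x \in A, y \in B & adj x y]) ->
    (forall x, x \in A -> #|[set y | r x y]| = D) ->
  #|A| ^ (2 ^ d.-1).-1 * D ^ (2 ^ d.-1 * d.-1) <=
  (4 ^ d) ^ (4 ^ (d - 2)) * 2 ^ (2 ^ d.-1) * (trunc_log 2 #|A|).+1 ^ (2 ^ d.-1 * d) *
    #|G| ^ (2 ^ d.-1 * d.-1).
Proof.
move=> d2 freeG disAB rP regA; set N := 2 ^ d.-1; set C0 := (4 ^ d) ^ _.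
set m := #|A|; set n := #|G|; set L := (trunc_log 2 m).+1; set k := N * d.-1.
have N_gt0 : 0 < N by rewrite expn_gt0.
have k_gt0 : 0 < k by rewrite muln_gt0 N_gt0; lia.
have C0_gt0 : 0 < C0 by rewrite !expn_gt0.
have NdE : N * d = N + k by rewrite -mulnS prednK // ltnW.
have [D0|D_gt0] := posnP D; first by rewrite D0 exp0n ?muln0.
have N2 : 1 < N by rewrite -[1]/(2 ^ 0) ltn_exp2l //; lia.
have [m0|m_gt0] := posnP m; first by rewrite m0 exp0n //; lia.
pose lv b := trunc_log 2 #|[set a | r a b]|.
pose E := [set u : G * G | r u.1 u.2].
have cardE : #|E| = m * D.
  rewrite -sum_nat_const -(eq_bigr _ regA) -(card_dep_pairs A (fun a => [set b | r a b])).
  apply: eq_card => -[a b]; rewrite !inE /=; case rab: (r a b); rewrite ?andbF // andbT.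
  by case/and3P: (rP _ _ rab) => ->.
have lv_lt b : lv b < L.
  rewrite ltnS leq_trunc_log // subset_leq_card //.
  by apply/subsetP => a; rewrite inE => /rP/andP[].
pose El (l : 'I_L) := [set u in E | lv u.2 == l].
have [l El_max] : exists l : 'I_L, m * D <= L * #|El l|.
  have [l _ maxl] := @arg_maxnP _ (ord0 : 'I_L) predT (fun l => #|El l|) isT.
  exists l; rewrite -cardE -sum1_card.
  rewrite (partition_big (fun u : G * G => Ordinal (lv_lt u.2)) predT) //=.
  apply: leq_trans (_ : \sum_(i < L) #|El l| <= _); last by rewrite sum_nat_const card_ord.
  apply: leq_sum => i _; apply: leq_trans (maxl i isT); rewrite sum1_card.
  apply: subset_leq_card; apply/subsetP => u /andP[uE /eqP <-].
  by rewrite in_set uE /=.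
have El_gt0 : 0 < #|El l|.
  by move: El_max; case: #|El l| => //; rewrite muln0 leqn0 muln_eq0 -!leqn0 leqNgt m_gt0 leqNgt D_gt0.
(* Since [trunc_log 2 0] is 0, isolated vertices have to be excluded from level 0 for the lower
   bound 2^l on degrees. *)
pose B' := [set b in B | (lv b == l) && (0 < #|[set a | r a b]|)].
pose r' : rel G := fun a b => r a b && (b \in B').
have r'E : [set u : G * G | r' u.1 u.2] = El l.
  apply/setP => -[a b]; rewrite in_set [_ \in El l]in_set [_ \in E]in_set /r' /= [b \in B']in_set.
  case rab: (r a b) => //=; have /and3P[_ -> _] := rP _ _ rab; case: (_ == _) => //=.
  by apply/card_gt0P; exists a; rewrite inE.
have r'AB x y : r' x y -> (x \in A) && (y \in B').
  by case/andP => /rP/and3P[-> _ _] ->.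
have r'adj x y : r' x y -> adj x y by case/andP => /rP/and3P[].
have disAB' : [disjoint A & B'].
  by apply: disjointWr disAB; apply/subsetP => b; rewrite inE => /andP[].
have r'deg b : b \in B' -> 2 ^ l <= #|[set a | r' a b]| < 2 ^ l.+1.
  move=> bB'; have -> : #|[set a | r' a b]| = #|[set a | r a b]|.
    by apply: eq_card => a; rewrite !inE /r' bB' andbT.
  by move: bB'; rewrite inE => /and3P[_ /eqP <- b_gt0]; apply: trunc_log_bounds.
have star := @edges_le_star d G A B' r' (ltnW d2) r'AB D (2 ^ l.+1) d2 disAB'
  (fun f => hypercube_hom_degenerate freeG r'adj).
have {star} star : #|El l| ^ (N * d) <= C0 * maxn (m * D ^ N) (#|B'| * (2 ^ l.+1) ^ N) * (m * #|B'|) ^ k.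
  rewrite -r'E; apply: star => [a aA|b bB']; last by have /andP[_ /ltnW] := r'deg b bB'.
  by rewrite -(regA a aA); apply: subset_leq_card; apply/subsetP => b; rewrite !inE => /andP[].
set b := #|B'| in star; set E' := #|El l| in star El_max El_gt0.
have b2 : b * 2 ^ l <= E'.
  rewrite /E' -r'E -sum_nat_const.
  apply: leq_trans (_ : \sum_(y in B') #|[set a | r' a y]| <= _).
    by apply: leq_sum => y /r'deg/andP[].
  rewrite -(card_dep_pairs B' (fun y => [set a | r' a y])).
  rewrite -(card_imset _ (can_inj (@pair_swapK _ _))); apply: subset_leq_card.
  apply/subsetP => _ /imsetP[[y a] ya ->]; rewrite in_set in ya.
  by case/andP: ya => _; rewrite !in_set.
have bn : b <= n by apply: max_card.
have mn : m <= n by apply: max_card.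
have L_gt0 : 0 < L by [].
have kN_le : N.-1 <= k by apply: leq_trans (leq_pred _) _; rewrite leq_pmulr //; lia.
clearbody E' b L m n C0 N k.
have E_le : (m * D) ^ (N + k) <= L ^ (N + k) * E' ^ (N + k).
  by rewrite -expnMn leq_exp2r // addn_gt0 k_gt0 orbT.
rewrite NdE in star *; have [starA|starB] := leqP (b * (2 ^ l.+1) ^ N) (m * D ^ N).
  rewrite (maxn_idPl starA) in star.
  have c_gt0 : 0 < m * m ^ k * D ^ N by rewrite !muln_gt0 !expn_gt0 m_gt0 D_gt0.
  rewrite -(leq_pmul2r c_gt0).
  have -> : m ^ N.-1 * D ^ k * (m * m ^ k * D ^ N) = (m * D) ^ (N + k).
    rewrite expnMn !expnD; have -> : m ^ N = m * m ^ N.-1 by rewrite -expnS prednK.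
    by lia.
  apply: leq_trans E_le _; apply: leq_trans (leq_mul (leqnn _) star) _.
  apply: leq_trans (_ : L ^ (N + k) * (C0 * (m * D ^ N) * (m * n) ^ k) <= _).
    by rewrite !leq_mul2l leq_exp2r // leq_mul2l bn !orbT.
  rewrite expnMn; apply: leq_trans (_ : 2 ^ N * (L ^ (N + k) * (C0 * (m * D ^ N) * (m ^ k * n ^ k))) <= _).
    by rewrite leq_pmull // expn_gt0.
  by apply: eq_leq; lia.
rewrite (maxn_idPr (ltnW starB)) in star.
have b_gt0 : 0 < b.
  case: (posnP b) star => // ->; rewrite mul0n muln0 mul0n leqn0 expn_eq0.
  by rewrite eqn0Ngt El_gt0.
have kN : N.-1 + (k - N.-1) = k by rewrite subnKC.
have h1 : E' ^ k * b ^ N.-1 <= C0 * 2 ^ N * (m * b) ^ k.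
  have c_gt0 : 0 < E' ^ N by rewrite expn_gt0 El_gt0.
  rewrite -(leq_pmul2r c_gt0).
  apply: leq_trans (_ : E' ^ (N + k) * b ^ N.-1 <= _); first by rewrite expnD; apply: eq_leq; lia.
  apply: leq_trans (leq_mul star (leqnn _)) _.
  apply: leq_trans (_ : C0 * (2 * (b * 2 ^ l)) ^ N * (m * b) ^ k <= _).
    rewrite expnS !expnMn; have -> : b ^ N = b * b ^ N.-1 by rewrite -expnS prednK.
    by apply: eq_leq; lia.
  apply: leq_trans (_ : C0 * (2 ^ N * E' ^ N) * (m * b) ^ k <= _); last by apply: eq_leq; lia.
  by rewrite leq_mul2r leq_mul2l -expnMn leq_exp2r // leq_mul2l b2 !orbT.
have h2 : D ^ k * b ^ N.-1 <= C0 * 2 ^ N * L ^ k * b ^ k.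
  have c_gt0 : 0 < m ^ k by rewrite expn_gt0 m_gt0.
  rewrite -(leq_pmul2l c_gt0) mulnA -expnMn.
  apply: leq_trans (_ : (L * E') ^ k * b ^ N.-1 <= _).
    by rewrite leq_mul2r leq_exp2r // El_max orbT.
  rewrite expnMn -mulnA; apply: leq_trans (leq_mul (leqnn _) h1) _.
  by rewrite expnMn; apply: eq_leq; lia.
have h3 : D ^ k <= C0 * 2 ^ N * L ^ k * n ^ (k - N.-1).
  have c_gt0 : 0 < b ^ N.-1 by rewrite expn_gt0 b_gt0.
  rewrite -(leq_pmul2r c_gt0); apply: leq_trans h2 _.
  have -> : b ^ k = b ^ (k - N.-1) * b ^ N.-1 by rewrite -expnD addnC kN.
  rewrite mulnA leq_mul2r leq_mul2l; apply/orP; right; apply/orP; right.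
  by have [->//|lt0] := posnP (k - N.-1); rewrite leq_exp2r.
apply: leq_trans (leq_mul (_ : m ^ N.-1 <= n ^ N.-1) h3) _; first by rewrite leq_exp2r //; lia.
rewrite mulnCA -expnD kN leq_mul2r leq_mul2l leq_pexp2l ?leq_addl ?orbT //.
Qed.

Lemma hypercube_high_degree (d : nat) (G : sgraph) (D h : nat) : 1 < d -> is_free (hypercube d) G ->
    #|[set v : G | D <= degree v]| = h ->
  h ^ (2 ^ d.-1).-1 * D ^ (2 ^ d.-1 * d.-1) <=
  2 ^ ((2 ^ d.-1).-1 + 2 ^ d.-1 * d.-1) * ((4 ^ d) ^ (4 ^ (d - 2)) * 2 ^ (2 ^ d.-1)) *
    (trunc_log 2 h).+1 ^ (2 ^ d.-1 * d) * #|G| ^ (2 ^ d.-1 * d.-1).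
Proof.
move=> d2 freeG hE; have [A [B [r [/andP[Ah hA] disAB rP regA]]]] := regular_bip_subgraph G D.
rewrite hE in Ah hA; have := hypercube_bip_bound d2 freeG disAB rP regA.
set N := 2 ^ d.-1; set C0 := (4 ^ d) ^ _ * _; set k := N * d.-1; set n := #|G| => bound; clearbody C0.
have N2 : 1 < N by rewrite -[1]/(2 ^ 0) ltn_exp2l //; lia.
have k_gt0 : 0 < k by rewrite muln_gt0; lia.
apply: leq_trans (_ : (2 * #|A|) ^ N.-1 * (2 * uphalf D) ^ k <= _).
  by apply: leq_mul; rewrite leq_exp2r //; lia.
rewrite !expnMn mulnACA -expnD -!mulnA leq_mul2l; apply/orP; right.
apply: leq_trans bound _; rewrite -!mulnA leq_mul2l leq_mul2r; apply/orP; right; apply/orP; right.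
by rewrite leq_exp2r ?muln_gt0 ?ltnS ?leq_trunc_log //; lia.
Qed.

(** * Separators of the cube *)

Section Separator.
Import GRing.Theory Num.Theory.
Local Open Scope ring_scope.
Variable d : nat.
Notation Q := {ffun 'I_d -> bool}.

(** Huang's recursive signing in closed form, up to reversing the order of coordinates. The sign
    does not involve coordinate i, so both ends of an edge give it the same sign. *)
Definition cube_sign (x : Q) (i : 'I_d) : rat := \prod_(k : 'I_d | (k < i)%N) (-1) ^+ (x k).

(* The signing of the adjacency matrix of the cube whose square is d times the identity. *)
Definition signed_adj (y : Q -> rat) (x : Q) : rat := \sum_i cube_sign x i * y (flip i x).

Lemma cube_sign_flip x i j :
  cube_sign (flip j x) i = (if (j < i)%N then -1 else 1) * cube_sign x i.
Proof.
rewrite /cube_sign; case: ifP => ji.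
  rewrite (bigD1 j) //= [in RHS](bigD1 j) //= mulrA ffunE eqxx addbT; congr (_ * _).
    by case: (x j); rewrite ?mulN1r ?opprK.
  by apply: eq_bigr => k /andP[_ kj]; rewrite ffunE (negbTE kj) addbF.
rewrite mul1r; apply: eq_bigr => k ki; rewrite ffunE.
by rewrite (_ : k == j = false) ?addbF //; apply: contraFF ji => /eqP <-.
Qed.

Lemma cube_sign_sqr x i : cube_sign x i * cube_sign x i = 1.
Proof.
rewrite -expr2 /cube_sign -prodrXl big1 // => k _.
by case: (x k); rewrite ?expr0 ?expr1 ?sqrrN expr1n.
Qed.

(** The walks i, j and j, i with i != j reach the same point with opposite signs and cancel; the d
    walks i, i return with sign 1. *)
Lemma signed_adj_sqr y x : signed_adj (signed_adj y) x = d%:R * y x.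
Proof.
pose t i j := cube_sign x i * (cube_sign (flip i x) j * y (flip j (flip i x))).
have -> : signed_adj (signed_adj y) x = \sum_i \sum_j t i j.
  by apply: eq_bigr => i _; rewrite big_distrr.
have diag i : t i i = y x.
  by rewrite /t cube_sign_flip ltnn mul1r flipK mulrA cube_sign_sqr mul1r.
have anti i j : i != j -> t i j = - t j i.
  move=> ij; rewrite /t !cube_sign_flip flipC.
  by case: ltngtP => [lt|gt|/val_inj e]; [ring|ring|rewrite e eqxx in ij].
have off : \sum_i \sum_(j | j != i) t i j = 0.
  suff /eqP : (\sum_i \sum_(j | j != i) t i j) *+ 2 = 0 by rewrite mulrn_eq0 => /eqP.
  rewrite mulr2n {1}(exchange_big_dep predT) //= -big_split /= big1 // => i _.
  rewrite (eq_bigl (fun j => j != i)) => [|j]; last by rewrite eq_sym.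
  by rewrite -big_split big1 //= => j ji; rewrite (anti j i ji) addNr.
rewrite (eq_bigr (fun i => y x + \sum_(j | j != i) t i j)) => [|i _]; last first.
  by rewrite (bigD1 i) //= diag.
by rewrite big_split /= off addr0 sumr_const card_ord mulr_natl.
Qed.

Lemma signed_adj_sym (y z : Q -> rat) :
  \sum_x z x * signed_adj y x = \sum_x signed_adj z x * y x.
Proof.
under eq_bigr do rewrite big_distrr /=; under [RHS]eq_bigr do rewrite big_distrl /=.
rewrite exchange_big [RHS]exchange_big; apply: eq_bigr => i _.
rewrite [RHS](reindex_inj (can_inj (flipK i))) /=; apply: eq_bigr => x _.
by rewrite flipK cube_sign_flip ltnn mul1r mulrA [z x * _]mulrC.
Qed.

Lemma underdetermined_solution (T : finType) (E O : {set T}) (c : T -> T -> rat) :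
    (#|O| < #|E|)%N ->
  exists y : T -> rat, [/\ exists2 v, v \in E & y v != 0, forall x, x \notin E -> y x = 0
    & forall o, o \in O -> \sum_x y x * c x o = 0].
Proof.
move=> ltOE; pose M := \matrix_(i < #|E|, j < #|O|) c (enum_val i) (enum_val j).
have /rowV0Pn[v /sub_kermxP vM v0] : kermx M != 0.
  rewrite -mxrank_eq0 mxrank_ker -lt0n subn_gt0.
  exact: leq_ltn_trans (rank_leq_col _) ltOE.
have [e0 e0E] : exists e0, e0 \in E by apply/card_gt0P; apply: leq_ltn_trans ltOE.
pose y x := if x \in E then v 0 (enum_rank_in e0E x) else 0.
have yE i : y (enum_val i) = v 0 i by rewrite /y enum_valP enum_valK_in.
exists y; split=> [|x /negbTE xE|o oO].
- have /rV0Pn[i vi] := v0; exists (enum_val i); rewrite ?enum_valP ?yE //.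
- by rewrite /y xE.
- transitivity (\sum_(x in E) y x * c x o).
    rewrite [RHS]big_mkcond /=; apply: eq_bigr => x _; case: ifP => // xE.
    by rewrite /y xE mul0r.
  rewrite big_enum_val /=; have /matrixP/(_ 0 (enum_rank_in oO o)) := vM.
  rewrite !mxE => e; rewrite -[RHS]e; apply: eq_bigr => i _.
  by rewrite yE mxE enum_rankK_in.
Qed.

Definition induced_adj (S : {set Q}) : rel Q := fun x y => [&& x \in S, y \in S & hypercube_adj x y].

(** Build C from v along edges: every new point adds at most one direction in which some point
    differs from v. The number of points therefore always exceeds the number of directions, which
    finally is d. A largest subset [B] with this property replaces the process. *)
Lemma connected_card (S : {set Q}) (v : Q) (C := [set w | connect (induced_adj S) v w]) :
  (forall i, exists2 w, w \in C & w i != v i) -> (d < #|C|)%N.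
Proof.
move=> Cdir; pose dirs (B : {set Q}) := [set i | [exists w in B, w i != v i]].
pose ok (B : {set Q}) := [&& v \in B, B \subset C & (#|dirs B| < #|B|)%N].
have dirs1 : dirs [set v] = set0.
  by apply/setP => i; rewrite !inE; apply/existsP => -[w]; rewrite inE => /andP[/eqP -> /eqP].
have ok1 : ok [set v].
  by rewrite /ok set11 sub1set inE connect0 dirs1 cards0 cards1.
have [B /and3P[vB BC Bdirs] maxB] := @arg_maxnP _ [set v] ok (fun B => #|B|) ok1.
have dirsC : #|dirs C| = d.
  rewrite -[RHS]card_ord; apply: eq_card => i; rewrite !inE.
  by have [w wC wi] := Cdir i; apply/existsP; exists w; rewrite wC.
suff CB : C \subset B.
  have BeqC : B = C by apply/eqP; rewrite eqEsubset BC CB.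
  by move: Bdirs; rewrite BeqC dirsC.
apply/negPn/negP => nCB.
have [b [w [bB wC wB bw]]] : exists b w, [/\ b \in B, w \in C, w \notin B & hypercube_adj b w].
  have [/forallP h|/forallPn[b /forallPn[w]]] :=
      boolP [forall b, forall w, [&& b \in B, w \in C & hypercube_adj b w] ==> (w \in B)].
    case/negP: nCB; apply/subsetP => w; rewrite inE => /connectP[p pth ->].
    have reach q x : x \in B -> connect (induced_adj S) v x -> path (induced_adj S) x q -> last x q \in B; last first.
      by apply: reach pth; rewrite ?connect0.
    elim: q x => [|u q IH] x xB cx //= /andP[xu].
    apply: IH; last exact: connect_trans cx (connect1 xu).
    have := forallP (h x) u; rewrite xB inE (connect_trans cx (connect1 xu)) /=.
    by case/and3P: (xu) => _ _ -> /implyP; apply.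
  by rewrite negb_imply => /andP[/and3P[? ? ?] ?]; exists b, w.
have ok2 : ok (w |: B).
  rewrite /ok !inE vB orbT subUset sub1set wC BC /= cardsU1 wB add1n ltnS.
  have /hypercube_adjP[i wE] := bw.
  apply: leq_trans (_ : #|i |: dirs B| <= _)%N.
    apply: subset_leq_card; apply/subsetP => k; rewrite !inE => /existsP[x].
    rewrite !inE => /andP[/orP[/eqP ->|xB] xk]; last by apply/orP; right; apply/existsP; exists x; rewrite xB.
    have [//|ki] := eqVneq k i; move: xk; rewrite wE ffunE (negbTE ki) addbF => bk.
    by apply/existsP; exists b; rewrite bB.
  by rewrite cardsU1; apply: leq_trans Bdirs; case: (_ \notin _).
by have := maxB _ ok2; rewrite cardsU1 wB /geq /= add1n ltnn.
Qed.

(* Let A be the signed adjacency matrix.  Counting dimensions gives y <> 0 supported on the even points of S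
   with A y = 0 on the odd points of S.  For the component C of S at a point where y does not vanish, the
   restriction z of y to C satisfies |A z|^2 = d |z|^2 = |(A z) restricted to C|^2, so A z vanishes off C.
   Hence C lies in no facet, and a connected set in no facet has more than d points. *)
Lemma cube_separator (L : eqType) (kappa : Q -> L) (S : {set Q}) : (2 ^ d.-1 < #|S|)%N ->
    (forall x y, x \in S -> y \in S -> hypercube_adj x y -> kappa x = kappa y) ->
  exists2 v, v \in S & (d < #|[set w in S | kappa w == kappa v]|)%N.
Proof.
move=> S_gt kappaS.
have d_gt0 : (0 < d)%N.
  rewrite lt0n; apply/negP => /eqP d0; have := leq_trans S_gt (max_card _).
  by rewrite card_ffun card_bool card_ord d0.
pose E := [set x in S | ~~ parity x]; pose O := [set x | parity x] :\: S.
have ltOE : (#|O| < #|E|)%N.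
  rewrite /O; set P := [set x | parity x].
  have cP : #|P| = (2 ^ d.-1)%N.
    by rewrite -(card_parity true d_gt0); apply: eq_card => x; rewrite !inE eqb_id.
  have cE : #|E| = #|S :\: P| by apply: eq_card => x; rewrite !inE andbC.
  have := cardsID P S; have := cardsID S P; rewrite cE cP setIC.
  by move=> eP eS; rewrite -(ltn_add2l #|S :&: P|) eP eS.
have [y [[v vE yv] yE yO]] :=
  underdetermined_solution (fun x o => signed_adj (fun z => (z == x)%:R) o) ltOE.
have adjE z x : signed_adj z x = \sum_w z w * signed_adj (fun u => (u == w)%:R) x.
  rewrite /signed_adj; under [RHS]eq_bigr do rewrite big_distrr /=.
  rewrite exchange_big; apply: eq_bigr => i _; rewrite (bigD1 (flip i x)) //= eqxx mulr1.
  rewrite big1 ?addr0 1?mulrC // => w /negbTE nw.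
  by rewrite eq_sym nw !mulr0.
have {}yO o : o \in O -> signed_adj y o = 0 by move=> oO; rewrite adjE yO.
have [vS pv] : v \in S /\ ~~ parity v by apply/andP; move: vE; rewrite inE.
pose C := [set w | connect (induced_adj S) v w].
have CS w : w \in C -> w \in S.
  rewrite inE => /connectP[p]; elim: p v vS {yv vE pv C} => [|u p IH] x xS /=; first by move=> _ ->.
  by case/andP => /and3P[_ uS _]; apply: IH.
have Cstep w u : w \in C -> u \in S -> hypercube_adj w u -> u \in C.
  move=> wC uS wu; have wS := CS w wC; move: wC; rewrite !inE => cw.
  by apply: connect_trans cw (connect1 _); rewrite /induced_adj wS uS.
have adj_flip (x : Q) i : hypercube_adj x (flip i x) by apply/hypercube_adjP; exists i.
pose yC x := if x \in C then y x else 0.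
pose u x := if x \in C then signed_adj y x else 0.
have yodd x : parity x -> y x = 0 by move=> px; apply: yE; rewrite inE px andbF.
have zC x : x \in C -> signed_adj yC x = signed_adj y x.
  move=> xC; apply: eq_bigr => i _; congr (_ * _); rewrite /yC; case: ifPn => // nC.
  rewrite yE // inE; apply: contra nC => /andP[fS _]; exact: (Cstep _ _ xC fS (adj_flip _ _)).
have uE w : w \in C -> ~~ parity w -> signed_adj u w = d%:R * y w.
  move=> wC pw; rewrite -signed_adj_sqr; apply: eq_bigr => i _; congr (_ * _).
  rewrite /u; case: ifPn => // nC; rewrite yO // !inE parity_flip pw andbT.
  by apply: contra nC => fS; exact: (Cstep _ _ wC fS (adj_flip _ _)).
have norm1 : \sum_x signed_adj yC x * signed_adj yC x = d%:R * \sum_x yC x * yC x.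
  rewrite signed_adj_sym big_distrr /=; apply: eq_bigr => x _.
  by rewrite signed_adj_sqr mulrA.
have norm2 : \sum_x u x * signed_adj yC x = d%:R * \sum_x yC x * yC x.
  rewrite signed_adj_sym big_distrr /=; apply: eq_bigr => x _.
  rewrite /yC; case: ifPn => xC; rewrite ?mulr0 // mulrA; case px: (parity x); last by rewrite uE ?px.
  by rewrite yodd // !mulr0.
have vanish x : x \notin C -> signed_adj yC x = 0.
  move=> xC; have : \sum_(x | x \notin C) signed_adj yC x ^+ 2 = 0.
    have := norm1; rewrite -norm2 (bigID (mem C)) /= [in X in _ = X -> _](bigID (mem C)) /=.
    rewrite [X in _ = _ + X -> _]big1 ?addr0 => [|w /negbTE wC]; last by rewrite /u wC mul0r.
    rewrite (eq_bigr (fun w => u w * signed_adj yC w)) => [|w wC]; last by rewrite /u wC zC.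
    move/eqP; rewrite -subr_eq0 addrAC subrr add0r => /eqP Y0.
    by rewrite -[RHS]Y0; apply: eq_bigr.
  move/eqP; rewrite psumr_eq0 => [/allP/(_ x)|w _]; last exact: sqr_ge0.
  by rewrite mem_index_enum xC sqrf_eq0 => /(_ isT)/eqP.
have vC : v \in C by rewrite inE connect0.
have Cdir i : exists2 w, w \in C & w i != v i.
  have [/existsP[w /andP[wC wi]]|] := boolP [exists w in C, w i != v i]; first by exists w.
  rewrite negb_exists_in => /forall_inP h; have fC : flip i v \notin C.
    by apply: contraTN (isT) => /h; rewrite ffunE eqxx; case: (v i).
  have := vanish _ fC; rewrite /signed_adj (bigD1 i) //= flipK /yC vC big1 => [|k ki].
    rewrite addr0 => /eqP; rewrite mulf_eq0 (negbTE yv) orbF => /eqP s0.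
    by have := cube_sign_sqr (flip i v) i; rewrite s0 mul0r => /eqP; rewrite eq_sym oner_eq0.
  case: ifP => [/h|]; last by rewrite mulr0.
  by rewrite !ffunE eqxx [i == k]eq_sym (negbTE ki); case: (v i).
exists v => //; apply: leq_trans (connected_card Cdir) _; apply: subset_leq_card.
apply/subsetP => w wC; rewrite inE (CS w wC) /=; move: wC; rewrite inE => /connectP[p].
elim: p v vS {yv vE pv C CS Cstep yC u yodd zC uE norm1 norm2 vanish vC Cdir} => [|x p IH] v vS /=.
  by move=> _ ->.
by case/andP => /and3P[_ xS vx] /IH h /h /eqP ->; rewrite ?xS // -(kappaS v x).
Qed.

End Separator.

(** * Embeddings of the cube *)

Lemma exists_injection (I T : finType) (D : {set I}) (S : {set T}) : #|D| <= #|S| -> 0 < #|S| ->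
  exists2 f : I -> T, {in D, forall x, f x \in S} & {in D &, injective f}.
Proof.
move=> DS /card_gt0P[t0 _]; pose f x := nth t0 (enum S) (index x (enum D)).
have lt x : x \in D -> index x (enum D) < size (enum S).
  by move=> xD; rewrite -cardE; apply: leq_trans DS; rewrite cardE index_mem mem_enum.
exists f => [x xD|x y xD yD /eqP]; first by rewrite -mem_enum mem_nth ?lt.
rewrite nth_uniq ?enum_uniq ?lt // => /eqP /(congr1 (nth x (enum D))).
by rewrite !nth_index ?mem_enum.
Qed.

Section Embedding.
Variables (d : nat) (G : sgraph).
Hypothesis d_gt0 : 0 < d.
Notation Q := {ffun 'I_d -> bool}.
Notation N := (2 ^ d.-1).

Definition nbhd (v : G) : {set G} := [set y | adj v y].

Definition common_nbhd (P : {set G}) : {set G} := [set y | [forall x in P, adj x y]].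

Lemma common_nbhdP (P : {set G}) y : reflect (forall x, x \in P -> adj x y) (y \in common_nbhd P).
Proof. by rewrite inE; apply: forall_inP. Qed.

Lemma common_nbhd_notin (P : {set G}) y : y \in common_nbhd P -> y \notin P.
Proof. by move=> /common_nbhdP h; apply/negP => /h; rewrite adj_irrefl. Qed.

Let contains_bip (f : Q -> G) : injective f ->
  (forall x i, ~~ parity x -> adj (f x) (f (flip i x))) -> contains (hypercube d) G.
Proof.
move=> f_inj f_adj; exists f => // x y /hypercube_adjP[i ->].
case px: (parity x); last by apply: f_adj; rewrite px.
by have := f_adj (flip i x) i; rewrite parity_flip px flipK adj_sym; apply.
Qed.

Let inj_split (b : Q -> bool) (f g : Q -> G) :
  (forall x y, b x -> b y -> f x = f y -> x = y) ->
  (forall x y, ~~ b x -> ~~ b y -> g x = g y -> x = y) ->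
  (forall x y, b x -> ~~ b y -> f x != g y) -> injective (fun x => if b x then f x else g x).
Proof.
move=> f_inj g_inj fg x y; case: ifPn => bx; case: ifPn => b_y e.
- exact: f_inj.
- by have := fg x y bx b_y; rewrite e eqxx.
- by have := fg y x b_y bx; rewrite e eqxx.
- exact: g_inj.
Qed.

Lemma contains_of_common_nbhd (P : {set G}) : #|P| = N -> N <= #|common_nbhd P| ->
  contains (hypercube d) G.
Proof.
move=> cP cC; have N_gt0 : 0 < N by rewrite expn_gt0.
have [fe feP fe_inj] : exists2 f : Q -> G, {in [set x | parity x == false], forall x, f x \in P}
    & {in [set x | parity x == false] &, injective f}.
  by apply: exists_injection; rewrite ?card_parity ?cP.
have [fo foC fo_inj] : exists2 f : Q -> G, {in [set x | parity x == true], forall x, f x \in common_nbhd P}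
    & {in [set x | parity x == true] &, injective f}.
  by apply: exists_injection; rewrite ?card_parity //; apply: leq_trans cC.
apply: (@contains_bip (fun x => if parity x then fo x else fe x)).
  apply: inj_split => [x y px py|x y px py|x y px py].
  - by apply: fo_inj; rewrite inE ?px ?py.
  - by apply: fe_inj; rewrite inE ?(negbTE px) ?(negbTE py).
  - apply/eqP => e; have := @common_nbhd_notin P (fo x) (foC x _).
    by rewrite inE px e feP ?inE ?(negbTE py) // => /(_ isT).
move=> x i px; rewrite parity_flip (negbTE px) /=.
have /common_nbhdP : fo (flip i x) \in common_nbhd P by apply: foC; rewrite inE parity_flip px.
by apply; apply: feP; rewrite inE (negbTE px).
Qed.

(** The zero vector goes to v and its d neighbours to neighbours of v in the common neighbourhood U
    of W; the other even points fill W, the other odd points fill U. The strict bound on U leaves N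
    places even if v lies in U. *)
Lemma contains_of_star (W : {set G}) (v : G) : #|W| = N.-1 -> v \notin W ->
    N < #|common_nbhd W| -> d <= #|nbhd v :&: common_nbhd W| ->
  contains (hypercube d) G.
Proof.
move=> cW vW cU cv; have N_gt0 : 0 < N by rewrite expn_gt0.
set U := common_nbhd W in cU cv.
have UW y : y \in U -> y \notin W by apply: common_nbhd_notin.
pose o : Q := [ffun=> false].
have po : parity o = false by rewrite /parity big1 // => i _; rewrite ffunE.
pose No := [set flip i o | i : 'I_d].
have cNo : #|No| = d.
  rewrite card_imset ?card_ord // => i j /ffunP/(_ i); rewrite !ffunE eqxx /=.
  by case: eqP.
have [S1 S1v cS1] := exists_subset_card cv.
have S1U : S1 \subset U by apply: subset_trans S1v (subsetIr _ _).
have [f1 f1S f1_inj] : exists2 f : Q -> G, {in No, forall x, f x \in S1} & {in No &, injective f}.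
  by apply: exists_injection; rewrite ?cNo cS1.
pose Od := [set x : Q | parity x == true] :\: No.
have NoO : No \subset [set x : Q | parity x == true].
  by apply/subsetP => _ /imsetP[i _ ->]; rewrite inE parity_flip po.
have cOd : #|Od| = N - d.
  by rewrite /Od cardsD (setIidPr NoO) card_parity // cNo.
pose S2 := (U :\ v) :\: S1.
have cS2 : N - d <= #|S2|.
  rewrite /S2 cardsD; have := subset_leq_card (subsetIr (U :\ v) S1); rewrite cS1.
  have := cardsD1 v U; have : (v \in U) <= 1 by case: (_ \in _).
  by lia.
have [f2 f2S f2_inj] : exists2 f : Q -> G, {in Od, forall x, f x \in S2} & {in Od &, injective f}.
  have [Od0|Od_gt0] := posnP #|Od|.
    by exists (fun=> v) => x; rewrite (cards0_eq Od0) inE.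
  by apply: exists_injection; rewrite ?cOd //; apply: leq_trans cS2; rewrite -cOd.
pose Ev := [set x : Q | parity x == false] :\ o.
have cEv : #|Ev| = N.-1.
  have := cardsD1 o [set x : Q | parity x == false].
  by rewrite -/Ev card_parity // inE po eqxx add1n => ->.
have [fe feW fe_inj] : exists2 f : Q -> G, {in Ev, forall x, f x \in W} & {in Ev &, injective f}.
  have [W0|W_gt0] := posnP #|W|.
    by exists (fun=> v) => x; rewrite (cards0_eq (etrans cEv (etrans (esym cW) W0))) inE.
  by apply: exists_injection => //; rewrite cEv cW.
pose fodd x := if x \in No then f1 x else f2 x.
pose fev x := if x == o then v else fe x.
have inOd x : parity x -> x \notin No -> x \in Od by move=> px xN; rewrite !inE px xN.
have inEv x : ~~ parity x -> x != o -> x \in Ev by move=> px xo; rewrite !inE (negbTE px) xo.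
have foddU x : parity x -> fodd x \in U /\ fodd x != v.
  move=> px; rewrite /fodd; case: ifPn => xN.
    have xS1 := f1S x xN; split; first exact: (subsetP S1U).
    apply: contraTneq (subsetP S1v _ xS1) => ->; rewrite !inE adj_irrefl //.
  by have := f2S x (inOd x px xN); rewrite !in_setD in_set1 => /and3P[_ -> ->].
apply: (@contains_bip (fun x => if parity x then fodd x else fev x)).
  apply: inj_split => [x y px py|x y px py|x y px py].
  - rewrite /fodd; case: ifPn => xN; case: ifPn => yN e.
    + exact: f1_inj.
    + by have := f2S y (inOd y py yN); rewrite -e !in_setD f1S.
    + by have := f2S x (inOd x px xN); rewrite e !in_setD f1S.
    + by apply: f2_inj e; apply: inOd.
  - rewrite /fev; case: eqP => [->|/eqP xo]; case: eqP => [->|/eqP yo] // e.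
    + by have := feW y (inEv y py yo); rewrite -e (negbTE vW).
    + by have := feW x (inEv x px xo); rewrite e (negbTE vW).
    + by apply: fe_inj e; apply: inEv.
  - have [fU fv] := foddU x px; rewrite /fev; have [//|yo] := eqVneq y o.
    by apply: contraNneq (UW _ fU) => ->; apply/feW/inEv.
move=> x i px; rewrite parity_flip (negbTE px) /= /fev; case: eqP => [->|/eqP xo].
  have iN : flip i o \in No by apply: imset_f.
  by rewrite /fodd iN; have := subsetP S1v _ (f1S _ iN); rewrite !inE => /andP[].
have pf : parity (flip i x) by rewrite parity_flip.
by have [/common_nbhdP h _] := foddU _ pf; apply/h/feW/inEv.
Qed.

(** Count edges from the other end. A vertex with at least N neighbours in B is a common neighbour
    of some N-subset of B; each such subset has fewer than N common neighbours, as Q_d lies in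
    K_{N,N}. *)
Lemma sum_degree_le (B : {set G}) : is_free (hypercube d) G ->
  \sum_(b in B) degree b <= N.-1 * #|G| + #|B| * (2 ^ #|B| * N).
Proof.
move=> freeG; have N_gt0 : 0 < N by rewrite expn_gt0.
pose k v := #|nbhd v :&: B|.
have -> : \sum_(b in B) degree b = \sum_v k v.
  rewrite /degree /k; under eq_bigr do rewrite -sum1_card.
  under [RHS]eq_bigr do rewrite -sum1_card.
  rewrite !pair_big_dep /= (reindex_inj (can_inj (@pair_swapK _ _))) /=.
  by apply: eq_bigl => -[a b]; rewrite !inE /= adj_sym andbC.
pose Bad := [set v | N <= k v].
apply: leq_trans (_ : \sum_v (N.-1 + (v \in Bad) * #|B|) <= _).
  apply: leq_sum => v _; rewrite inE; case: (leqP N (k v)) => /= kN; last by apply: leq_trans (leq_addr _ _); rewrite -ltnS prednK.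
  by rewrite mul1n; apply: leq_trans (leq_addl _ _); apply: subset_leq_card; apply: subsetIr.
rewrite big_split /= sum_nat_const cardT -cardE mulnC leq_add2l -big_distrl /= mulnC leq_mul2l.
apply/orP; right.
have -> : \sum_v (v \in Bad) = #|Bad| by rewrite -sum1_card [RHS]big_mkcond; apply: eq_bigr => v _; case: (_ \in _).
pose Ps := [set P : {set G} | (P \subset B) && (#|P| == N)].
apply: leq_trans (_ : #|\bigcup_(P in Ps) common_nbhd P| <= _).
  apply: subset_leq_card; apply/subsetP => v; rewrite inE => /exists_subset_card[P sP cP].
  apply/bigcupP; exists P; first by rewrite inE cP eqxx (subset_trans sP (subsetIr _ _)).
  by apply/common_nbhdP => x xP; have := subsetP sP x xP; rewrite !inE adj_sym => /andP[].
apply: leq_trans (card_bigcup_le _ _) _.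
apply: leq_trans (_ : \sum_(P in Ps) N <= _).
  apply: leq_sum => P; rewrite inE => /andP[_ /eqP cP]; rewrite leqNgt; apply/negP => /ltnW ltC.
  by apply: freeG; apply: contains_of_common_nbhd ltC.
rewrite sum_nat_const leq_mul2r -card_powerset; apply/orP; right; apply: subset_leq_card.
by apply/subsetP => P; rewrite !inE => /andP[].
Qed.

End Embedding.

Lemma degree_lt (G : sgraph) (v : G) : (degree v < #|G|)%N.
Proof.
rewrite /degree -cardsT; apply: proper_card; rewrite properE subsetT /=.
by apply/subsetPn; exists v; rewrite !inE ?adj_irrefl.
Qed.

Lemma card_common_nbhd (G : sgraph) (P : {set G}) :
  (#|G| <= #|common_nbhd P| + \sum_(x in P) (#|G| - degree x))%N.
Proof.
rewrite -[leqLHS](cardsC (common_nbhd P)) leq_add2l.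
apply: leq_trans (_ : #|\bigcup_(x in P) ~: nbhd x| <= _)%N.
  apply: subset_leq_card; apply/subsetP => y; rewrite !inE negb_forall_in => /exists_inP[x xP nxy].
  by apply/bigcupP; exists x; rewrite // !inE.
apply: leq_trans (card_bigcup_le _ _) _; apply: leq_sum => x _.
by rewrite [leqLHS]cardsCs setCK.
Qed.

(** Unlike in [card_common_nbhd], vertices adjacent to all others contribute 0, which makes the
    bound sharp enough for the final comparison. *)
Lemma card_uncommon (G : sgraph) (W : {set G}) :
  (#|~: (W :|: common_nbhd W)| <= \sum_(w in W) (#|G|.-1 - degree w))%N.
Proof.
apply: leq_trans (_ : #|\bigcup_(w in W) (~: nbhd w :\ w)| <= _)%N.
  apply: subset_leq_card; apply/subsetP => y; rewrite !inE negb_or negb_forall_in.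
  case/andP=> yW /exists_inP[x xP nxy]; apply/bigcupP; exists x; rewrite // !inE nxy andbT.
  by apply: contraNneq yW => ->.
apply: leq_trans (card_bigcup_le _ _) _; apply: leq_sum => w _.
have := cardsD1 w (~: nbhd w); have := cardsC (nbhd w).
rewrite !inE adj_irrefl /= /degree -/(nbhd w).
by move: #|~: _| #|_ :\ _| #|nbhd w| #|G| => a b c e; lia.
Qed.

Section Induced.
Variables (G : sgraph) (S : {set G}).
Definition induced_rel : rel {x : G | x \in S} := fun x y => adj (val x) (val y).
Fact induced_sym : symmetric induced_rel.
Proof. by move=> x y; apply: adj_sym. Qed.
Fact induced_irrefl : irreflexive induced_rel.
Proof. by move=> x; apply: adj_irrefl. Qed.
Definition induced_subgraph : sgraph := SGraph induced_sym induced_irrefl.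

Lemma card_induced : #|induced_subgraph| = #|S|.
Proof. by rewrite card_sig. Qed.

Lemma degree_induced (x : induced_subgraph) : degree x = #|nbhd (val x) :&: S|.
Proof.
rewrite /degree -(card_imset _ val_inj); congr #|pred_of_set _|; apply/setP => y.
apply/imsetP/idP => [[z]|]; first by rewrite inE => xz ->; rewrite !inE (valP z) andbT.
rewrite !inE => /andP[xy yS]; exists (exist _ y yS : induced_subgraph) => //.
by rewrite inE.
Qed.

Lemma induced_free (F : sgraph) : is_free F G -> is_free F induced_subgraph.
Proof.
move=> freeG [f f_inj f_adj]; apply: freeG; exists (fun x => val (f x)) => [x y /val_inj/f_inj//|x y].
exact: f_adj.
Qed.

End Induced.

(** * Cube-free joins *)

Lemma graph_iso_sym (G H : sgraph) : graph_iso G H -> graph_iso H G.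
Proof.
case=> f [g fK gK] f_adj; exists g; first by exists f.
by move=> x y; rewrite -f_adj !gK.
Qed.

Lemma graph_iso_trans (G H K : sgraph) : graph_iso G H -> graph_iso H K -> graph_iso G K.
Proof.
case=> f bf fA [g bg gA]; exists (g \o f); first exact: bij_comp.
by move=> x y /=; rewrite gA fA.
Qed.

Lemma graph_iso_inj (G H : sgraph) (f : G -> H) : injective f -> #|H| <= #|G| ->
  (forall x y, adj (f x) (f y) = adj x y) -> graph_iso G H.
Proof. by move=> f_inj cH fA; exists f => //; apply: inj_card_bij. Qed.

Lemma graph_iso_card (G H : sgraph) : graph_iso G H -> #|G| = #|H|.
Proof. by case=> f bf _; apply: bij_eq_card bf. Qed.

Lemma graph_iso_degree (G H : sgraph) (f : G -> H) (x : G) : bijective f ->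
  (forall x y, adj (f x) (f y) = adj x y) -> degree (f x) = degree x.
Proof.
case=> g fK gK f_adj; rewrite /degree -(card_imset _ (can_inj fK)).
congr #|pred_of_set _|; apply/setP => y; apply/idP/imsetP => [|[z]]; rewrite inE.
  by move=> xy; exists (g y); rewrite ?gK // inE -f_adj gK.
by rewrite -f_adj => xz ->; rewrite inE.
Qed.

Lemma graph_iso_contains (F G H : sgraph) : graph_iso G H -> contains F G -> contains F H.
Proof.
case=> g bg gA [f f_inj f_adj]; exists (g \o f); first exact: inj_comp (bij_inj bg) f_inj.
by move=> x y /f_adj; rewrite /= gA.
Qed.

Section Join.
Variables (s : nat) (L : sgraph).
Notation G := (join (complete s) L).

Lemma card_join : #|G| = s + #|L|.
Proof. by rewrite card_sum card_ord. Qed.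

Lemma card_sum_pred (A B : finType) (P : pred (A + B)%type) :
  #|[set u | P u]| = #|[set x | P (inl x)]| + #|[set y | P (inr y)]|.
Proof. by rewrite -!sum1dep_card big_sumType. Qed.

Lemma degree_join_l (i : 'I_s) : degree (inl i : G) = (s + #|L|).-1.
Proof.
rewrite /degree card_sum_pred /=.
rewrite [X in _ + X](eq_card (B := L)) => [|y]; last by rewrite inE.
have -> : [set x : 'I_s | adj (inl i : G) (inl x)] = ~: [set i].
  by apply/setP => x; rewrite !inE eq_sym.
by rewrite cardsC1 card_ord; have := ltn_ord i; move: #|L| => c; lia.
Qed.

Lemma degree_join_r (v : L) : degree (inr v : G) = s + degree v.
Proof.
rewrite /degree card_sum_pred; congr (_ + _).
by rewrite -[RHS]card_ord -cardsT; apply: eq_card => y; rewrite !inE.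
Qed.
End Join.

Definition is_inr (A B : Type) (u : A + B) := if u is inr _ then true else false.

Lemma card_preim_inl (T A B : finType) (f : T -> A + B) : injective f ->
  #|T| <= #|A| + #|[set x | is_inr (f x)]|.
Proof.
move=> f_inj; rewrite -(cardsC [set x | is_inr (f x)]) addnC leq_add2r; set Z := ~: _.
have [/eqP ->|/set0Pn[x0]] := boolP (Z == set0); first by rewrite cards0.
rewrite !inE; case: (f x0) => // a0 _.
rewrite -(card_in_imset (f := fun x => if f x is inl a then a else a0)); first exact: max_card.
move=> x y; rewrite !inE; case fx: (f x) => [a|] //; case fy: (f y) => [b|] // _ _ ab.
by apply: f_inj; rewrite fx fy ab.
Qed.

Lemma card_preim_inr (T A B : finType) (f : T -> A + B) (P : pred B) : injective f ->
  #|[set x | if f x is inr b then P b else false]| <= #|[set b | P b]|.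
Proof.
move=> f_inj; set Z := finset _.
have [/eqP ->|/set0Pn[x0]] := boolP (Z == set0); first by rewrite cards0.
rewrite !inE; case: (f x0) => // b0 _.
rewrite -(card_in_imset (f := fun x => if f x is inr b then b else b0)).
  apply: subset_leq_card; apply/subsetP => _ /imsetP[x + ->]; rewrite !inE.
  by case: (f x).
move=> x y; rewrite !inE; case fx: (f x) => [|a] //; case fy: (f y) => [|b] // _ _ ab.
by apply: f_inj; rewrite fx fy ab.
Qed.

(** The clique absorbs at most N - 1 of the 2N cube points, so more than N fall into L. Labels are
    constant along their edges, and [cube_separator] finds more than d of them with one label. *)
Lemma join_free (d : nat) (L : sgraph) (T : eqType) (lab : L -> T) : 0 < d ->
    (forall u v, adj u v -> lab u = lab v) ->
    (forall v, #|[set u | lab u == lab v]| <= d) ->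
  is_free (hypercube d) (join (complete (2 ^ d.-1).-1) L).
Proof.
move=> d_gt0 lab_adj lab_card [f f_inj f_adj].
pose S := [set x | is_inr (f x)].
pose kappa x := if f x is inr v then Some (lab v) else None.
have cS : 2 ^ d.-1 < #|S|.
  have N_gt0 : 0 < 2 ^ d.-1 by rewrite expn_gt0.
  have := card_preim_inl f_inj; rewrite card_ffun card_bool !card_ord -/S.
  have -> : 2 ^ d = 2 ^ d.-1 + 2 ^ d.-1 by rewrite addnn -mul2n -expnS prednK.
  move: N_gt0; move: (2 ^ d.-1) #|S| => N a; lia.
have [|v vS] := cube_separator (kappa := kappa) cS.
  move=> x y; rewrite !inE /kappa => xS yS /f_adj.
  by case: (f x) xS => // u _; case: (f y) yS => // v _ /lab_adj ->.
move: vS; rewrite inE; case fv: (f v) => [|w] // _; rewrite ltnNge => /negP; apply.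
apply: leq_trans (lab_card w); apply: leq_trans (card_preim_inr _ f_inj).
apply: subset_leq_card; apply/subsetP => x; rewrite !inE /kappa fv.
by case: (f x) => // u /=.
Qed.

Lemma degree_complete d (i : complete d) : degree i = d.-1.
Proof.
rewrite /degree (_ : [set y | _] = [set~ i]); first by rewrite cardsC1 card_ord.
by apply/setP => x; rewrite !inE eq_sym.
Qed.

Lemma degree_copies k (G : sgraph) (u : copies k G) : degree u = degree u.2.
Proof.
rewrite /degree -(card_imset [set y : G | adj u.2 y] (f := fun y => (u.1, y))); last by move=> x y [].
congr #|pred_of_set _|; apply/setP => -[j y]; rewrite inE.
apply/andP/imsetP => [[/= /eqP <- uy]|[z]]; first by exists y; rewrite ?inE.
by rewrite inE => uz [-> ->].
Qed.

Lemma copies_complete_free d k : 0 < d ->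
  is_free (hypercube d) (join (complete (2 ^ d.-1).-1) (copies k (complete d))).
Proof.
move=> d_gt0; apply: (join_free (lab := fun u : copies k (complete d) => u.1)) => // [u v /andP[/eqP]//|v].
rewrite -[leqRHS]card_ord -(card_in_imset (f := fun u : copies k (complete d) => u.2)).
  exact: max_card.
by move=> [i x] [j y]; rewrite !inE /= => /eqP -> /eqP -> ->.
Qed.

Definition cube3_vertex (x y z : bool) : {ffun 'I_3 -> bool} :=
  [ffun i : 'I_3 => nth false [:: x; y; z] i].

Lemma cube3_vertex_eq x y z x' y' z' :
  (cube3_vertex x y z == cube3_vertex x' y' z') = [&& x == x', y == y' & z == z'].
Proof.
apply/eqP/and3P => [/ffunP e|[/eqP-> /eqP-> /eqP->] //].
by have := (e ord0, e (inord 1), e (inord 2)); rewrite !ffunE !inordK //= => -[[-> ->] ->].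
Qed.

Lemma cube3_vertex_adj x y z x' y' z' :
  hypercube_adj (cube3_vertex x y z) (cube3_vertex x' y' z') =
    ((x != x') + (y != y') + (z != z') == 1).
Proof.
rewrite /hypercube_adj -sum1dep_card big_mkcond /= !big_ord_recl big_ord0 !ffunE /=.
by rewrite addn0 addnA; do 3 case: ifP => _.
Qed.

Lemma cube3_vertexE (w : {ffun 'I_3 -> bool}) : w = cube3_vertex (w ord0) (w (inord 1)) (w (inord 2)).
Proof.
apply/ffunP => i; rewrite ffunE; case: i => -[|[|[|//]]] lt_i /=; congr (w _); apply: val_inj.
- by [].
- by rewrite /= inordK.
- by rewrite /= inordK.
Qed.

Lemma sum_cube3 (F : {ffun 'I_3 -> bool} -> nat) :
  \sum_u F u = \sum_x \sum_y \sum_z F (cube3_vertex x y z).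
Proof.
rewrite pair_bigA pair_bigA /=.
rewrite (reindex (fun t : bool * bool * bool => cube3_vertex t.1.1 t.1.2 t.2)) //=.
apply: onW_bij; apply: inj_card_bij; last by rewrite !card_prod card_ffun !card_bool card_ord.
by move=> [[x y] z] [[x' y'] z'] /eqP; rewrite cube3_vertex_eq /= => /and3P[/eqP-> /eqP-> /eqP->].
Qed.

(* A set of at least five vertices of Q_3 that contains no K_{1,3} is connected: a labelling that is
   constant along its edges is constant. *)
Lemma cube3_connected (T : eqType) (b : bool -> bool -> bool -> bool) (k : bool -> bool -> bool -> T) :
    (forall x y z, b x y z && b (~~ x) y z ==> (k x y z == k (~~ x) y z)) ->
    (forall x y z, b x y z && b x (~~ y) z ==> (k x y z == k x (~~ y) z)) ->
    (forall x y z, b x y z && b x y (~~ z) ==> (k x y z == k x y (~~ z))) ->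
    (forall x y z, ~~ [&& b x y z, b (~~ x) y z, b x (~~ y) z & b x y (~~ z)]) ->
    4 < \sum_x \sum_y \sum_z b x y z ->
  exists t, forall x y z, b x y z ==> (k x y z == t).
Proof.
move=> e1 e2 e3 st; rewrite !big_bool /=.
move: (e1 false false false) (e1 false false true) (e1 false true false) (e1 false true true).
move: (e2 false false false) (e2 false false true) (e2 true false false) (e2 true false true).
move: (e3 false false false) (e3 false true false) (e3 true false false) (e3 true true false).
move: (st false false false) (st false false true) (st false true false) (st false true true).
move: (st true false false) (st true false true) (st true true false) (st true true true) => /= {e1 e2 e3 st}.
set b0 := b true true true; set b1 := b true true false; set b2 := b true false true.
set b3 := b true false false; set b4 := b false true true; set b5 := b false true false.
set b6 := b false false true; set b7 := b false false false.
set k0 := k true true true; set k1 := k true true false; set k2 := k true false true.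
set k3 := k true false false; set k4 := k false true true; set k5 := k false true false.
set k6 := k false false true; set k7 := k false false false.
move=> h1 h2 h3 h4 h5 h6 h7 h8 g1 g2 g3 g4 f1 f2 f3 f4 e1 e2 e3 e4 c.
suff [t /and5P[? ? ? ? /and4P[? ? ? ?]]] : exists t, [&& b0 ==> (k0 == t), b1 ==> (k1 == t),
  b2 ==> (k2 == t), b3 ==> (k3 == t), b4 ==> (k4 == t), b5 ==> (k5 == t), b6 ==> (k6 == t) & b7 ==> (k7 == t)].
  by exists t => -[] [] [].
move: h1 h2 h3 h4 h5 h6 h7 h8 g1 g2 g3 g4 f1 f2 f3 f4 e1 e2 e3 e4 c.
move: b0 b1 b2 b3 b4 b5 b6 b7 k0 k1 k2 k3 k4 k5 k6 k7.
do 8 case; move=> //= k0 k1 k2 k3 k4 k5 k6 k7 //=.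
all: try by do 20 (move=> ?).
all: do 20 (first [move/eqP=> ? | move=> _]); subst.
all: first [by exists k0; rewrite ?eqxx | by exists k1; rewrite ?eqxx | by exists k2; rewrite ?eqxx
  | by exists k3; rewrite ?eqxx | by exists k4; rewrite ?eqxx | by exists k5; rewrite ?eqxx
  | by exists k6; rewrite ?eqxx | by exists k7; rewrite ?eqxx].
Qed.

(** * Disjoint unions of triangles and quadrilaterals *)

(** With label classes of size 4 the separator bound falls one point short. The degree condition
    excludes K_{1,3}, so all of the at least five cube points in L get one label. *)
Lemma cube3_join_free (L : sgraph) (T : eqType) (lab : L -> T) :
    (forall u v, adj u v -> lab u = lab v) ->
    (forall v, #|[set u | lab u == lab v]| <= 4) -> (forall v : L, degree v <= 2) ->
  is_free (hypercube 3) (join (complete 3) L).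
Proof.
move=> lab_adj lab_card deg2 [f f_inj f_adj].
pose b x y z := is_inr (f (cube3_vertex x y z)).
pose k x y z := if f (cube3_vertex x y z) is inr v then Some (lab v) else None.
have f_adj' x y z x' y' z' : (x != x') + (y != y') + (z != z') = 1 ->
    adj (f (cube3_vertex x y z)) (f (cube3_vertex x' y' z')).
  by move=> e; apply: f_adj; rewrite -[adj _ _]/(hypercube_adj _ _) cube3_vertex_adj e.
have e x y z x' y' z' : (x != x') + (y != y') + (z != z') = 1 ->
    b x y z && b x' y' z' ==> (k x y z == k x' y' z').
  move=> h; have := f_adj' _ _ _ _ _ _ h; rewrite /b /k.
  by case: (f _) => // u; case: (f _) => // v /lab_adj ->; rewrite eqxx.
have star x y z : ~~ [&& b x y z, b (~~ x) y z, b x (~~ y) z & b x y (~~ z)].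
  apply/negP; rewrite /b; case fu: (f (cube3_vertex x y z)) => [|u] //= /and3P[h1 h2 h3].
  have := deg2 u; rewrite leqNgt => /negP; apply.
  apply: leq_trans (card_preim_inr _ f_inj).
  apply: leq_trans (_ : #|[set cube3_vertex (~~ x) y z; cube3_vertex x (~~ y) z; cube3_vertex x y (~~ z)]| <= _).
    by rewrite setUC cardsU1 cards2 !inE !cube3_vertex_eq; case: (x) (y) (z) => -[] [].
  have inr_adj w : adj (inr u : join (complete 3) L) (f w) -> is_inr (f w) ->
    if f w is inr v then adj u v else false by case: (f w).
  apply: subset_leq_card; apply/subsetP => w; rewrite !inE => /orP[/orP[]|] /eqP ->; apply: inr_adj => //;
    by rewrite -fu f_adj' // !eqxx; case: (x) (y) (z) => -[] [].
have e1 x y z : b x y z && b (~~ x) y z ==> (k x y z == k (~~ x) y z).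
  by apply: e; rewrite !eqxx; case: x.
have e2 x y z : b x y z && b x (~~ y) z ==> (k x y z == k x (~~ y) z).
  by apply: e; rewrite !eqxx; case: y.
have e3 x y z : b x y z && b x y (~~ z) ==> (k x y z == k x y (~~ z)).
  by apply: e; rewrite !eqxx; case: z.
pose S := [set x | is_inr (f x)].
have cS : #|S| = \sum_x \sum_y \sum_z b x y z.
  by rewrite -sum1dep_card big_mkcond /= sum_cube3; do 3 (apply: eq_bigr => ? _); rewrite /b; case: (is_inr _).
have gtS : 4 < #|S| by have := card_preim_inl f_inj; rewrite card_ffun card_bool !card_ord.
rewrite cS in gtS; have [t tP] := cube3_connected e1 e2 e3 star gtS.
move: gtS; rewrite -cS; have [->|/set0Pn[w]] := eqVneq S set0; first by rewrite cards0.
have labS w' : w' \in S -> (if f w' is inr v then Some (lab v) else None) = t.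
  rewrite inE (cube3_vertexE w') => bw.
  by have := tP (w' ord0) (w' (inord 1)) (w' (inord 2)); rewrite /b bw => /eqP.
move=> wS; have := wS; rewrite inE; case fw: (f w) => [|v] // _; rewrite ltnNge => /negP; apply.
apply: leq_trans (lab_card v); apply: leq_trans (card_preim_inr _ f_inj).
apply: subset_leq_card; apply/subsetP => x xS; have := labS _ xS; rewrite -(labS _ wS) fw.
by move: xS; rewrite !inE; case: (f x) => // v' _ [->].
Qed.

Definition C3_C4_union a b :=
  disjoint_union (copies a (cycle_graph 3)) (copies b (cycle_graph 4)).

Lemma card_C3_C4_union a b : #|C3_C4_union a b| = a * 3 + b * 4.
Proof. by rewrite card_sum !card_prod !card_ord. Qed.

Lemma card_disjoint_union (G H : sgraph) : #|disjoint_union G H| = #|G| + #|H|.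
Proof. exact: card_sum. Qed.

Lemma degree_disjoint_union_l (G H : sgraph) (x : G) : degree (inl x : disjoint_union G H) = degree x.
Proof.
rewrite /degree card_sum_pred /= [X in _ + X]eq_card0 ?addn0 // => y.
by rewrite !inE.
Qed.

Lemma degree_disjoint_union_r (G H : sgraph) (x : H) : degree (inr x : disjoint_union G H) = degree x.
Proof.
rewrite /degree card_sum_pred /= [X in X + _]eq_card0 // => y.
by rewrite !inE.
Qed.

Lemma degree_cycle3 (i : cycle_graph 3) : degree i = 2.
Proof.
rewrite /degree -sum1dep_card big_mkcond /= !big_ord_recl big_ord0.
by case: i => -[|[|[|]]].
Qed.

Lemma degree_cycle4 (i : cycle_graph 4) : degree i = 2.
Proof.
rewrite /degree -sum1dep_card big_mkcond /= !big_ord_recl big_ord0.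
by case: i => -[|[|[|[|]]]].
Qed.

Lemma degree_C3_C4_union a b (u : C3_C4_union a b) : degree u = 2.
Proof.
case: u => u; rewrite ?degree_disjoint_union_l ?degree_disjoint_union_r degree_copies.
  exact: degree_cycle3.
exact: degree_cycle4.
Qed.

Lemma C3_C4_union_free a b : is_free (hypercube 3) (join (complete 3) (C3_C4_union a b)).
Proof.
pose lab (u : C3_C4_union a b) : 'I_a + 'I_b :=
  match u with inl u => inl u.1 | inr u => inr u.1 end.
apply: (@cube3_join_free _ _ lab) => [[u|u] [v|v] //= /andP[/eqP-> //]|v|v]; last by rewrite degree_C3_C4_union.
pose pos (u : C3_C4_union a b) : 'I_4 := match u with inl u => widen_ord (isT : 3 <= 4) u.2 | inr u => u.2 end.
rewrite -[leqRHS]card_ord -(card_in_imset (f := pos)); first exact: max_card.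
move=> u w; rewrite !inE => /eqP lu /eqP; rewrite -lu {lu v}.
case: u => -[i x]; case: w => -[j y] //= [->].
  by move/(congr1 val) => /= /val_inj ->.
by move->.
Qed.

Lemma graph_iso_split (L H K : sgraph) (f : H -> L) : injective f ->
    (forall x y, adj (f x) (f y) = adj x y) ->
    (forall x y, adj (f x) y -> y \in f @: setT) ->
    graph_iso (induced_subgraph (~: (f @: setT))) K -> graph_iso L (disjoint_union H K).
Proof.
move=> f_inj f_adj closed iso; have := graph_iso_card iso; have [g bg g_adj] := graph_iso_sym iso.
rewrite card_induced => cK; apply: graph_iso_sym.
pose h (u : disjoint_union H K) : L := match u with inl x => f x | inr y => val (g y) end.
have gN y : val (g y) \notin f @: setT by have := valP (g y); rewrite inE.
have fg x y : f x != val (g y).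
  by apply: contraNneq (gN y) => <-; apply: imset_f; rewrite inE.
apply: (@graph_iso_inj _ _ h).
- case=> x [] y /= => [/f_inj->//|/eqP|/eqP|/val_inj/(bij_inj bg)->//].
    by rewrite (negbTE (fg _ _)).
  by rewrite eq_sym (negbTE (fg _ _)).
- by rewrite card_sum -cK -(cardsC (f @: setT)) leq_add2r card_imset // cardsT leqnn.
- have fgN x y : adj (f x) (val (g y)) = false by apply/negbTE; apply: contra (gN y) => /closed.
  case=> x [] y; [exact: f_adj | exact: fgN | by rewrite /= adj_sym fgN | exact: g_adj].
Qed.

Lemma C3_add_union a b :
  graph_iso (disjoint_union (cycle_graph 3) (C3_C4_union a b)) (C3_C4_union a.+1 b).
Proof.
pose h (u : disjoint_union (cycle_graph 3) (C3_C4_union a b)) : C3_C4_union a.+1 b :=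
  match u with
  | inl x => inl (ord0, x)
  | inr (inl u) => inl (lift ord0 u.1, u.2)
  | inr (inr u) => inr u
  end.
apply: (@graph_iso_inj _ _ h).
- by case=> [x|[[i x]|u]] [y|[[j y]|v]] //= [] => [->|/addnI/val_inj-> ->|->].
- by rewrite card_C3_C4_union card_disjoint_union card_C3_C4_union card_ord mulSn addnA.
- by case=> [x|[[i x]|u]] [y|[[j y]|v]] //=; rewrite /copies_adj /= ?eqxx.
Qed.

Lemma C4_add_union a b :
  graph_iso (disjoint_union (cycle_graph 4) (C3_C4_union a b)) (C3_C4_union a b.+1).
Proof.
pose h (u : disjoint_union (cycle_graph 4) (C3_C4_union a b)) : C3_C4_union a b.+1 :=
  match u with
  | inl x => inr (ord0, x)
  | inr (inl u) => inl u
  | inr (inr u) => inr (lift ord0 u.1, u.2)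
  end.
apply: (@graph_iso_inj _ _ h).
- by case=> [x|[u|[i x]]] [y|[v|[j y]]] //= [] => [->|->|/addnI/val_inj-> ->].
- by rewrite card_C3_C4_union card_disjoint_union card_C3_C4_union card_ord mulSn addnCA.
- by case=> [x|[u|[i x]]] [y|[v|[j y]]] //=; rewrite /copies_adj /= ?eqxx.
Qed.

Definition path5_free (L : sgraph) := forall a b c d e : L,
  uniq [:: a; b; c; d; e] -> adj a b -> adj b c -> adj c d -> adj d e -> False.

Lemma adj_neq (G : sgraph) (x y : G) : adj x y -> x != y.
Proof. by apply: contraTneq => ->; rewrite adj_irrefl. Qed.

Lemma degree2_nbhd (L : sgraph) (v x y z : L) : degree v = 2 -> x != y -> adj v x -> adj v y ->
  adj v z = (z == x) || (z == y).
Proof.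
move=> dv xy vx vy; suff /setP/(_ z) : [set x; y] = nbhd v by rewrite !inE => ->.
by apply/eqP; rewrite eqEcard cards2 xy -[#|nbhd v|]/(degree v) dv subUset !sub1set !inE vx vy.
Qed.

Lemma degree2_other (L : sgraph) (v x : L) : degree v = 2 -> adj v x ->
  exists2 y, y != x & adj v y.
Proof.
rewrite /degree (cardsD1 x) inE => dv vx; move: dv; rewrite vx => -[/eqP/cards1P[y /setP/(_ y)]].
by rewrite !inE eqxx => /andP[yx vy]; exists y.
Qed.

(** An induced cycle already uses both edges at each of its vertices, so it is a component; deleting
    it preserves the hypotheses. *)
Lemma union_of_C3_C4_split (L : sgraph) m (f : cycle_graph m -> L) : 
    m = 3 \/ m = 4 -> injective f -> (forall x y, adj (f x) (f y) = adj x y) ->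
    (forall v : L, degree v = 2) -> path5_free L ->
    (forall H : sgraph, #|H| < #|L| -> (forall v : H, degree v = 2) -> path5_free H -> union_of_C3_C4 H) ->
  union_of_C3_C4 L.
Proof.
move=> m34 f_inj f_adj deg2 noP5 IH; set S := f @: setT.
have cS : #|S| = m by rewrite card_imset // cardsT card_ord.
have deg_m (i : cycle_graph m) : degree i = 2.
  by case: m34 i => -> i; rewrite ?degree_cycle3 ?degree_cycle4.
have closed x y : adj (f x) y -> y \in S.
  move=> xy; suff /setP/(_ y) : f @: nbhd x = nbhd (f x).
    by rewrite [in RHS]inE xy => /imsetP[z _ ->]; apply: imset_f; rewrite inE.
  apply/eqP; rewrite eqEcard -[#|nbhd (f x)|]/(degree (f x)) deg2 card_imset //.
  rewrite -[#|nbhd x|]/(degree x) deg_m leqnn andbT; apply/subsetP => _ /imsetP[z + ->].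
  by rewrite !inE f_adj.
have [|||a [b iso]] := IH (induced_subgraph (~: S)).
- by rewrite card_induced -(cardsC S) cS -add1n leq_add2r; case: m34 => ->.
- move=> v; rewrite degree_induced (setIidPl _) ?[#|nbhd _|]deg2 //.
  apply/subsetP => y; rewrite !inE => vy; apply/imsetP => -[z _ yz].
  by have := valP v; rewrite inE (closed z) // -yz adj_sym.
- move=> a b c e g; rewrite -(map_inj_uniq val_inj) /=; exact: noP5.
have := graph_iso_split f_inj f_adj closed iso.
case: m34 f {iso cS S f_inj f_adj deg_m closed} => -> f iso.
  by exists a.+1, b; apply: graph_iso_trans iso (C3_add_union a b).
by exists a, b.+1; apply: graph_iso_trans iso (C4_add_union a b).
Qed.

(** Let x, y be the neighbours of v. If they are adjacent, v lies in a triangle. Otherwise their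
    second neighbours w, w' coincide, because w x v y w' would be a path on five vertices, and v
    lies in a quadrilateral. *)
Lemma path5_free_union (L : sgraph) : (forall v : L, degree v = 2) -> path5_free L ->
  union_of_C3_C4 L.
Proof.
have [n] := ubnP #|L|; elim: n L => // n IHn L; rewrite ltnS => Ln deg2 noP5.
have IH (H : sgraph) : #|H| < #|L| -> (forall v : H, degree v = 2) -> path5_free H -> union_of_C3_C4 H.
  by move=> HL; apply: IHn; apply: leq_trans HL Ln.
have [L0|/card_gt0P[v _]] := posnP #|L|.
  exists 0, 0; apply: graph_iso_sym.
  have f : C3_C4_union 0 0 -> L by case=> -[[]].
  by apply: (@graph_iso_inj _ _ f); [case=> -[[]] | rewrite L0 | case=> -[[]]].
have /card_gt0P[x] : 0 < #|nbhd v| by rewrite -[#|_|]/(degree v) deg2.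
rewrite inE => vx; have [y yx vy] := degree2_other (deg2 v) vx.
have [xv yv] : adj x v /\ adj y v by rewrite !(adj_sym _ v).
have [xy|nxy] := boolP (adj x y).
  have yx' : adj y x by rewrite adj_sym.
  pose f (i : cycle_graph 3) : L := tnth [tuple v; x; y] i.
  apply: (@union_of_C3_C4_split L 3 f) => //; first by left.
    by apply/tuple_uniqP; rewrite /= !inE negb_or (adj_neq vx) (adj_neq vy) [x == y]eq_sym yx.
  case=> -[|[|[|//]]] ? [] [|[|[|//]]] ?; rewrite /f !(tnth_nth v) /=
    -[RHS]/(cycle_adj _ _) /cycle_adj -!val_eqE /= ?adj_irrefl //.
have [w wv xw] := degree2_other (deg2 x) xv.
have [w' wv' yw] := degree2_other (deg2 y) yv.
have xy : x != y by rewrite eq_sym.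
have wx : w != x by rewrite eq_sym adj_neq.
have wy : w != y by apply: contraNneq nxy => <-.
have {w' wv' yw} yw : adj y w.
  have [<- //|ww'] := eqVneq w' w; have xw' : x != w' by apply: contraNneq nxy => ->; rewrite adj_sym.
  case: (noP5 w x v y w') => //; last by rewrite adj_sym.
  rewrite /= !inE !negb_or wx wv wy [w == w']eq_sym ww' (adj_neq xv) xy xw' (adj_neq vy).
  by rewrite [v == w']eq_sym wv' (adj_neq yw).
have wx' : adj w x by rewrite adj_sym.
have wy' : adj w y by rewrite adj_sym.
have nvw : adj v w = false.
  by rewrite (degree2_nbhd w (deg2 v) yx vy vx) (negbTE wx) (negbTE wy).
have nwv : adj w v = false by rewrite adj_sym.
have {}nxy := negbTE nxy; have nyx : adj y x = false by rewrite adj_sym.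
pose f (i : cycle_graph 4) : L := tnth [tuple v; x; w; y] i.
apply: (@union_of_C3_C4_split L 4 f) => //; first by right.
  by apply/tuple_uniqP; rewrite /= !inE !negb_or (adj_neq vx) [v == w]eq_sym wv (adj_neq vy) (adj_neq xw) xy wy.
case=> -[|[|[|[|//]]]] ? [] [|[|[|[|//]]]] ?; rewrite /f !(tnth_nth v) /=
    -[RHS]/(cycle_adj _ _) /cycle_adj -!val_eqE /= ?adj_irrefl //.
Qed.

From mathcomp Require Import all_classical all_reals all_analysis.
From mathcomp Require Import lra fintype finset.
Import Order.TTheory GRing.Theory Num.Theory.
Local Open Scope ring_scope.

(** * Degree powers *)

Section PowerFacts.
Variable R : realType.
Implicit Types a x y p : R.

Lemma powR_gt1 a p : 1 < a -> 0 < p -> 1 < a `^ p.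
Proof.
move=> a1 p0; have a0 : 0 < a by rewrite (lt_trans ltr01).
by have := gt0_ltr_powR p0 _ _ a1; rewrite powR1 !nnegrE ler01 ltW // => /(_ isT isT).
Qed.

Lemma powRV x p : 0 <= x -> x^-1 `^ p = (x `^ p)^-1.
Proof. by move=> x0; rewrite -powR_inv1 // -powRrM mulN1r powRN. Qed.

Lemma powR_nat_exp (k : nat) x : (2 ^ k)%:R `^ x = (2 `^ x) ^+ k :> R.
Proof. by rewrite natrX -powR_mulrn // -powRrM mulrC powRrM powR_mulrn // powR_ge0. Qed.

Lemma powRD_pos a x y : 0 < a -> a `^ (x + y) = a `^ x * a `^ y.
Proof. by move=> a0; rewrite powRD // (gt_eqF a0) implybT. Qed.

Lemma powR_le_nneg p x y : 0 <= p -> 0 <= x -> x <= y -> x `^ p <= y `^ p.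
Proof. by move=> p0 x0 xy; apply: ge0_ler_powR; rewrite ?nnegrE // (le_trans x0). Qed.

End PowerFacts.

Section DegreePowerBounds.
Variables (R : realType) (p q : R) (F : sgraph).
Hypotheses (q_gt0 : 0 < q) (qp : q < p).

Definition high_degree_bound (C : R) := forall (G : sgraph) (D : nat), is_free F G -> (0 < D)%N ->
  #|[set v : G | (D <= degree v)%N]|%:R <= C * (#|G|%:R / D%:R) `^ q.

Let p_gt0 : 0 < p. Proof. exact: lt_trans qp. Qed.

Let gap_gt0 : 0 < p - q. Proof. by rewrite subr_gt0. Qed.

(** The dyadic layers form a geometric series with ratio g = 2^(p-q) > 1, dominated by its last
    term. [C1] is the solution of C1 g = C1 + C 2^p, as the induction requires. *)
Lemma dyadic_low_degree_pow C : 0 <= C -> high_degree_bound C ->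
  forall (G : sgraph) k, is_free F G ->
  \sum_(v : G | (degree v < 2 ^ k)%N) (degree v)%:R `^ p <=
  C * 2 `^ p / (2 `^ (p - q) - 1) * #|G|%:R `^ q * (2 `^ (p - q)) ^+ k.
Proof.
move=> C0 bound G k freeG; set g := 2 `^ (p - q); set C1 := C * _ / _.
have g1 : 0 < g - 1 by rewrite subr_gt0 powR_gt1 ?ltr1n.
have C1_ge0 : 0 <= C1 by rewrite divr_ge0 ?mulr_ge0 ?powR_ge0 // ltW.
have C1E : C1 * g = C1 + C * 2 `^ p.
  by rewrite /C1; field; rewrite gt_eqF.
elim: k => [|k IH].
  rewrite big1 => [|v]; first by rewrite expr0 mulr1 mulr_ge0 ?powR_ge0.
  by rewrite ltnS leqn0 => /eqP ->; rewrite powR0 ?gt_eqF.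
rewrite (bigID (fun v : G => (degree v < 2 ^ k)%N)) /=.
apply: le_trans (_ : C1 * #|G|%:R `^ q * g ^+ k + C * 2 `^ p * (#|G|%:R `^ q * g ^+ k) <= _).
  apply: lerD.
    rewrite (eq_bigl (fun v : G => (degree v < 2 ^ k)%N)) // => v.
    by apply/andP/idP => [[]//|lt]; rewrite (leq_trans lt) // leq_exp2l.
  apply: le_trans (_ : \sum_(v : G | (2 ^ k <= degree v)%N) (2 ^ k.+1)%:R `^ p <= _).
    rewrite big_mkcond [X in _ <= X]big_mkcond; apply: ler_sum => v _.
    rewrite -leqNgt; case: (leqP (2 ^ k)%N); rewrite ?andbF // andbT => _.
    case: ltnP => lt; last exact: powR_ge0.
    by apply: powR_le_nneg; rewrite ?ler_nat ?ler0n ?(ltW p_gt0) ?(ltnW lt).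
  rewrite sumr_const -[_ *+ #|_|]mulr_natl.
  have := bound G (2 ^ k)%N freeG; rewrite expn_gt0 => /(_ isT) bk.
  apply: le_trans (_ : C * (#|G|%:R / (2 ^ k)%:R) `^ q * (2 ^ k.+1)%:R `^ p <= _).
    by rewrite ler_wpM2r ?powR_ge0 //; apply: le_trans bk; rewrite ler_nat cardsE.
  set X := (2 ^ k)%:R : R; have X0 : 0 < X by rewrite ltr0n expn_gt0.
  have -> : (2 ^ k.+1)%:R = 2 * X by rewrite expnS natrM.
  have XE : X `^ p = g ^+ k * X `^ q by rewrite -powR_nat_exp -powRD_pos // subrK.
  have X0' := ltW X0.
  rewrite !powRM ?invr_ge0 // powRV // XE le_eqVlt; apply/orP; left; apply/eqP.
  by field; rewrite gt_eqF ?powR_gt0.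
rewrite exprS le_eqVlt; apply/orP; left; apply/eqP.
transitivity (C1 * g * (#|G|%:R `^ q * g ^+ k)); last by ring.
by rewrite C1E; ring.
Qed.

Lemma low_degree_pow C : 0 <= C -> high_degree_bound C ->
  exists2 C' : R, 0 < C' & forall (G : sgraph) (e : R), is_free F G -> 0 < e ->
  \sum_(v : G | (degree v)%:R < e * #|G|%:R) (degree v)%:R `^ p <= C' * e `^ (p - q) * #|G|%:R `^ p.
Proof.
move=> C0 bound; set g := 2 `^ (p - q).
have g1 : 0 < g - 1 by rewrite subr_gt0 powR_gt1 ?ltr1n.
pose C1 := C * 2 `^ p / (g - 1).
have C1_ge0 : 0 <= C1 by rewrite divr_ge0 ?mulr_ge0 ?powR_ge0 // ltW.
have g0 : 0 < g by rewrite powR_gt0.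
(* The factor g comes from rounding e n up to a power of two; the 1 makes the constant positive even
   when C is 0. *)
exists (C1 * g + 1); first by rewrite ltr_wpDl ?ltr01 // mulr_ge0 // ltW.
move=> G e freeG e0; set n := #|G|%:R; set x := e * n.
have n0 : 0 <= n by rewrite ler0n.
have x0 : 0 <= x by rewrite mulr_ge0 // ltW.
have RHS_ge0 : 0 <= (C1 * g + 1) * e `^ (p - q) * n `^ p.
  by rewrite !mulr_ge0 ?powR_ge0 // addr_ge0 // mulr_ge0 // ltW.
have [k0 xk0] : exists k, x <= (2 ^ k)%:R.
  exists (Num.truncn x).+1; apply: le_trans (ltW (truncnS_gt x)) _.
  by rewrite ler_nat ltnW // ltn_expl.
have [[|k] xk mink] := ex_minnP (ex_intro (fun k => x <= (2 ^ k)%:R) k0 xk0).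
  rewrite big1 // => v vx.
  have : ((degree v)%:R < 1 :> R) by apply: lt_le_trans vx xk.
  by rewrite (ltr_nat R _ 1) ltnS leqn0 => /eqP ->; rewrite powR0 ?gt_eqF.
have x_gt : (2 ^ k)%:R < x by rewrite ltNge; apply/negP => /mink; rewrite ltnn.
have x_pos : 0 < x by apply: le_lt_trans x_gt; rewrite ler0n.
have n_pos : 0 < n by move: x_pos; rewrite /x pmulr_rgt0.
apply: le_trans (_ : \sum_(v : G | (degree v < 2 ^ k.+1)%N) (degree v)%:R `^ p <= _).
  rewrite big_mkcond [X in _ <= X]big_mkcond; apply: ler_sum => v _.
  case: ifP => vx; last by case: ifP; rewrite ?powR_ge0.
  by rewrite -(ltr_nat R) (lt_le_trans vx xk).
apply: le_trans (dyadic_low_degree_pow C0 bound k.+1 freeG) _.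
rewrite -/g -/C1 -/n -powR_nat_exp.
apply: le_trans (_ : C1 * n `^ q * (2 * x) `^ (p - q) <= _).
  apply: ler_wpM2l; first by rewrite mulr_ge0 ?powR_ge0.
  apply: powR_le_nneg; rewrite ?ler0n ?(ltW gap_gt0) //.
  by rewrite expnS natrM ler_pM2l ?ltr0n // ltW.
have -> : n `^ p = n `^ q * n `^ (p - q) by rewrite -powRD_pos // addrC subrK.
have e0' := ltW e0; rewrite !powRM ?mulr_ge0 // -/g.
apply: le_trans (_ : C1 * g * e `^ (p - q) * (n `^ q * n `^ (p - q)) <= _).
  by rewrite le_eqVlt; apply/orP; left; apply/eqP; ring.
by rewrite !ler_wpM2r ?mulr_ge0 ?powR_ge0 // lerDl ler01.
Qed.

Lemma deg_pow_le C : 0 <= C -> high_degree_bound C ->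
  exists2 C' : R, 0 < C' & forall G : sgraph, is_free F G -> deg_pow p G <= C' * #|G|%:R `^ p.
Proof.
move=> C0 /(low_degree_pow C0)[C' C'0 h]; exists (C' * 2 `^ (p - q)).
  by rewrite mulr_gt0 ?powR_gt0.
move=> G freeG; apply: le_trans (h G 2 freeG _); last by rewrite ltr0n.
rewrite /deg_pow le_eqVlt; apply/orP; left; apply/eqP.
apply: eq_bigl => v; apply/esym; have Gv : (0 < #|G|)%N by apply/card_gt0P; exists v.
rewrite -natrM ltr_nat; apply: leq_ltn_trans (max_card _) _.
by rewrite mul2n -addnn -[ltnLHS]addn0 ltn_add2l.
Qed.

End DegreePowerBounds.

(** * Stability *)

Lemma deg_pow_induced (R : realType) (p : R) (G : sgraph) (S : {set G}) :
  deg_pow p (induced_subgraph S) = \sum_(v in S) #|nbhd v :&: S|%:R `^ p.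
Proof.
rewrite [RHS]big_sub /deg_pow; apply: eq_bigr => x _.
by rewrite degree_induced.
Qed.

Section Stability.
Variables (R : realType) (p gam C2 C3 : R) (d : nat).
Hypotheses (p2 : 2 <= p) (gam0 : 0 < gam) (C20 : 0 < C2) (C30 : 0 < C3) (d2 : (1 < d)%N).
Notation Qd := (hypercube d).
Notation N := (2 ^ d.-1)%N.
Hypothesis tail : forall (G : sgraph) (e : R), is_free Qd G -> 0 < e ->
  \sum_(v : G | (degree v)%:R < e * #|G|%:R) (degree v)%:R `^ p <= C2 * e `^ gam * #|G|%:R `^ p.
Hypothesis total : forall G : sgraph, is_free Qd G -> deg_pow p G <= C3 * #|G|%:R `^ p.

Let p0 : 0 <= p. Proof. by apply: le_trans p2; rewrite ler0n. Qed.
Let d0 : (0 < d)%N. Proof. exact: ltnW. Qed.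

Definition almost_full (G : sgraph) (delta : R) :=
  [set v : G | (1 - delta) * (#|G|.-1)%:R <= (degree v)%:R].

Lemma exists_small_pow (t : R) : 0 < t -> exists2 e : R, 0 < e <= 1 / 4 & e `^ gam <= t.
Proof.
move=> t0; exists (Num.min (1 / 4) (t `^ gam^-1)).
  by rewrite lt_min powR_gt0 // ge_min lexx andbT divr_gt0 // ltr0n.
apply: le_trans (_ : (t `^ gam^-1) `^ gam <= _).
  apply: powR_le_nneg; rewrite ?ge_min ?lexx ?orbT // ?(ltW gam0) //.
  by rewrite le_min powR_ge0 divr_ge0 // ler0n.
by rewrite -powRrM mulVf ?gt_eqF // powRr1 // ltW.
Qed.

(** Let x be the degree divided by n - 1, over the boundedly many vertices B of linear degree. Then
    the sum of x is at most s + eta, while the sum of x^2, being at least that of x^p, is at least s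
    - eta; so the sum of x(1-x) is at most 2 eta. Vertices of B that are not almost full have 1 - x
    > delta, so with eta = delta/4 their x add up to at most 1/2. This leaves more than s - 1 almost
    full vertices. *)
Lemma many_almost_full (delta : R) : 0 < delta <= 1 ->
  exists n0 : nat, forall G : sgraph, (n0 <= #|G|)%N -> is_free Qd G ->
    N.-1%:R * (#|G|.-1)%:R `^ p <= deg_pow p G -> (N.-1 <= #|almost_full G delta|)%N.
Proof.
case/andP => dl0 dl1; set eta := delta / 4; have eta0 : 0 < eta by rewrite divr_gt0 ?ltr0n.
have [e /andP[e0 e14] eP] : exists2 e : R, 0 < e <= 1 / 4 & e `^ gam <= eta / (C2 * 2 `^ p).
  by apply: exists_small_pow; rewrite divr_gt0 // mulr_gt0 // powR_gt0.
pose M := Num.bound (C3 / e `^ p).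
have MP : C3 / e `^ p < M%:R by apply: archi_boundP; rewrite divr_ge0 ?powR_ge0 // ltW.
have [M' M'P] : exists M' : nat, forall (G : sgraph) (B : {set G}), is_free Qd G -> (#|B| <= M)%N ->
    (\sum_(b in B) degree b <= N.-1 * #|G| + M')%N.
  exists (M * (2 ^ M * N))%N => G B freeG BM; apply: leq_trans (sum_degree_le d0 B freeG) _.
  by rewrite leq_add2l leq_mul // leq_mul2r leq_pexp2l ?orbT.
move: N.-1 M'P => s M'P; clearbody M.
pose n1 := Num.bound ((s + M')%:R / eta).
have n1P : (s + M')%:R / eta < n1%:R by apply: archi_boundP; rewrite divr_ge0 ?ler0n // ltW.
exists (n1 + 2)%N => G nG freeG lower.
set n := #|G| in nG lower *; set nu := n.-1%:R : R.
have n2 : (2 <= n)%N by apply: leq_trans nG; rewrite leq_addl.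
have nuE : n%:R = nu + 1 by rewrite /nu natr1 prednK // ltnW.
have nu1 : 1 <= nu by rewrite /nu (ler_nat R 1) -ltnS prednK // ltnW.
have nu0 : 0 < nu by apply: lt_le_trans nu1.
have n_pos : 0 < n%:R :> R by rewrite nuE addr_gt0.
have nu_n1 : n1%:R <= nu.
  by rewrite /nu ler_nat -ltnS prednK ?(ltnW n2) //; apply: leq_trans nG; rewrite addn2 ltnS.
pose B := [set v : G | e * n%:R <= (degree v)%:R].
have tailB : \sum_(v : G | v \notin B) (degree v)%:R `^ p <= eta * nu `^ p.
  rewrite (eq_bigl (fun v : G => (degree v)%:R < e * n%:R)) => [|v]; last by rewrite inE ltNge.
  apply: le_trans (tail freeG e0) _; rewrite -/n.
  apply: le_trans (_ : C2 * e `^ gam * (2 * nu) `^ p <= _).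
    apply: ler_wpM2l; first by rewrite mulr_ge0 ?powR_ge0 // ltW.
    by apply: powR_le_nneg; rewrite ?ler0n // nuE; lra.
  rewrite powRM ?ler0n ?(ltW nu0) //; rewrite ler_pdivlMr ?mulr_gt0 ?powR_gt0 // in eP.
  rewrite mulrA ler_wpM2r ?powR_ge0 //; apply: le_trans eP.
  by rewrite le_eqVlt; apply/orP; left; apply/eqP; ring.
have cardB : (#|B| <= M)%N.
  rewrite -(ler_nat R); apply: le_trans (ltW MP).
  rewrite ler_pdivlMr ?powR_gt0 // -(ler_pM2r (powR_gt0 p n_pos)).
  apply: le_trans (total freeG); rewrite -mulrA -powRM ?(ltW e0) ?ler0n //.
  rewrite /deg_pow (bigID (mem B)) /=; apply: ler_wpDr.
    by apply: sumr_ge0 => v _; rewrite powR_ge0.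
  rewrite mulr_natl -sumr_const; apply: ler_sum => v; rewrite inE => vB.
  by apply: powR_le_nneg => //; rewrite mulr_ge0 ?ler0n // ltW.
pose x (v : G) : R := (degree v)%:R / nu.
have x_ge0 v : 0 <= x v by rewrite divr_ge0 ?ler0n // ltW.
have x_le1 v : x v <= 1.
  by rewrite ler_pdivrMr // mul1r /nu ler_nat -ltnS prednK ?degree_lt // ltnW.
have sumB1 : \sum_(v in B) x v <= s%:R + eta.
  rewrite -mulr_suml -natr_sum ler_pdivrMr //.
  apply: le_trans (_ : (s * n + M')%:R <= _); first by rewrite ler_nat M'P.
  move: n1P; rewrite ltr_pdivrMr // => n1P.
  have : n1%:R * eta <= nu * eta by rewrite ler_wpM2r // ltW.
  by move: n1P; rewrite !natrD [(_ * n)%:R]natrM nuE mulrDl mulrDr mulr1; lra.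
have sumB2 : s%:R - eta <= \sum_(v in B) x v ^+ 2.
  apply: le_trans (_ : \sum_(v in B) x v `^ p <= _); last first.
    apply: ler_sum => v _; rewrite -powR_mulrn //.
    have [->|xv] := eqVneq (x v) 0.
      by rewrite !powR0 // ?pnatr_eq0 // gt_eqF // (lt_le_trans _ p2).
    by apply: ger_powR => //; rewrite x_le1 lt0r xv x_ge0.
  have -> : \sum_(v in B) x v `^ p = (\sum_(v in B) (degree v)%:R `^ p) / nu `^ p.
    rewrite mulr_suml; apply: eq_bigr => v _.
    by rewrite powRM ?invr_ge0 ?ler0n ?(ltW nu0) // powRV // ltW.
  rewrite ler_pdivlMr ?powR_gt0 // mulrBl lerBlDr.
  apply: le_trans lower _; rewrite /deg_pow (bigID (mem B)) /= lerD2l.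
  by apply: le_trans tailB.
pose W := almost_full G delta.
have sumBW : delta * (\sum_(v in B | v \notin W) x v) <= 2 * eta.
  apply: le_trans (_ : \sum_(v in B) (x v - x v ^+ 2) <= _); last first.
    by rewrite sumrB; lra.
  rewrite [X in _ <= X](bigID (mem W)) /=; apply: ler_wpDl.
    by apply: sumr_ge0 => v _; have := x_ge0 v; have := x_le1 v; nra.
  rewrite big_distrr /=; apply: ler_sum => v /andP[_].
  rewrite inE -ltNge -/n -/nu -ltr_pdivrMr // -/(x v) => xv.
  by have := x_ge0 v; nra.
have : s%:R - eta <= #|W|%:R + 1 / 2.
  apply: le_trans sumB2 _; rewrite (bigID (mem W)) /=; apply: lerD.
    apply: le_trans (_ : \sum_(v in W) (1 : R) <= _); last by rewrite sumr_const.
    rewrite big_mkcond [X in _ <= X]big_mkcond; apply: ler_sum => v _ /=.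
    case: ifP => [/andP[_ ->]|_]; first by rewrite expr_le1.
    by case: ifP; rewrite ?ler01.
  apply: le_trans (_ : \sum_(v in B | v \notin W) x v <= _).
    by apply: ler_sum => v _; have := x_ge0 v; have := x_le1 v; nra.
  by rewrite -(ler_pM2l dl0); apply: le_trans sumBW _; rewrite /eta; lra.
move=> le_sW; rewrite leqNgt; apply/negP; rewrite -(ler_nat R) -natr1 => lt_W.
have : eta <= 1 / 4 by rewrite /eta; lra.
by move: le_sW lt_W; rewrite /W; lra.
Qed.

Lemma common_nbhd_almost_full (G : sgraph) (delta : R) (P : {set G}) : 0 <= delta ->
  P \subset almost_full G delta ->
  #|G|%:R <= #|common_nbhd P|%:R + #|P|%:R * (1 + delta * #|G|%:R) :> R.
Proof.
move=> dl0 sP; set n := #|G|%:R.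
have := card_common_nbhd P; rewrite -(ler_nat R) natrD natr_sum -/n => h.
apply: le_trans h _; rewrite lerD2l mulr_natl -sumr_const; apply: ler_sum => v vP.
rewrite natrB -/n; last exact: ltnW (degree_lt v).
have := subsetP sP v vP; rewrite inE.
have Gv : (0 < #|G|)%N by apply: leq_trans (degree_lt v).
have -> : (#|G|.-1)%:R = n - 1 by rewrite /n -[in RHS](prednK Gv) -natr1 addrK.
by rewrite mulrBl mul1r mulrBr mulr1; lra.
Qed.

(** N almost full vertices would have at least n/2 - N >= N common neighbours, giving K_{N,N}. *)
Lemma few_almost_full (G : sgraph) (delta : R) : 0 <= delta -> N%:R * delta <= 1 / 2 ->
    (4 * N <= #|G|)%N -> is_free Qd G ->
  (#|almost_full G delta| <= N.-1)%N.
Proof.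
move=> dl0 dlN nG freeG; have N0 : (0 < N)%N by rewrite expn_gt0.
rewrite leqNgt prednK //; apply/negP => /exists_subset_card[P sP cP].
apply: freeG; apply: (contains_of_common_nbhd d0 cP); rewrite -(ler_nat R).
have := common_nbhd_almost_full dl0 sP; rewrite cP.
have : (4 * N)%:R <= #|G|%:R :> R by rewrite ler_nat.
rewrite natrM; have := ler0n R #|G|; move: #|G|%:R #|common_nbhd P|%:R => g c g0 Ng.
by rewrite mulrDr mulr1 mulrA; nra.
Qed.

(* The vertices Z missed by the almost full set W cost at least #|Z| (n - 1)^(p - 1) at W
   and gain only O(#|Z|^p) elsewhere. *)
Lemma stability : exists n0 : nat, forall G : sgraph, (n0 <= #|G|)%N -> is_free Qd G ->
    N.-1%:R * (#|G|.-1)%:R `^ p + (#|G| - N.-1)%:R * (N.-1 + d.-1)%:R `^ p <= deg_pow p G ->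
  exists W : {set G}, [/\ #|W| = N.-1, forall w, w \in W -> degree w = #|G|.-1
    & forall v, v \notin W -> degree v = (N.-1 + d.-1)%N].
Proof.
set s := N.-1; set K := (s + d.-1)%N.
(* A vertex outside W with z >= 1 neighbours in Z has degree at most K + z <= (K+1) z. The sum of
   z^p is at most (d-1)|Z|^p over U and C3 |Z|^p over Z. *)
pose K1 : R := (K.+1)%:R `^ p * (d.-1%:R + C3).
have K10 : 0 <= K1 by rewrite mulr_ge0 ?powR_ge0 // addr_ge0 ?ler0n // ltW.
have N0 : (0 < N)%N by rewrite expn_gt0.
have N1 : 1 <= N%:R :> R by rewrite (ler_nat R 1).
(* Chosen to give both N delta <= 1/2, for [few_almost_full], and K1 N delta < 1, which rules out a
   nonempty Z. *)
pose delta : R := (2 * N%:R * (K1 + 1))^-1.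
have D0 : 0 < 2 * N%:R * (K1 + 1) by rewrite !mulr_gt0 ?ltr0n // ltr_wpDl.
have dl0 : 0 < delta by rewrite invr_gt0.
have dl1 : N%:R * delta <= 1 / 2.
  by rewrite ler_pdivrMr //; nra.
have dlK : K1 * (N%:R * delta) < 1.
  by rewrite mulrA ltr_pdivrMr //; nra.
have dle1 : delta <= 1 by nra.
have [n0 n0P] := @many_almost_full delta (introT andP (conj dl0 dle1)).
exists (n0 + 4 * N + 4)%N => G nG freeG lower.
have nG0 : (n0 <= #|G|)%N by apply: leq_trans nG; rewrite -addnA leq_addr.
have nG4 : (4 * N + 4 <= #|G|)%N by apply: leq_trans nG; rewrite -addnA leq_addl.
set n := #|G| in nG nG4 lower *; set nu := n.-1%:R : R.
pose W := almost_full G delta.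
have cW : #|W| = s.
  apply/eqP; rewrite eqn_leq few_almost_full ?(ltW dl0) //; last by apply: leq_trans nG4; rewrite leq_addr.
  apply: n0P => //; apply: le_trans lower; rewrite lerDl mulr_ge0 ?ler0n ?powR_ge0 //.
pose U := common_nbhd W; pose Z := ~: (W :|: U).
have cU : (N < #|U|)%N.
  have := common_nbhd_almost_full (ltW dl0) (subxx W); rewrite cW -/n -/U => cU.
  rewrite -(ltr_nat R).
  have : (4 * N + 4)%:R <= n%:R :> R by rewrite ler_nat.
  have : s%:R <= N%:R :> R by rewrite ler_nat leq_pred.
  have := ler0n R n; have := ler0n R s; rewrite natrD natrM.
  move: cU; move: (n%:R : R) (#|U|%:R : R) (s%:R : R) => x u t cU t0 x0 tN Nx.
  have : t * (delta * x) <= N%:R * (delta * x) by rewrite ler_wpM2r // mulr_ge0 // ltW.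
  have : N%:R * delta * x <= 1 / 2 * x by rewrite ler_wpM2r.
  by move: cU; rewrite mulrDr mulr1 -mulrA; lra.
have degU v : v \notin W -> (#|nbhd v :&: U| <= d.-1)%N.
  move=> vW; rewrite -ltnS prednK // ltnNge; apply/negP => cv.
  by apply: freeG; apply: (contains_of_star d0 cW vW cU cv).
pose z (v : G) := #|nbhd v :&: Z|.
have UW v : v \in U -> v \notin W by apply: common_nbhd_notin.
have deg_le v : v \notin W -> (degree v <= K + z v)%N.
  move=> vW; have sub : nbhd v \subset W :|: (nbhd v :&: U) :|: (nbhd v :&: Z).
    by apply/subsetP => y; rewrite !inE => ->; case: (y \in W) => //=; rewrite orbN.
  apply: leq_trans (subset_leq_card sub) _.
  apply: leq_trans (leq_card_setU _ _).1 _; rewrite leq_add2r.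
  apply: leq_trans (leq_card_setU _ _).1 _; rewrite cW leq_add2l.
  exact: degU.
have zU v : v \in Z -> v \notin W by rewrite !inE => /norP[].
have n2 : (1 < n)%N by apply: leq_trans nG4; apply: ltn_addl.
have nu1 : 1 <= nu by rewrite /nu (ler_nat R 1) -ltnS prednK // ltnW.
have nu0 : 0 < nu by apply: lt_le_trans nu1.
have p1 : 1 <= p by apply: le_trans p2; rewrite ler1n.
have pm1 : 0 <= p - 1 by rewrite subr_ge0.
have p_gt0 : 0 < p by apply: lt_le_trans p2; rewrite ltr0n.
have deg_nu (v : G) : (degree v)%:R <= nu :> R.
  by rewrite /nu ler_nat -ltnS prednK ?degree_lt // ltnW.
have Z_le : #|Z|%:R <= \sum_(w in W) (nu - (degree w)%:R) :> R.
  have := card_uncommon W; rewrite -/U -/Z -(ler_nat R) natr_sum => h; apply: le_trans h _.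
  by apply: ler_sum => w _; rewrite natrB // -(ler_nat R) deg_nu.
have sumW : \sum_(w in W) (degree w)%:R `^ p <= s%:R * nu `^ p - #|Z|%:R * nu `^ (p - 1).
  apply: le_trans (_ : \sum_(w in W) (nu `^ p - (nu - (degree w)%:R) * nu `^ (p - 1)) <= _).
    apply: ler_sum => w _; rewrite -(mulr_powRB1 (ler0n _ (degree w)) p_gt0).
    rewrite -(mulr_powRB1 (ltW nu0) p_gt0) -mulrBl opprB addrCA subrr addr0.
    by apply: ler_wpM2l => //; apply: powR_le_nneg.
  rewrite sumrB sumr_const cW -[_ *+ s]mulr_natl lerD2l lerN2 -mulr_suml.
  by rewrite ler_wpM2r ?powR_ge0.
have sum_zU : \sum_(v in U) (z v)%:R `^ p <= d.-1%:R * #|Z|%:R `^ p.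
  have [Z0|Zpos] := posnP #|Z|.
    rewrite big1 ?mulr_ge0 ?powR_ge0 ?ler0n // => v _.
    by rewrite /z (cards0_eq Z0) setI0 cards0 powR0 // gt_eqF.
  apply: le_trans (_ : \sum_(v in U) (z v)%:R * #|Z|%:R `^ (p - 1) <= _).
    apply: ler_sum => v _; rewrite -(mulr_powRB1 (ler0n _ (z v)) p_gt0).
    apply: ler_wpM2l => //; apply: powR_le_nneg => //.
    by rewrite ler_nat subset_leq_card ?subsetIr.
  rewrite -mulr_suml -(mulr_powRB1 (ler0n _ #|Z|) p_gt0) mulrA ler_wpM2r ?powR_ge0 //.
  rewrite -natr_sum -natrM ler_nat mulnC.
  have -> : (\sum_(v in U) z v = \sum_(v in Z) #|nbhd v :&: U|)%N.
    rewrite /z; under eq_bigr do rewrite -sum1_card; under [RHS]eq_bigr do rewrite -sum1_card.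
    rewrite (exchange_big_dep (mem Z)) /=; last by move=> v y _; rewrite inE => /andP[].
    apply: eq_bigr => y yZ; apply: eq_bigl => v; rewrite !inE adj_sym.
    by move: yZ; rewrite !inE => ->; rewrite andbT andbC.
  by rewrite -sum_nat_const; apply: leq_sum => y /zU; apply: degU.
(* The graph induced on Z is again Q_d-free, so the global bound [total] applies to it, whatever its
   size. *)
have sum_zZ : \sum_(v in Z) (z v)%:R `^ p <= C3 * #|Z|%:R `^ p.
  rewrite -deg_pow_induced -(card_induced Z); apply: total; exact: induced_free.
have cOut : #|[pred v | v \notin W]| = (n - s)%N.
  by rewrite -cW /n -(cardsC W) addKn; apply: eq_card => v; rewrite !inE.
have sum_out : \sum_(v | v \notin W) (degree v)%:R `^ p <=
    (n - s)%:R * K%:R `^ p + K1 * #|Z|%:R `^ p.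
  apply: le_trans (_ : \sum_(v | v \notin W) (K%:R `^ p + K.+1%:R `^ p * (z v)%:R `^ p) <= _).
    apply: ler_sum => v vW; have := deg_le v vW.
    have [->|z_gt0] := posnP (z v); rewrite ?addn0 => dv.
      by rewrite powR0 ?gt_eqF // mulr0 addr0 powR_le_nneg // ler_nat.
    rewrite -powRM ?ler0n //; apply: ler_wpDl; first exact: powR_ge0.
    apply: powR_le_nneg => //; rewrite -natrM ler_nat; apply: leq_trans dv _.
    by rewrite mulSn addnC leq_add2l leq_pmulr.
  rewrite big_split /= sumr_const -[_ *+ #|_|]mulr_natl.
  rewrite cOut lerD2l -mulr_sumr /K1 -mulrA; apply: ler_wpM2l; first exact: powR_ge0.
  rewrite (bigID (mem U)) /= mulrDl; apply: lerD.
    apply: le_trans sum_zU; rewrite le_eqVlt; apply/orP; left; apply/eqP.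
    by apply: eq_bigl => v; case vU: (v \in U); rewrite ?andbF // (UW v).
  apply: le_trans sum_zZ; rewrite le_eqVlt; apply/orP; left; apply/eqP.
  by apply: eq_bigl => v; rewrite /Z in_setC in_setU negb_or.
have split_sum : deg_pow p G = \sum_(w in W) (degree w)%:R `^ p + \sum_(v | v \notin W) (degree v)%:R `^ p.
  by rewrite /deg_pow (bigID (mem W)).
(* Otherwise nu^(p-1) <= K1 |Z|^(p-1). But |Z| <= N delta nu, and p - 1 >= 1 with N delta <= 1 gives
   |Z|^(p-1) <= N delta nu^(p-1), a contradiction. *)
have Z0 : #|Z| = 0%N.
  apply/eqP; rewrite -leqn0 leqNgt; apply/negP => Zpos.
  have Zpos' : 0 < #|Z|%:R :> R by rewrite ltr0n.
  have le1 : #|Z|%:R * nu `^ (p - 1) <= K1 * #|Z|%:R `^ p.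
    by move: lower; rewrite split_sum -/nu; lra.
  have leZ : #|Z|%:R <= N%:R * delta * nu.
    apply: le_trans Z_le _; apply: le_trans (_ : \sum_(w in W) delta * nu <= _).
      apply: ler_sum => w; rewrite inE -/n -/nu => hw; lra.
    rewrite sumr_const cW -[_ *+ s]mulr_natl -mulrA ler_wpM2r ?mulr_ge0 ?(ltW dl0) ?(ltW nu0) //.
    by rewrite ler_nat leq_pred.
  have Nd0 : 0 < N%:R * delta by rewrite mulr_gt0 // ltr0n.
  have leZp : #|Z|%:R `^ (p - 1) <= N%:R * delta * nu `^ (p - 1).
    apply: le_trans (powR_le_nneg pm1 (ltW Zpos') leZ) _.
    rewrite powRM ?(ltW Nd0) ?(ltW nu0) // ler_wpM2r ?powR_ge0 //.
    apply: ge1r_powR; last by rewrite lerBrDr; apply: p2.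
    by rewrite Nd0 (le_trans dl1) // ler_pdivrMr ?ltr0n // mul1r ler1n.
  have nup : 0 < nu `^ (p - 1) by rewrite powR_gt0.
  move: le1; rewrite -(mulr_powRB1 (ltW Zpos') p_gt0) mulrCA ler_pM2l //.
  have : K1 * #|Z|%:R `^ (p - 1) <= K1 * (N%:R * delta) * nu `^ (p - 1).
    by rewrite -mulrA ler_wpM2l.
  have : K1 * (N%:R * delta) * nu `^ (p - 1) < nu `^ (p - 1).
    by rewrite -[ltRHS]mul1r ltr_pM2r.
  by lra.
have degK v : v \notin W -> (degree v <= K)%N.
  by move=> /deg_le; rewrite /z (cards0_eq Z0) setI0 cards0 addn0.
(* Each term of e_p is at most its value under [g], and by [lower] the sum is at least that of [g],
   so equality holds termwise. *)
pose g (v : G) : R := if v \in W then nu `^ p else K%:R `^ p.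
have fg v : (degree v)%:R `^ p <= g v.
  rewrite /g; case: ifPn => vW; apply: powR_le_nneg => //.
  by rewrite ler_nat degK.
have sum_g : \sum_v g v = s%:R * nu `^ p + (n - s)%:R * K%:R `^ p.
  rewrite (bigID (mem W)) /=; congr (_ + _).
    rewrite (eq_bigr (fun=> nu `^ p)) ?sumr_const ?cW ?mulr_natl // => v vW.
    by rewrite /g vW.
  rewrite (eq_bigr (fun=> K%:R `^ p)) => [|v vW]; last by rewrite /g (negbTE vW).
  by rewrite sumr_const cOut mulr_natl.
have eq_fg v : (degree v)%:R `^ p = g v.
  have : \sum_v (g v - (degree v)%:R `^ p) == 0.
    rewrite eq_le sumr_ge0 ?andbT => [|u _]; last by rewrite subr_ge0.
    by rewrite sumrB subr_le0 sum_g.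
  rewrite psumr_eq0 => [/allP/(_ v)|u _]; last by rewrite subr_ge0.
  by rewrite mem_index_enum subr_eq0 => /(_ isT)/eqP ->.
have powI (a b : nat) : a%:R `^ p = b%:R `^ p -> a = b.
  by move/(powR_injective p_gt0); rewrite !nnegrE !ler0n => /(_ isT isT)/eqP; rewrite eqr_nat => /eqP.
exists W; split=> // [w wW|v vW]; apply: powI; rewrite eq_fg /g ?wW //.
by rewrite (negbTE vW).
Qed.

End Stability.

(** * The exponents of the theorem *)

Section HighDegreeBounds.
Variable R : realType.

Lemma cube3_high_degree_bound : high_degree_bound (5 / 2 : R) (hypercube 3) (2 ^+ 10).
Proof.
move=> G D freeG D_gt0; set n : R := #|G|%:R; set h : R := #|_|%:R.
have D0 : 0 < D%:R :> R by rewrite ltr0n.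
have n0 : 0 <= n by rewrite ler0n.
have nD0 : 0 <= n / D%:R by rewrite divr_ge0 // ltW.
have rhs0 : 0 <= 2 ^+ 10 * (n / D%:R) `^ (5 / 2) by rewrite mulr_ge0 ?powR_ge0 ?exprn_ge0 ?ler0n.
rewrite -(ler_pXn2r (n := 2)) ?nnegrE ?ler0n // exprMn -exprM.
have -> : ((n / D%:R) `^ (5 / 2)) ^+ 2 = (n / D%:R) ^+ 5.
  by rewrite -powR_mulrn ?powR_ge0 // -powRrM divfK ?pnatr_eq0 // powR_mulrn.
rewrite expr_div_n mulrA ler_pdivlMr ?exprn_gt0 // /h /n.
by have := cube3_high_degree D freeG; rewrite -(ler_nat R) [in leLHS]natrM [in leRHS]natrM !natrX.
Qed.

(** Bernoulli's inequality for a = 2^e: with l the logarithm of h, h^e >= a^l >= 1 + l(a - 1). *)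
Lemma trunc_log_le_pow (e : R) : 0 < e -> exists2 C : R, 0 < C &
  forall h : nat, (0 < h)%N -> (trunc_log 2 h).+1%:R <= C * h%:R `^ e.
Proof.
move=> e0; set a : R := 2 `^ e; have a1 : 0 < a - 1 by rewrite subr_gt0 powR_gt1 ?ltr1n.
exists ((a - 1)^-1 + 1) => [|h h0]; first by rewrite addr_gt0 ?invr_gt0.
have bern l : 1 + l%:R * (a - 1) <= a ^+ l.
  elim: l => [|l IH]; first by rewrite mul0r addr0 expr0.
  rewrite exprS; apply: le_trans (_ : a * (1 + l%:R * (a - 1)) <= _); last first.
    by rewrite ler_wpM2l // powR_ge0.
  have : 0 <= l%:R * (a - 1) * (a - 1) by rewrite !mulr_ge0 ?ler0n // ltW.
  by rewrite -natr1; lra.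
set l := trunc_log 2 h.
have ah : a ^+ l <= h%:R `^ e.
  rewrite -powR_nat_exp; apply: powR_le_nneg; rewrite ?ler0n ?(ltW e0) // ler_nat.
  exact: trunc_logP.
apply: le_trans (_ : ((a - 1)^-1 + 1) * (1 + l%:R * (a - 1)) <= _).
  have -> : ((a - 1)^-1 + 1) * (1 + l%:R * (a - 1)) = (a - 1)^-1 + l%:R + 1 + l%:R * (a - 1).
    by field; rewrite gt_eqF.
  rewrite -natr1.
  have : 0 < (a - 1)^-1 by rewrite invr_gt0.
  have : 0 <= l%:R * (a - 1) by rewrite mulr_ge0 ?ler0n // ltW.
  by lra.
apply: ler_wpM2l; first by rewrite addr_ge0 ?invr_ge0 // ltW.
exact: le_trans (bern l) ah.
Qed.

Lemma alphaE (d : nat) : (1 < d)%N ->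
  (1 - alpha R d)^-1 = (2 ^ d.-1 * d.-1)%:R / (2 ^ d.-1).-1%:R.
Proof.
move=> d2; have N2 : (1 < 2 ^ d.-1)%N by rewrite -[1%N]/(2 ^ 0)%N ltn_exp2l //; lia.
have d10 : d.-1%:R != 0 :> R by rewrite pnatr_eq0 -lt0n -ltnS prednK // ltnW.
have N10 : (2 ^ d.-1).-1%:R != 0 :> R.
  by rewrite pnatr_eq0 -lt0n -ltnS prednK // ltnW.
have dE : d%:R - 1 = d.-1%:R :> R by rewrite -[in LHS](prednK (ltnW d2)) -natr1 addrK.
have NE : (2 : R) ^+ d.-1 = (2 ^ d.-1).-1%:R + 1 by rewrite natr1 prednK ?natrX // ltnW.
have N0 : (2 ^ d.-1).-1%:R + 1 != 0 :> R by rewrite natr1 pnatr_eq0.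
rewrite /alpha dE NE natrM natrX NE.
move: (2 ^ d.-1).-1%:R d.-1%:R N0 N10 d10 => x y N0 N10 d10.
by field; rewrite d10 N10 N0.
Qed.

Lemma hypercube_high_degree_bound (d : nat) (p : R) : (1 < d)%N -> (1 - alpha R d)^-1 < p ->
  exists q C : R, [/\ 0 < q < p, 0 <= C & high_degree_bound q (hypercube d) C].
Proof.
move=> d2; rewrite alphaE //.
have N2 : (1 < 2 ^ d.-1)%N by rewrite -[1%N]/(2 ^ 0)%N ltn_exp2l //; lia.
have high := fun G D h => @hypercube_high_degree d G D h d2.
set C0 := ((4 ^ d) ^ (4 ^ (d - 2)) * 2 ^ (2 ^ d.-1))%N in high; clearbody C0.
move: (2 ^ d.-1)%N N2 high => N N2 high.
set k := (N * d.-1)%N => kp.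
have k_gt0 : (0 < k)%N by rewrite muln_gt0; lia.
set s : R := N.-1%:R; have s0 : 0 < s by rewrite ltr0n; lia.
have k0 : 0 < k%:R :> R by rewrite ltr0n.
(* Here k/s is the critical exponent; any q strictly between it and p leaves the surplus power h^(s
   - k/q) to absorb the logarithm. *)
pose q : R := (k%:R / s + p) / 2.
have q_lo : k%:R / s < q by rewrite /q; lra.
have q0 : 0 < q by apply: lt_trans q_lo; rewrite divr_gt0.
have qp : q < p by rewrite /q; lra.
have kq0 : 0 < k%:R / q by rewrite divr_gt0.
have theta0 : 0 < s - k%:R / q by move: q_lo; rewrite subr_gt0 !ltr_pdivrMr // mulrC.
have Nd0 : 0 < (N * d)%:R :> R by rewrite ltr0n muln_gt0; lia.
(* The logarithm occurs with exponent Nd, so each factor may cost h^e with Nd e = s - k/q. *)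
set e := (s - k%:R / q) / (N * d)%:R; have e0 : 0 < e by rewrite divr_gt0.
have [C1 C10 logP] := trunc_log_le_pow e0.
pose C2 : R := (2 ^ (N.-1 + k) * C0)%:R * C1 ^+ (N * d).
have C20 : 0 <= C2 by rewrite mulr_ge0 ?ler0n // exprn_ge0 // ltW.
exists q, (C2 `^ (k%:R / q)^-1); split; rewrite ?q0 ?powR_ge0 // => G D freeG D_gt0.
set H := [set v : G | (D <= degree v)%N]; have := high G D _ freeG (erefl #|H|).
rewrite -/k; move: #|H| => h bound.
have D0 : 0 < D%:R :> R by rewrite ltr0n.
set n : R := #|G|%:R; have nD0 : 0 <= n / D%:R by rewrite divr_ge0 ?ler0n // ltW.
have [->|h_gt0] := posnP h; first by rewrite mulr_ge0 ?powR_ge0.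
have h0 : 0 < h%:R :> R by rewrite ltr0n.
have le1 : h%:R `^ s <= C2 * h%:R `^ (s - k%:R / q) * (n / D%:R) ^+ k.
  rewrite expr_div_n mulrA ler_pdivlMr ?exprn_gt0 // powR_mulrn ?(ltW h0) //.
  rewrite -!natrX -natrM; move: bound; rewrite -(ler_nat R) => bound; apply: le_trans bound _.
  rewrite natrM [(#|G| ^ k)%:R]natrX -/n; apply: ler_wpM2r; first by rewrite exprn_ge0 ?ler0n.
  rewrite natrM natrX /C2 -mulrA; apply: ler_wpM2l; first exact: ler0n.
  have -> : h%:R `^ (s - k%:R / q) = (h%:R `^ e) ^+ (N * d).
    by rewrite -powR_mulrn ?powR_ge0 // -powRrM /e divfK // gt_eqF.
  by rewrite -exprMn; apply: lerXn2r; rewrite ?nnegrE ?ler0n ?mulr_ge0 ?powR_ge0 ?(ltW C10) // logP.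
have le2 : h%:R `^ (k%:R / q) <= C2 * (n / D%:R) ^+ k.
  have c0 : 0 < h%:R `^ (s - k%:R / q) :> R by rewrite powR_gt0.
  rewrite -(ler_pM2l c0) -powRD_pos // subrK; apply: le_trans le1 _.
  by rewrite mulrCA mulrA.
have -> : h%:R = (h%:R `^ (k%:R / q)) `^ (k%:R / q)^-1 :> R.
  by rewrite -powRrM mulfV ?gt_eqF // powRr1 // ltW.
have -> : (n / D%:R) `^ q = ((n / D%:R) ^+ k) `^ (k%:R / q)^-1.
  rewrite -powR_mulrn // -powRrM invf_div mulrCA mulfV ?mulr1 // gt_eqF //.
rewrite -powRM ?exprn_ge0 //; apply: powR_le_nneg; rewrite ?powR_ge0 //.
by rewrite invr_ge0 ltW.
Qed.

End HighDegreeBounds.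

(** * The extremal graphs *)

(** The points 101, 100, 000, 010, 011 of Q_3 form a path and receive a, b, c, d, e; the remaining
    points 110, 001, 111 go to the three clique vertices. *)
Lemma path5_free_of_join (L : sgraph) : is_free (hypercube 3) (join (complete 3) L) -> path5_free L.
Proof.
move=> freeL a b c d e; rewrite /= !inE !negb_or.
case/and5P=> /and4P[ab' ac' ad' ae'] /and3P[bc' bd' be'] /andP[cd' ce'] de' _ ab bc cd de; apply: freeL.
pose K (i : 'I_3) : join (complete 3) L := inl i; pose J (x : L) : join (complete 3) L := inr x.
have JJ x y : (J x == J y) = (x == y) by apply: inj_eq => ? ? [].
have KK i j : (K i == K j) = (val i == val j) by rewrite val_eqE; apply: inj_eq => ? ? [].
have JK x i : (J x == K i) = false by apply/eqP.
have KJ x i : (K i == J x) = false by apply/eqP.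
apply: (contains_cube3_seq (v000 := J c) (v100 := J b) (v010 := J d) (v110 := K ord0)
  (v001 := K (inord 1)) (v101 := J a) (v011 := J e) (v111 := K (inord 2))).
- rewrite /uniq !inE !JJ !KK !JK !KJ [c == b]eq_sym [c == a]eq_sym [b == a]eq_sym [d == a]eq_sym /= !inordK //.
  by rewrite !negb_or ab' ac' ad' ae' bc' bd' be' cd' ce' de'.
- by rewrite /= adj_sym bc cd.
- by rewrite /= /complete_adj -!val_eqE /= !inordK.
- by rewrite /= ab.
- by rewrite /= adj_sym de.
Qed.

Lemma universal_adj (G : sgraph) (w y : G) : degree w = #|G|.-1 -> adj w y = (w != y).
Proof.
move=> dw; suff /setP/(_ y) : nbhd w = [set~ w] by rewrite !inE eq_sym.
apply/eqP; rewrite eqEcard cardsC1 -dw leqnn andbT; apply/subsetP => x; rewrite !inE.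
by move/adj_neq; rewrite eq_sym.
Qed.

Lemma join_induced_iso (G : sgraph) (W : {set G}) : (forall w, w \in W -> degree w = #|G|.-1) ->
  graph_iso G (join (complete #|W|) (induced_subgraph (~: W))).
Proof.
move=> degW; apply: graph_iso_sym.
pose h (u : join (complete #|W|) (induced_subgraph (~: W))) : G :=
  match u with inl i => enum_val i | inr y => val y end.
have neq i (y : induced_subgraph (~: W)) : enum_val (A := W) i != val y.
  by apply: contraTneq (valP y) => <-; rewrite inE negbK enum_valP.
apply: (@graph_iso_inj _ _ h).
- case=> x [] y /= => [/enum_val_inj->//|/eqP|/esym/eqP|/val_inj->//]; by rewrite (negbTE (neq _ _)).
- by rewrite card_join card_induced cardsC.
- have enum_adj (i : 'I_#|W|) (y : G) : adj (enum_val i) y = (enum_val i != y).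
    by apply: universal_adj; apply/degW/enum_valP.
  case=> x [] y //=.
  + by rewrite enum_adj (inj_eq enum_val_inj).
  + by rewrite enum_adj neq.
  + by rewrite adj_sym enum_adj neq.
Qed.

Section DegPow.
Variables (R : realType) (p : R).

Lemma deg_pow_iso (G H : sgraph) : graph_iso G H -> deg_pow p G = deg_pow p H.
Proof.
case=> f bf f_adj; rewrite /deg_pow (reindex f) /=; last exact: onW_bij.
by apply: eq_bigr => x _; rewrite (graph_iso_degree _ bf f_adj).
Qed.

Lemma deg_pow_join_regular s k (L : sgraph) : (forall v : L, degree v = k) ->
  deg_pow p (join (complete s) L) = s%:R * (s + #|L|).-1%:R `^ p + #|L|%:R * (s + k)%:R `^ p.
Proof.
move=> degL; rewrite /deg_pow big_sumType /=; congr (_ + _).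
  rewrite (eq_bigr (fun=> (s + #|L|).-1%:R `^ p)) => [|i _]; last by rewrite degree_join_l.
  by rewrite sumr_const card_ord mulr_natl.
rewrite (eq_bigr (fun=> (s + k)%:R `^ p)) => [|i _]; last by rewrite degree_join_r degL.
by rewrite sumr_const mulr_natl.
Qed.

(** The threshold is the value of e_p at a join of K_s with a (d-1)-regular graph, stated without
    assuming that such a graph exists. Applied to extremal graphs, it determines their shape as soon
    as one Q_d-free join of this kind is known. *)
Lemma join_regular_of_deg_pow (d : nat) (q C : R) : (1 < d)%N -> 2 <= p ->
    0 < q < p -> 0 <= C -> high_degree_bound q (hypercube d) C ->
  let s := (2 ^ d.-1).-1 in
  exists n0 : nat, forall G : sgraph, (n0 <= #|G|)%N -> is_free (hypercube d) G ->
    s%:R * (#|G|.-1)%:R `^ p + (#|G| - s)%:R * (s + d.-1)%:R `^ p <= deg_pow p G ->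
  exists L : sgraph, [/\ (s + #|L| = #|G|)%N, forall v : L, degree v = d.-1
    & graph_iso G (join (complete s) L)].
Proof.
move=> d2 p2 /andP[q0 qp] C0 bound s.
have [C2 C20 tail] := low_degree_pow q0 qp C0 bound.
have [C3 C30 total] := deg_pow_le q0 qp C0 bound.
have qp0 : 0 < p - q by rewrite subr_gt0.
have [n0 n0P] := stability p2 qp0 C20 C30 d2 tail total.
exists n0 => G nG freeG lower; have [W [cW degW degNW]] := n0P G nG freeG lower.
exists (induced_subgraph (~: W)); rewrite card_induced; split.
- by rewrite /s -cW cardsC.
- move=> v; have vW := valP v; rewrite inE in vW.
  have sub : W \subset nbhd (val v).
    apply/subsetP => w wW; rewrite inE adj_sym universal_adj ?degW //.
    by apply: contraNneq vW => <-.
  have := degNW _ vW; rewrite degree_induced /degree -[[set y | _]]/(nbhd (val v)).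
  by rewrite -(cardsID W) (setIidPr sub) cW setDE => /addnI.
- by have := join_induced_iso degW; rewrite cW.
Qed.

End DegPow.

Lemma C3_C4_sum m : (6 <= m)%N -> exists a b, (m = a * 3 + b * 4)%N.
Proof. by move=> m6; exists (m %/ 3 - m %% 3)%N, (m %% 3)%N; lia. Qed.

(** Says that 1/(1 - alpha_d) >= 2, so that the stability argument, which needs p >= 2, covers every
    admissible p. *)
Lemma double_pred_exp_le d : (1 < d)%N -> (2 * (2 ^ d.-1).-1 <= 2 ^ d.-1 * d.-1)%N.
Proof. by case: d => [|[|[|d]]] // _; rewrite -[_.+3.-1]/d.+2; move: (2 ^ d.+2)%N => N; nia. Qed.

(** Among d - 1 and d one is even; hence near (d-1)-regular means (d-1)-regular on kd vertices. *)
Lemma odd_pred_mul d k : odd (d.-1 * (k * d)) = false.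
Proof. by rewrite !oddM; case: d => // d /=; case: (odd d) (odd k) => -[]. Qed.

Theorem theorem1p8 (R : realType) :
  (forall p : R, 5 / 2 < p ->
    exists n0 : nat, forall n : nat, (n0 <= n)%N ->
    forall G : sgraph, #|G| = n -> is_free (hypercube 3) G ->
      (extremal p n (hypercube 3) G <->
       exists L : sgraph, [/\ (3 + #|L| = n)%N, union_of_C3_C4 L &
                              graph_iso G (join (complete 3) L)]))
  /\
  (forall (d : nat) (p : R), (2 <= d)%N -> (1 - alpha R d)^-1 < p ->
    exists n0 : nat, forall n : nat, (n0 <= n)%N ->
      n = (2 ^ d.-1 - 1)%N %[mod d] ->
    forall G : sgraph, #|G| = n -> is_free (hypercube d) G ->
      deg_pow p G = ex_pow p n (hypercube d) ->
      join_near_regular n (2 ^ d.-1 - 1) d.-1 G).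
Proof.
split=> [p p52|d p d2 dp].
  have p2 : 2 <= p by lra.
  have qp : 0 < (5 / 2 : R) < p by lra.
  have C0 : 0 <= 2 ^+ 10 :> R by rewrite exprn_ge0.
  have [n0 n0P] := join_regular_of_deg_pow (isT : (1 < 3)%N) p2 qp C0 (@cube3_high_degree_bound R).
  have valE (G L : sgraph) : (3 + #|L| = #|G|)%N -> (forall v : L, degree v = 2) ->
      graph_iso G (join (complete 3) L) ->
    deg_pow p G = 3%:R * (#|G|.-1)%:R `^ p + (#|G| - 3)%:R * (3 + 2)%:R `^ p.
    by move=> cL dL /deg_pow_iso ->; rewrite (deg_pow_join_regular _ _ dL) cL -cL addKn.
  have deg_union (L : sgraph) : union_of_C3_C4 L -> forall v : L, degree v = 2.
    by case=> a [b [f bf f_adj]] v; rewrite -(graph_iso_degree v bf f_adj) degree_C3_C4_union.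
  (* The 9 ensures n - 3 >= 6, from where every integer is a sum of threes and fours. *)
  exists (n0 + 9)%N => n nn0 G Gn freeG; split=> [[_ _ ext]|[L [cL uL iso]]].
    have [a [b ab]] := @C3_C4_sum (n - 3) ltac:(lia).
    have cU : #|join (complete 3) (C3_C4_union a b)| = n.
      by rewrite card_join card_C3_C4_union -ab; lia.
    have lower := ex_pow_ge p cU (@C3_C4_union_free a b); rewrite -ext in lower.
    have [|||L [cL dL iso]] := n0P G => //; first by lia.
      apply: le_trans lower; rewrite (deg_pow_join_regular _ _ (@degree_C3_C4_union a b)).
      by rewrite -card_join cU card_C3_C4_union -ab Gn.
    exists L; split=> //; first by rewrite -Gn.
    apply: path5_free_union => //; apply: path5_free_of_join.
    by move=> /(graph_iso_contains (graph_iso_sym iso)).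
  (* An extremal graph H reaches the value of G, so it is a join of the same kind; the value of e_p
     at such joins depends on n only, so G attains the maximum too. *)
  have [H [Hn freeH extH]] := ex_pow_attained p Gn freeG.
  have lower := ex_pow_ge p Gn freeG.
  have GE := valE G L ltac:(by rewrite Gn) (deg_union L uL) iso.
  split=> //; rewrite -extH GE.
  have [|||L' [cL' dL' iso']] := n0P H => //; first by lia.
    by rewrite extH; apply: le_trans lower; rewrite GE Gn Hn.
  by rewrite (valE H L') // Hn Gn.
have [q [C [qp C0 bound]]] := hypercube_high_degree_bound d2 dp.
set s := (2 ^ d.-1).-1; have -> : (2 ^ d.-1 - 1)%N = s by rewrite subn1.
have p2 : 2 <= p.
  apply: le_trans (ltW dp); rewrite alphaE //.
  have N2 : (1 < 2 ^ d.-1)%N by rewrite -[1%N]/(2 ^ 0)%N ltn_exp2l // -ltnS prednK // ltnW.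
  rewrite ler_pdivlMr ?ltr0n; last by rewrite -ltnS prednK // ltnW.
  by rewrite -(natrM _ 2) ler_nat double_pred_exp_le.
have [n0 n0P] := join_regular_of_deg_pow d2 p2 qp C0 bound; rewrite -/s in n0P.
exists (n0 + s)%N => n nn0 nd G Gn freeG ext.
have sn : (s <= n)%N by apply: leq_trans nn0; rewrite leq_addl.
(* The congruence lets n - s vertices be split into k copies of K_d, which gives the comparison
   graph K_s v k K_d. *)
have [k nk] : exists k, (n - s = k * d)%N.
  by exists ((n - s) %/ d)%N; rewrite divnK // -eqn_mod_dvd //; apply/eqP.
have cU : #|join (complete s) (copies k (complete d))| = n.
  by rewrite card_join card_prod !card_ord -nk subnKC.
have dU (u : copies k (complete d)) : degree u = d.-1 by rewrite degree_copies degree_complete.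
have lower := ex_pow_ge p cU (@copies_complete_free d k (ltnW d2)); rewrite -ext in lower.
have [|||L [cL dL iso]] := n0P G => //; first by rewrite Gn (leq_trans _ nn0) // leq_addr.
  apply: le_trans lower; rewrite (deg_pow_join_regular _ _ dU).
  by rewrite -card_join cU card_prod !card_ord -nk Gn.
exists L; split; [by rewrite -Gn | | by []].
rewrite /near_regular; have -> : #|L| = (k * d)%N by rewrite -nk -Gn -cL addKn.
by rewrite odd_pred_mul.
Qed.
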